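(* Let $X$ be a symmetrically self-similar graph, $d$ its transition function, $A_0^*$ the immediate basin of attraction of the fixed point $0$ of $d$ (the component of the basin of attraction of $0$ containing $0$), $\mathcal{D}$ the discrete exceptional set and $\mathcal{S}$ the set of all singularities of all Green functions. Then every Green function $G(x,y|\cdot)$, $x,y\in VX$, has a unique analytic continuation to $A_0^*\setminus\mathcal{S}$, this set contains $A_0^*\setminus\mathcal{D}$, and \[\operatorname{spec}^{-1}P\ \subset\ \overline{\mathbb{C}}\setminus(A_0^*\setminus\mathcal{S})\ \subset\ \overline{\mathbb{C}}\setminus(A_0^*\setminus\overline{\mathcal{D}}),\] where $\overline{\mathcal{D}}$ is the closure of $\mathcal{D}$.
   Context: Graphs are connected, locally finite, infinite, undirected, without loops or multiple edges. For $C\subseteq VX$, $\theta C$ is the set of vertices of $VX\setminus C$ adjacent to a vertex of $C$, and $\overline C=C\cup\theta C$. For $F\subseteq VX$, $\mathcal{C}_X(F)$ is the set of connected components (as vertex sets) of the subgraph induced on $VX\setminus F$. The reduced graph $X_F$ has vertex set $F$, distinct $x,y$ adjacent iff $x,y\in\theta C$ for some $C\in\mathcal{C}_X(F)$. $X$ is self-similar with respect to $F$ if (F1) no two vertices of $F$ are adjacent in $X$, (F2) distinct $C,D\in\mathcal{C}_X(F)$ satisfy $|\overline C\cap\overline D|\le1$, (F3) there is a graph isomorphism $\psi:X\to X_F$. Elements of $\mathcal{C}_X(F)$ are cells; $\hat C$ is the subgraph induced on $\overline C$. Symmetrically self-similar: additionally (S1) all cells finite and for any cells $C,D$ an isomorphism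 $\alpha:\hat C\to\hat D$ with $\alpha(\theta C)=\theta D$ exists, and (S3) automorphisms of $\hat C$ preserving $\theta C$ act doubly transitively on $\theta C$. $\theta_X=|\theta C|$. $P$: simple random walk transition operator, $p(x,y)=1/\deg_X x$ for $x\sim y$, on $\ell^2(X)$ weighted by $\deg_X$; $G(x,y|z)=\sum_n p^{(n)}(x,y)z^n$ for $|z|<1$; $\operatorname{spec}^{-1}P=\{1/\lambda:\lambda\in\operatorname{spec}P\}\subset\overline{\mathbb{C}}$. $Q_B$ for $B\subseteq\theta C$: $q_B(x,y)=1/\deg_{\hat C}x$ if $x\sim y$, $x\notin B$, else 0; $Q_B^*(z)=(I-zQ_B)^{-1}$. For distinct $v,w\in\theta C$: $d(z)=(\theta_X-1)(Q^*_{\theta C\setminus\{v\}}(z))_{v,w}$, $f(z)=(Q^*_{\theta C\setminus\{v\}}(z))_{v,v}$; $h_C(x,y|z)=(Q^*_{\theta C}(z))_{x,y}$ for $x\in C,y\in\overline C$; $\operatorname{poles}(\hat C)$ is the union of poles of these $h_C$. $\mathcal{D}=\bigcup_{n\ge0}d^{-n}(\operatorname{poles}(f)\cup\operatorname{poles}(\hat C))$.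
   Formalization: The inclusion of spec^{-1}P in the complement of A_0^*∖S is proved for spec^{-1}P without the point ∞: when 0 is an isolated eigenvalue of P, all Green functions can be analytic at ∞ ∈ A_0^*∖D although ∞ ∈ spec^{-1}P, so the literal inclusion can fail there. *)

(* Defs.v *)
From HB Require Import structures.
From mathcomp Require Import all_boot all_order all_algebra.
From mathcomp Require Import generic_quotient fraction finmap.
From mathcomp Require Import all_classical all_reals all_analysis.
From mathcomp Require Import complex.

Set Implicit Arguments.
Unset Strict Implicit.
Unset Printing Implicit Defensive.

Import Order.TTheory GRing.Theory Num.Theory.
Import numFieldNormedType.Exports.

Local Open Scope classical_set_scope.
Local Open Scope complex_scope.
Local Open Scope quotient_scope.
Local Open Scope ring_scope.

(* A simple graph with vertex set V is a symmetric irreflexive [e : rel V];   *)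
(* vertex subsets are classical sets.                                         *)

Definition gnbr (V : choiceType) (e : rel V) (x : V) : set V :=
  [set y | e x y].

Definition gdeg (V : choiceType) (e : rel V) (x : V) : nat :=
  #|` fset_set (gnbr e x)|.

(* y is reachable from x by a walk all of whose vertices lie in A *)
Definition greach (V : choiceType) (e : rel V) (A : set V) (x y : V) : Prop :=
  exists p : seq V, [/\ path e x p, last x p = y &
    forall u, u \in x :: p -> A u].

Definition graph_ax (V : choiceType) (e : rel V) : Prop :=
  [/\ symmetric e, irreflexive e,
      forall x y, greach e setT x y,
      forall x, finite_set (gnbr e x) &
      infinite_set [set: V]].

Definition theta (V : choiceType) (e : rel V) (C : set V) : set V :=
  [set y | ~ C y /\ exists2 x, C x & e x y].

Definition gbar (V : choiceType) (e : rel V) (C : set V) : set V :=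
  C `|` theta e C.

Definition cells (V : choiceType) (e : rel V) (F : set V) : set (set V) :=
  [set C | exists2 x, (~` F) x & C = [set y | greach e (~` F) x y]].

Definition reduced_adj (V : choiceType) (e : rel V) (F : set V) (x y : V) :
    Prop :=
  [/\ F x, F y, x <> y & exists C, [/\ cells e F C, theta e C x & theta e C y]].

Definition self_similar (V : choiceType) (e : rel V) (F : set V) : Prop :=
  [/\ (* F1 *) forall x y, F x -> F y -> ~~ e x y,
      (* F2 *) forall C D, cells e F C -> cells e F D -> C <> D ->
                 (gbar e C `&` gbar e D #<= `I_1)%card &
      (* F3 *) exists psi : V -> V, set_bij setT F psi /\
                 forall x y, e x y <-> reduced_adj e F (psi x) (psi y)].

(* alpha restricts to an isomorphism between the induced subgraphs on gbar C  *)
(* and gbar D which maps theta C onto theta D                                 *)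
Definition cell_iso (V : choiceType) (e : rel V) (C D : set V) (alpha : V -> V)
    : Prop :=
  [/\ set_bij (gbar e C) (gbar e D) alpha,
      forall x y, gbar e C x -> gbar e C y -> e (alpha x) (alpha y) = e x y &
      alpha @` theta e C = theta e D].

Definition symmetrically_self_similar (V : choiceType) (e : rel V) (F : set V) :
    Prop :=
  [/\ self_similar e F,
      (* S1 *) (forall C, cells e F C -> finite_set C) /\
               (forall C D, cells e F C -> cells e F D ->
                  exists alpha, cell_iso e C D alpha) &
      (* S3 *) forall C, cells e F C -> forall x y x' y',
                 theta e C x -> theta e C y -> x <> y ->
                 theta e C x' -> theta e C y' -> x' <> y' ->
                 exists alpha, [/\ cell_iso e C C alpha, alpha x = x' &
                                   alpha y = y']].

Definition theta_card (V : choiceType) (e : rel V) (C : set V) : nat :=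
  #|` fset_set (theta e C)|.

Definition srw_p (R : realType) (V : choiceType) (e : rel V) (x y : V) : R[i] :=
  if e x y then (gdeg e x)%:R^-1 else 0.

Definition srw_op (R : realType) (V : choiceType) (e : rel V)
    (phi : V -> R[i]) (x : V) : R[i] :=
  \sum_(y \in gnbr e x) srw_p R e x y * phi y.

(* p^(n)(x, y) = (P^n delta_y)(x) *)
Definition srw_pn (R : realType) (V : choiceType) (e : rel V) (n : nat)
    (x y : V) : R[i] :=
  iter n (srw_op (R := R) e) (fun u => (u == y)%:R) x.

(* only meaningful for `|z| < 1 *)
Definition green (R : realType) (V : choiceType) (e : rel V) (x y : V)
    (z : R[i]) : R[i]^o :=
  limn (series (fun n => (srw_pn R e n x y * z ^+ n : R[i]^o))).

Definition l2norm2 (R : realType) (V : choiceType) (e : rel V)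
    (phi : V -> R[i]) : \bar R :=
  \esum_(x in [set: V]) ((gdeg e x)%:R * Normc.normc (phi x) ^+ 2)%:E.

Definition l2 (R : realType) (V : choiceType) (e : rel V) : set (V -> R[i]) :=
  [set phi | (l2norm2 e phi < +oo)%E].

Definition bounded_op (R : realType) (V : choiceType) (e : rel V)
    (T : (V -> R[i]) -> (V -> R[i])) : Prop :=
  [/\ forall phi, l2 e phi -> l2 e (T phi),
      forall (a : R[i]) phi chi, l2 e phi -> l2 e chi ->
        T (fun x => a * phi x + chi x) = (fun x => a * T phi x + T chi x) &
      exists M : R, forall phi, l2 e phi ->
        (l2norm2 e (T phi) <= M%:E * l2norm2 e phi)%E].

Definition specP (R : realType) (V : choiceType) (e : rel V) : set R[i] :=
  [set lambda | ~ exists T, [/\ bounded_op e T,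
     forall phi, l2 e phi ->
       T (fun x => lambda * phi x - srw_op e phi x) = phi &
     forall phi, l2 e phi ->
       (fun x => lambda * T phi x - srw_op e (T phi) x) = phi]].

(* The Riemann sphere: [None] is the point at infinity. *)
Definition csphere (R : realType) := one_point_compactification R[i]^o.

HB.instance Definition _ (R : realType) := Topological.on (csphere R).

Definition csphere_inv (R : realType) (z : R[i]) : csphere R :=
  if z == 0 then None else Some z^-1.

(* Beware of the point at infinity: G(x, y | z) is a matrix coefficient of    *)
(* w (w - P)^-1 with w = 1 / z, so if 0 is an isolated eigenvalue of P, all   *)
(* Green functions are analytic at infinity although infinity is in this set. *)
Definition spec_invP (R : realType) (V : choiceType) (e : rel V) :
    set (csphere R) :=
  @csphere_inv R @` specP e.

(* h |-> csphere_chart z h is a holomorphic chart centred at z *)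
Definition csphere_chart (R : realType) (z : csphere R) (h : R[i]) : csphere R :=
  if z is Some c then Some (c + h) else csphere_inv h.

Definition analytic_at (R : realType) (g : csphere R -> R[i]) (z : csphere R) :
    Prop :=
  exists (a : nat -> R[i]) (r : R), 0 < r /\
    forall h : R[i], `|h| < r%:C ->
      series (fun n => (a n * h ^+ n : R[i]^o)) @ \oo
        --> (g (csphere_chart z h) : R[i]^o).

Definition unit_disc (R : realType) : set (csphere R) :=
  [set Some z | z in [set z : R[i] | `|z| < 1]].

(* g is an analytic continuation to U of the germ f, given on the unit disc *)
Definition continuation (R : realType) (f : R[i] -> R[i]) (U : set (csphere R))
    (g : csphere R -> R[i]) : Prop :=
  [/\ open U, @unit_disc R `<=` U, forall z, U z -> analytic_at g z &
      forall z : R[i], `|z| < 1 -> g (Some z) = f z].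

Definition unique_continuation (R : realType) (f : R[i] -> R[i])
    (U : set (csphere R)) : Prop :=
  exists2 g, continuation f U g &
    forall g', continuation f U g' -> forall z, U z -> g' z = g z.

(* The points of A to which some Green function cannot be continued           *)
(* analytically inside A. Outside A other branches of a Green function could  *)
(* be reached, so the domains of continuation must stay in A.                 *)
Definition green_singularities (R : realType) (V : choiceType) (e : rel V)
    (A : set (csphere R)) : set (csphere R) :=
  [set z | A z /\ exists x y, ~ exists U g,
     [/\ connected U, U `<=` A, U z & continuation (green e x y) U g]].

Definition ratfun (R : realType) := {fraction {poly R[i]}}.

Definition rat_num (R : realType) (r : ratfun R) : {poly R[i]} :=
  (frac (repr r)).1 %/ gcdp (frac (repr r)).1 (frac (repr r)).2.

Definition rat_den (R : realType) (r : ratfun R) : {poly R[i]} :=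
  (frac (repr r)).2 %/ gcdp (frac (repr r)).1 (frac (repr r)).2.

(* a rational function as a self-map of the sphere, through its reduced form *)
Definition rat_map (R : realType) (r : ratfun R) (z : csphere R) : csphere R :=
  let p := rat_num r in let q := rat_den r in
  if z is Some c then
    if q.[c] == 0 then None else Some (p.[c] / q.[c])
  else if (size q < size p)%N then None
  else Some (p`_(size q).-1 / lead_coef q).

Definition poles (R : realType) (r : ratfun R) : set (csphere R) :=
  [set z | rat_map r z = None].

(* degree in the induced subgraph on gbar C *)
Definition cell_deg (V : choiceType) (e : rel V) (C : set V) (x : V) : nat :=
  #|` fset_set (gnbr e x `&` gbar e C)|.

Definition Q_coef (R : realType) (V : choiceType) (e : rel V) (C B : set V)
    (x y : V) : R[i] :=
  if e x y && (x \notin B) then (cell_deg e C x)%:R^-1 else 0.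

Definition Q_mx (R : realType) (V : choiceType) (e : rel V) (C B : set V) :
    'M[R[i]]_(#|{: fset_set (gbar e C)}|) :=
  \matrix_(i, j) Q_coef R e C B (val (enum_val i)) (val (enum_val j)).

Definition Qstar_mx (R : realType) (V : choiceType) (e : rel V) (C B : set V) :
    'M[ratfun R]_(#|{: fset_set (gbar e C)}|) :=
  invmx (1%:M - map_mx (fun a => FracField.tofrac ('X * a%:P)) (Q_mx R e C B)).

(* set to 0 if x or y is not in gbar C *)
Definition Qstar (R : realType) (V : choiceType) (e : rel V) (C B : set V)
    (x y : V) : ratfun R :=
  match insub x, insub y with
  | Some i, Some j => Qstar_mx R e C B (enum_rank i) (enum_rank j)
  | _, _ => 0
  end.

Definition d_fun (R : realType) (V : choiceType) (e : rel V) (C : set V)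
    (v w : V) : ratfun R :=
  ((theta_card e C)%:R - 1) * Qstar R e C (theta e C `\ v) v w.

Definition f_fun (R : realType) (V : choiceType) (e : rel V) (C : set V)
    (v : V) : ratfun R :=
  Qstar R e C (theta e C `\ v) v v.

Definition h_fun (R : realType) (V : choiceType) (e : rel V) (C : set V)
    (x y : V) : ratfun R :=
  Qstar R e C (theta e C) x y.

Definition cell_poles (R : realType) (V : choiceType) (e : rel V) (C : set V) :
    set (csphere R) :=
  [set z | exists x y, [/\ C x, gbar e C y & poles (h_fun R e C x y) z]].

Definition exceptional_set (R : realType) (V : choiceType) (e : rel V)
    (C : set V) (v w : V) : set (csphere R) :=
  [set z | exists n, (poles (f_fun R e C v) `|` @cell_poles R V e C)
                       (iter n (rat_map (d_fun R e C v w)) z)].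

Definition basin0 (R : realType) (phi : csphere R -> csphere R) :
    set (csphere R) :=
  [set z | iter n phi z @[n --> \oo] --> (Some 0 : csphere R)].

Definition immediate_basin0 (R : realType) (phi : csphere R -> csphere R) :
    set (csphere R) :=
  connected_component (basin0 phi) (Some 0 : csphere R).

(* Main.v *)
From HB Require Import structures.
From mathcomp Require Import all_boot all_order all_algebra.
From mathcomp Require Import generic_quotient fraction finmap.
From mathcomp Require Import all_classical all_reals all_analysis.
From mathcomp Require Import complex.
From mathcomp Require Import ring lra zify.
Require Import Defs.

(** A function on [V] that solves [g = z P g] off [F] solves, along [F], an
    equation of the same form for the reduced graph with [z] replaced by [d z];
    hence [G (psi x) (psi y) z = f z * G x y (d z)], and solving the Dirichlet
    problem in the cells extends this to a formula for [G x y z] in terms of the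
    values [G _ _ (d z)] and of rational functions of [z] with poles in
    [poles f] and [cell_poles]. Since [|d z| <= |z| ^ 2] in the unit disc, a
    point of the basin enters the disc after finitely many iterations of [d];
    iterating the formula defines the continuation on [A0] minus [D], and [D] is
    locally finite in [A0] because [d] is not constant.

    For the spectrum, the same formula shows that the row sums of the continued
    kernel grow at most like a power of [1 / |h|] at distance [h] from any point
    of [A0]. At a point outside [S] the maximum principle turns this into a
    bound on the row sums at the point itself; the kernel is reversible, so by
    Schur's test it is a bounded operator on [l2], and the identity
    [G = 1 + z P G] makes it the resolvent. *)

Set Implicit Arguments.
Unset Strict Implicit.
Unset Printing Implicit Defensive.

Import Order.TTheory GRing.Theory Num.Theory.
Import numFieldNormedType.Exports.

Local Open Scope classical_set_scope.
Local Open Scope complex_scope.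
Local Open Scope ring_scope.

(** * Complex series *)

(** Where the constants come from: two vertices adjacent in the reduced graph lie on the boundary of
    exactly one common cell, and each boundary vertex has the same number [delta] of neighbours in
    every cell it bounds. Summing the Dirichlet equations of the cells around [psi x] therefore
    reproduces the transition operator of the reduced graph, with the factor [theta_card e C - 1] of
    [d_fun]. The square in the bound of [d z] reflects that boundary vertices are never adjacent.

    What shapes the spectral part is the gap between [D] and [S]: at a point of [D] outside [S]
    every Green function extends, yet the recursive formula bounds nothing there. It does bound
    whole rows on a small circle around the point, uniformly in the row and in the finite set of
    columns; finite sums of entries with coefficients of modulus at most 1 are analytic inside, so
    the constant passes to the centre. The growth exponent only serves to keep the estimate stable
    under pullback by [d].

    Local analysis rests on absolutely summable coefficients, where products, compositions and
    series of functions all become rearrangements of double sums. *)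

Notation nc := Normc.normc.

Section ComplexSeries.
Variable R : realType.
Local Notation C := R[i].
Implicit Types (z : C) (a b : nat -> C).

Lemma norm_nc z : `|z| = (nc z)%:C. Proof. by []. Qed.

Lemma nc_ge0 z : 0 <= nc z.
Proof. by rewrite -ler0c -norm_nc. Qed.

Lemma ncD x y : nc (x + y : C) <= nc x + nc y.
Proof. by rewrite -lecR rmorphD /= -!norm_nc ler_normD. Qed.

Lemma ncN z : nc (- z) = nc z.
Proof. by apply: complexI; rewrite -!norm_nc normrN. Qed.

Lemma ncBC x y : nc (x - y : C) = nc (y - x).
Proof. by rewrite -ncN opprB. Qed.

Lemma nc0 : nc (0 : C) = 0. Proof. exact: Normc.normc0. Qed.
Lemma nc1 : nc (1 : C) = 1. Proof. exact: Normc.normc1. Qed.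

Lemma ncM x y : nc (x * y : C) = nc x * nc y.
Proof. exact: Normc.normcM. Qed.

Lemma ncV x : nc (x^-1 : C) = (nc x)^-1.
Proof. exact: Normc.normcV. Qed.

Lemma ncX x n : nc (x ^+ n : C) = nc x ^+ n.
Proof. by elim: n => [|n IH]; rewrite ?expr0 ?nc1// !exprS ncM IH. Qed.

Lemma nc_eq0 x : (nc (x : C) == 0) = (x == 0).
Proof.
apply/eqP/eqP => [/Normc.eq0_normc//|->]; exact: nc0.
Qed.

Lemma nc_gt0 x : (0 < nc (x : C)) = (x != 0).
Proof. by rewrite lt_def nc_ge0 andbT nc_eq0. Qed.

Lemma nc_real (x : R) : nc x%:C = `|x|.
Proof. by rewrite /= expr0n /= addr0 sqrtr_sqr. Qed.

Lemma nc_nat n : nc (n%:R : C) = n%:R.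
Proof.
have -> : (n%:R : C) = (n%:R : R)%:C by rewrite rmorph_nat.
by rewrite nc_real ger0_norm.
Qed.

Lemma nc_sum (I : Type) (r : seq I) (P : pred I) (f : I -> C) :
  nc (\sum_(i <- r | P i) f i) <= \sum_(i <- r | P i) nc (f i).
Proof.
rewrite -lecR -norm_nc rmorph_sum /=.
exact: (le_trans (ler_norm_sum _ _ _)).
Qed.

Lemma nc_Re z : `|complex.Re z| <= nc z.
Proof. by rewrite -lecR; exact: normc_ge_Re. Qed.

Lemma nc_Im z : `|complex.Im z| <= nc z.
Proof.
have := nc_Re (z * 'i); rewrite ReiNIm normrN ncM.
suff -> : nc ('i : C) = 1 by rewrite mulr1.
by rewrite /= expr0n /= add0r expr1n sqrtr1.
Qed.

Lemma nc_le z : nc z <= `|complex.Re z| + `|complex.Im z|.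
Proof.
rewrite {1}(complexE z); apply: (le_trans (ncD _ _)).
rewrite ncM !nc_real.
suff -> : nc ('i : C) = 1 by rewrite mul1r.
by rewrite /= expr0n /= add0r expr1n sqrtr1.
Qed.

(** The device behind all estimates of sums of moduli: with such factors [u], a sum of moduli is the
    modulus of one linear combination, to which linear or analytic arguments apply. *)
Lemma phase z : exists2 u, nc u <= 1 & u * z = (nc z)%:C.
Proof.
have [->|z0] := eqVneq z 0; first by exists 0; rewrite ?nc0 ?mul0r.
exists ((nc z)%:C / z); last by rewrite mulfVK.
by rewrite ncM ncV nc_real ger0_norm ?nc_ge0// divff// nc_eq0.
Qed.

(** The norm of [R[i]] takes values in [R[i]]; this form of convergence keeps [eps] real. *)
Definition tends (u : nat -> C) l := forall eps : R, 0 < eps ->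
  exists N, forall n, (N <= n)%N -> nc (u n - l) < eps.

Lemma cvg_tends (u : nat -> C) l :
  ((u : nat -> C^o) @ \oo --> (l : C^o)) <-> tends u l.
Proof.
split.
  move=> /cvgrPdist_lt H eps e0.
  have /H [N _ HN] : 0 < eps%:C by rewrite ltcR.
  exists N => n Nn; have := HN n Nn.
  by rewrite /= norm_nc ltcR ncBC.
move=> H; apply/cvgrPdist_lt => eps e0.
have [k ek] : exists k, eps = k%:C by apply/complex_realP; rewrite realE ltW.
rewrite ek ltcR in e0 *.
have [N HN] := H _ e0.
exists N => // n /= Nn; rewrite norm_nc ltcR ncBC; exact: HN.
Qed.

(** The value is arbitrary for a divergent series, so lemmas about it carry bounds [summ] or
    vanishing tails. *)
Definition csum a : C := limn (series (a : nat -> C^o)).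

Definition summ a (M : R) := forall n, \sum_(k < n) nc (a k) <= M.

Lemma summ_ge0 a M : summ a M -> 0 <= M.
Proof. by move/(_ 0%N); rewrite big_ord0. Qed.

Lemma summ_real_cvg (u : nat -> R) M : (forall n, \sum_(k < n) `|u k| <= M) ->
  exists l, forall eps : R, 0 < eps ->
    exists N, forall n, (N <= n)%N -> `|\sum_(k < n) u k - l| < eps.
Proof.
move=> H.
have cv : cvgn (series (u : R^nat)).
  apply: normed_cvg; apply: nondecreasing_is_cvgn.
    apply/nondecreasing_seqP => n; rewrite /= !seriesEord /=.
    by rewrite big_ord_recr /= lerDl.
  by exists M => _ [n _ <-]; rewrite /= seriesEord /=; exact: H.
exists (limn (series (u : R^nat))) => eps e0.
have /cvgrPdist_lt/(_ eps e0) [N _ HN] := cv.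
by exists N => n /HN; rewrite /= seriesEord /= distrC.
Qed.

Lemma csumE a (l : C) : tends (fun n => \sum_(k < n) a k) l -> csum a = l.
Proof.
move=> H; apply: (@cvg_lim C^o (@norm_hausdorff _ C^o)).
by rewrite seriesEord; apply/cvg_tends.
Qed.

(** Real and imaginary parts are absolutely convergent real series, being dominated by the
    modulus. *)
Lemma csumP a M : summ a M -> tends (fun n => \sum_(k < n) a k) (csum a).
Proof.
move=> H.
have [lr Hr] : exists l, forall eps : R, 0 < eps ->
    exists N, forall n, (N <= n)%N -> `|\sum_(k < n) complex.Re (a k) - l| < eps.
  apply: (@summ_real_cvg (fun k => complex.Re (a k)) M) => n.
  by apply: le_trans (H n); apply: ler_sum => k _; exact: nc_Re.
have [li Hi] : exists l, forall eps : R, 0 < eps ->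
    exists N, forall n, (N <= n)%N -> `|\sum_(k < n) complex.Im (a k) - l| < eps.
  apply: (@summ_real_cvg (fun k => complex.Im (a k)) M) => n.
  by apply: le_trans (H n); apply: ler_sum => k _; exact: nc_Im.
have T : tends (fun n => \sum_(k < n) a k) (Complex lr li).
  move=> eps e0; have e2 : 0 < eps / 2 by rewrite divr_gt0.
  have [N1 H1] := Hr _ e2; have [N2 H2] := Hi _ e2.
  exists (maxn N1 N2) => n; rewrite geq_max => /andP[n1 n2].
  apply: (le_lt_trans (nc_le _)).
  have RE (x y : C) : complex.Re (x - y) = complex.Re x - complex.Re y
    by case: x y => [? ?] [? ?].
  have IE (x y : C) : complex.Im (x - y) = complex.Im x - complex.Im y
    by case: x y => [? ?] [? ?].
  have RS : complex.Re (\sum_(k < n) a k) = \sum_(k < n) complex.Re (a k).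
    by apply: (big_morph (fun z : C => complex.Re z)) => //; case=> ? ? [].
  have IS : complex.Im (\sum_(k < n) a k) = \sum_(k < n) complex.Im (a k).
    by apply: (big_morph (fun z : C => complex.Im z)) => //; case=> ? ? [].
  rewrite RE IE RS IS /= [eps]splitr; apply: ltrD; [exact: H1|exact: H2].
suff -> : csum a = Complex lr li by [].
exact: csumE.
Qed.

Lemma csum_le a M : summ a M -> nc (csum a) <= M.
Proof.
move=> H; apply/ler_addgt0Pr => eps e0.
have [N HN] := csumP H e0.
have -> : csum a = \sum_(k < N) a k - (\sum_(k < N) a k - csum a) by ring.
apply: (le_trans (ncD _ _)); rewrite ncN; apply: lerD.
  exact: le_trans (nc_sum _ _ _) (H N).
exact/ltW/HN.
Qed.

Lemma summD a b M N : summ a M -> summ b N ->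
  summ (fun n => a n + b n) (M + N).
Proof.
move=> Ha Hb n; apply: le_trans (lerD (Ha n) (Hb n)).
by rewrite -big_split /=; apply: ler_sum => k _; exact: ncD.
Qed.

Lemma summZ c a M : summ a M -> summ (fun n => c * a n) (nc c * M).
Proof.
move=> Ha n; under eq_bigr do rewrite ncM.
by rewrite -mulr_sumr ler_wpM2l ?nc_ge0.
Qed.

Lemma summ_le a b M : summ b M -> (forall n, nc (a n) <= nc (b n)) -> summ a M.
Proof. by move=> Hb H n; apply: le_trans (Hb n); exact: ler_sum. Qed.

Lemma csumD a b M N : summ a M -> summ b N ->
  csum (fun n => a n + b n) = csum a + csum b.
Proof.
move=> Ha Hb; apply: csumE => eps e0.
have e2 : 0 < eps / 2 by rewrite divr_gt0.
have [N1 H1] := csumP Ha e2; have [N2 H2] := csumP Hb e2.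
exists (maxn N1 N2) => n; rewrite geq_max => /andP[n1 n2].
have -> : \sum_(k < n) (a k + b k) - (csum a + csum b) =
  (\sum_(k < n) a k - csum a) + (\sum_(k < n) b k - csum b).
  by rewrite big_split /=; ring.
apply: (le_lt_trans (ncD _ _)); rewrite [eps]splitr; apply: ltrD.
  exact: H1.
exact: H2.
Qed.

Lemma csumZ c a M : summ a M -> csum (fun n => c * a n) = c * csum a.
Proof.
move=> Ha; apply: csumE => eps e0.
have c1 : 0 < nc c + 1 by rewrite ltr_wpDl ?nc_ge0.
have [N HN] := csumP Ha (divr_gt0 e0 c1).
exists N => n Nn; rewrite -mulr_sumr -mulrBr ncM.
apply: (@le_lt_trans _ _ ((nc c + 1) * nc (\sum_(i < n) a i - csum a))).
  by rewrite ler_wpM2r ?nc_ge0// lerDl.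
by rewrite mulrC -ltr_pdivlMr//; exact: HN.
Qed.

Lemma csumB a b M N : summ a M -> summ b N ->
  csum (fun n => a n - b n) = csum a - csum b.
Proof.
move=> Ha Hb; rewrite -mulN1r -(csumZ _ Hb) -(csumD Ha (summZ (-1) Hb)).
by congr csum; apply: funext => n; rewrite mulN1r.
Qed.

Lemma csum_fin a n : (forall k, (n <= k)%N -> a k = 0) ->
  csum a = \sum_(k < n) a k.
Proof.
move=> H; apply: csumE => eps e0; exists n => m nm.
suff -> : \sum_(k < m) a k = \sum_(k < n) a k by rewrite subrr nc0.
rewrite -!(big_mkord xpredT) (big_cat_nat _ nm) //= [X in _ + X]big1_seq ?addr0//.
by move=> i; rewrite mem_index_iota => /andP[_ /andP[ni _]]; exact: H.
Qed.

Lemma csum_sum (I : Type) (r : seq I) (P : pred I) (f : I -> nat -> C) M :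
  (forall i, P i -> summ (f i) M) ->
  csum (fun n => \sum_(i <- r | P i) f i n) = \sum_(i <- r | P i) csum (f i).
Proof.
move=> H; suff [] : (exists N, summ (fun n => \sum_(i <- r | P i) f i n) N) /\
  csum (fun n => \sum_(i <- r | P i) f i n) = \sum_(i <- r | P i) csum (f i) by [].
elim: r => [|i r [[N IN] IE]].
  split.
    by exists 0 => n; under eq_bigr do rewrite big_nil nc0; rewrite big1.
  by rewrite big_nil (@csum_fin _ 0) ?big_ord0// => k _; rewrite big_nil.
have E n : \sum_(j <- i :: r | P j) f j n =
    (if P i then f i n else 0) + \sum_(j <- r | P j) f j n.
  by rewrite big_cons; case: ifP => _; rewrite ?add0r.
have S0 : summ (fun n => if P i then f i n else 0) `|M|.
  case Pi: (P i) => n; last by under eq_bigr do rewrite nc0; rewrite big1.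
  exact: le_trans (H i Pi n) (ler_norm _).
have -> : (fun n => \sum_(j <- i :: r | P j) f j n) = (fun n =>
    (if P i then f i n else 0) + \sum_(j <- r | P j) f j n) by exact: funext.
split; first by exists (`|M| + N); apply: summD.
rewrite (csumD S0 IN) IE big_cons; case: ifP => _ //.
by rewrite (@csum_fin _ 0) ?big_ord0 ?add0r.
Qed.

Lemma summ_shift a M J : summ a M -> summ (fun n => a (n + J)%N) M.
Proof.
move=> H n; apply: le_trans (H (J + n)%N).
rewrite big_split_ord /= -[leLHS]add0r; apply: lerD.
  by apply: sumr_ge0 => i _; exact: nc_ge0.
by apply: ler_sum => i _; rewrite addnC.
Qed.

Lemma csum_shift a M J : summ a M ->
  csum a = \sum_(n < J) a n + csum (fun n => a (n + J)%N).
Proof.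
move=> H; apply: csumE => eps e0.
have [N HN] := csumP (summ_shift J H) e0.
exists (N + J)%N => n Nn.
have JE : n = (J + (n - J))%N by lia.
rewrite JE big_split_ord /=.
under [X in _ + X - _]eq_bigr do rewrite addnC.
rewrite opprD addrACA subrr add0r; apply: HN; lia.
Qed.

Lemma tail_small (N : nat -> R) M : (forall n, 0 <= N n) ->
  (forall n, \sum_(i < n) N i <= M) -> forall eps : R, 0 < eps ->
  exists J0, forall J n, (J0 <= J)%N -> \sum_(i < n) N (i + J)%N <= eps.
Proof.
move=> N0 NM eps e0.
have [|l Hl] := @summ_real_cvg N M.
  by move=> n; under eq_bigr do rewrite ger0_norm//.
have [J0 HJ] := Hl _ (divr_gt0 e0 (ltr0n R 2)).
exists J0 => J n JJ; have H1 := HJ _ JJ.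
have /HJ H2 : (J0 <= J + n)%N by lia.
rewrite big_split_ord /= in H2.
under eq_bigr do rewrite addnC.
move: H1 H2; rewrite !ltr_distl => /andP[? ?] /andP[? ?]; lra.
Qed.

(** Multiplying the columns by phases turns the sum of the moduli of [m] column sums into the
    modulus of a single series over [n], whose [n]-th term is at most [N n]. *)
Lemma summ_csum (a : nat -> nat -> C) (N : nat -> R) M :
  (forall n m, \sum_(k < m) nc (a n k) <= N n) ->
  (forall n, \sum_(i < n) N i <= M) ->
  (forall k, summ (a^~ k) M) /\ summ (fun k => csum (a^~ k)) M.
Proof.
move=> HN HM.
have S k : summ (a^~ k) M.
  move=> n; apply: le_trans (HM n); apply: ler_sum => i _.
  apply: le_trans (HN i k.+1); rewrite big_ord_recr /= lerDr.
  by apply: sumr_ge0 => ? _; exact: nc_ge0.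
split=> // m.
have /choice[u Hu] : forall k : nat, exists u : C,
    nc u <= 1 /\ u * csum (a^~ k) = (nc (csum (a^~ k)))%:C.
  by move=> k; have [u ? ?] := phase (csum (a^~ k)); exists u.
have -> : \sum_(k < m) nc (csum (a^~ k)) =
    nc (csum (fun n => \sum_(k < m) u k * a n k)).
  rewrite (@csum_sum _ _ _ (fun (k : 'I_m) n => u k * a n k) (1 * M)).
    have E k : csum (fun n => u k * a n k) = (nc (csum (a^~ k)))%:C.
      by rewrite (csumZ _ (S k)); exact: (Hu k).2.
    under [in RHS]eq_bigr do rewrite E.
    rewrite -rmorph_sum nc_real ger0_norm//.
    by apply: sumr_ge0 => k _; exact: nc_ge0.
  move=> k _ n; apply: (le_trans (summZ (u k) (S k) n)).
  by rewrite ler_wpM2r ?(summ_ge0 (S k)) ?(Hu k).1.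
apply: csum_le => n; apply: le_trans (HM n); apply: ler_sum => i _.
apply: le_trans (HN i m); apply: (le_trans (nc_sum _ _ _)).
apply: ler_sum => k _; rewrite ncM -[leRHS]mul1r.
by rewrite ler_wpM2r ?nc_ge0 ?(Hu k).1.
Qed.

(** The first [J] rows may be summed in either order because they are finitely many; what is left of
    the column sums is bounded by the tail of [N]. *)
Lemma csum_fubini (a : nat -> nat -> C) (N : nat -> R) M :
  (forall n m, \sum_(k < m) nc (a n k) <= N n) ->
  (forall n, \sum_(i < n) N i <= M) ->
  csum (fun k => csum (a^~ k)) = csum (fun n => csum (a n)).
Proof.
move=> HN HM; apply/esym/csumE => eps e0.
have N0 n : 0 <= N n by have := HN n 0%N; rewrite big_ord0.
have [S1 S2] := summ_csum HN HM.
have [J0 HJ] := tail_small N0 HM (divr_gt0 e0 (ltr0n R 2)).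
exists J0 => J JJ; rewrite ncBC.
have NM n : N n <= M.
  apply: le_trans (HM n.+1); rewrite big_ord_recr /= lerDr.
  by apply: sumr_ge0.
have SJ n : summ (a n) M by move=> m; exact: le_trans (HN n m) (NM n).
have -> : \sum_(k < J) csum (a k) = csum (fun k => \sum_(n < J) a n k).
  by rewrite (@csum_sum _ _ _ (fun n : 'I_J => a n) M).
have S3 : summ (fun k => \sum_(n < J) a n k) M.
  move=> m; apply: (@le_trans _ _ (\sum_(k < m) \sum_(n < J) nc (a n k))).
    by apply: ler_sum => k _; exact: nc_sum.
  rewrite exchange_big /=; apply: le_trans (HM J); apply: ler_sum => n _.
  exact: HN.
rewrite -(csumB S2 S3).
have -> : (fun k => csum (a^~ k) - \sum_(n < J) a n k) =
    (fun k => csum (fun n => a (n + J)%N k)).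
  apply: funext => k; rewrite (csum_shift J (S1 k)); ring.
have [_ S4] := @summ_csum (fun n => a (n + J)%N) (fun n => N (n + J)%N) (eps / 2)
  (fun n m => HN _ m) (fun n => HJ J n JJ).
by apply: le_lt_trans (csum_le S4) _; lra.
Qed.

End ComplexSeries.

(** * Germs of analytic functions *)

Section Germs.
Variable R : realType.
Local Notation C := R[i].
Implicit Types (k s : C -> C) (rho N M : R).

(* [k] is the sum, on the closed disc of radius [rho], of a power series whose
   Wiener norm at [rho] is at most [N]. *)
Definition wiener rho k N := exists a : nat -> C,
  summ (fun m => a m * rho%:C ^+ m) N /\
  forall h, nc h <= rho -> k h = csum (fun m => a m * h ^+ m).

Lemma nc_rho rho : 0 <= rho -> nc (rho%:C : C) = rho.
Proof. by move=> r0; rewrite nc_real ger0_norm. Qed.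

Lemma summ_rho rho (a : nat -> C) N h : 0 <= rho ->
  summ (fun m => a m * rho%:C ^+ m) N -> nc h <= rho ->
  summ (fun m => a m * h ^+ m) N.
Proof.
move=> r0 H hr; apply: (summ_le H) => n.
rewrite !ncM !ncX nc_rho// ler_wpM2l ?nc_ge0//.
by rewrite lerXn2r ?nnegrE ?nc_ge0.
Qed.

Lemma wiener_le rho k N : 0 <= rho -> wiener rho k N ->
  forall h, nc h <= rho -> nc (k h) <= N.
Proof.
move=> r0 [a [Ha Hk]] h hr; rewrite Hk//; apply: csum_le.
exact: summ_rho hr.
Qed.

Lemma wiener_eq rho k s N : (forall h, nc h <= rho -> s h = k h) ->
  wiener rho k N -> wiener rho s N.
Proof.
by move=> E [a [Ha Hk]]; exists a; split=> // h hr; rewrite E ?Hk.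
Qed.

Lemma wiener_mono rho rho' k N : 0 <= rho' -> rho' <= rho ->
  wiener rho k N -> wiener rho' k N.
Proof.
move=> r0 rr [a [Ha Hk]]; exists a; split.
  by apply: (summ_rho (le_trans r0 rr) Ha); rewrite nc_rho.
by move=> h hr; rewrite Hk// (le_trans hr).
Qed.

(** Without a constant term every monomial gains at least one factor [rho' / rho] when the radius
    shrinks. *)
Lemma wiener_small rho rho' k N : 0 < rho -> 0 <= rho' -> rho' <= rho ->
  wiener rho k N -> k 0 = 0 -> wiener rho' k (N * (rho' / rho)).
Proof.
move=> r0 r'0 rr [a [Ha Hk]] k0; exists a; split; last first.
  by move=> h hr; rewrite Hk// (le_trans hr).
have a0 : a 0%N = 0.
  rewrite -k0 Hk ?nc0 ?ltW// (@csum_fin _ _ 1).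
    by rewrite big_ord1 expr0 mulr1.
  by move=> [//|m] _; rewrite exprS mul0r mulr0.
move=> n; apply: (@le_trans _ _ (\sum_(m < n) nc (a m * rho%:C ^+ m) * (rho' / rho))).
  apply: ler_sum => -[[|m] /= mn] _.
    by rewrite a0 mul0r nc0 mul0r.
  have r0' := ltW r0.
  rewrite !ncM !ncX !nc_rho// -mulrA ler_wpM2l ?nc_ge0//.
  have -> : rho ^+ m.+1 * (rho' / rho) = rho ^+ m * rho'.
    by rewrite exprSr; field; rewrite gt_eqF.
  by rewrite exprSr ler_wpM2r// lerXn2r.
by rewrite -mulr_suml ler_wpM2r ?Ha// divr_ge0// ltW.
Qed.

(** Fubini for the double series of coefficients: the sum of the functions is the power series of
    the summed coefficients. *)
Lemma wiener_csum rho (k : nat -> C -> C) (N : nat -> R) M : 0 < rho ->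
  (forall n, wiener rho (k n) (N n)) -> (forall n, \sum_(i < n) N i <= M) ->
  wiener rho (fun h => csum (fun n => k n h)) M.
Proof.
move=> r0 /choice[a Ha] NM.
have N0 n : 0 <= N n by exact: (summ_ge0 (Ha n).1).
have [S1 S2] := @summ_csum _ (fun n m => a n m * rho%:C ^+ m) N M
  (fun n => (Ha n).1) NM.
have rn0 m : rho%:C ^+ m != 0 :> C.
  by rewrite expf_neq0// -nc_gt0 nc_rho// ltW.
have S3 m : summ (fun n => a n m) (nc (rho%:C ^+ m)^-1 * M).
  apply: (summ_le (summZ (rho%:C ^+ m)^-1 (S1 m))) => n.
  by rewrite mulrC mulfK.
exists (fun m => csum (fun n => a n m)); split.
  apply: (summ_le S2) => m; rewrite [X in _ <= nc (csum X)](_ : _ =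
    (fun n => rho%:C ^+ m * a n m)); last by apply: funext => n; rewrite mulrC.
  by rewrite (csumZ _ (S3 m)) mulrC.
move=> h hr; have -> : (fun n => k n h) = (fun n => csum (fun m => a n m * h ^+ m)).
  by apply: funext => n; rewrite (Ha n).2.
rewrite -(@csum_fubini _ (fun n m => a n m * h ^+ m) N M)//; last first.
  by move=> n; apply: (summ_rho (ltW r0) (Ha n).1).
congr csum; apply: funext => m.
rewrite mulrC -(csumZ _ (S3 m)); congr csum; apply: funext => n.
by rewrite mulrC.
Qed.

Lemma wiener_cst rho (c : C) : wiener rho (fun=> c) (nc c).
Proof.
have F (h : C) m : (0 < m)%N -> (if m == 0%N then c else 0) * h ^+ m = 0.
  by case: m => // m _; rewrite mul0r.
exists (fun m => if m == 0%N then c else 0); split.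
  case=> [|n]; first by rewrite big_ord0 nc_ge0.
  rewrite big_ord_recl /= expr0 mulr1 big1 ?addr0// => i _.
  by rewrite mul0r nc0.
move=> h _; rewrite (@csum_fin _ _ 1) ?big_ord1 ?expr0 ?mulr1// => m m1.
exact: F.
Qed.

Lemma wiener_Z rho c k N : wiener rho k N ->
  wiener rho (fun h => c * k h) (nc c * N).
Proof.
move=> [a [Ha Hk]]; exists (fun m => c * a m).
split.
  by apply: (summ_le (summZ c Ha)) => m; rewrite mulrA.
move=> h hr; have r0 : 0 <= rho by exact: le_trans (nc_ge0 _) hr.
rewrite Hk// -(csumZ _ (summ_rho r0 Ha hr)); congr csum.
by apply: funext => m; rewrite mulrA.
Qed.

Lemma wienerD rho k s N M : wiener rho k N -> wiener rho s M ->
  wiener rho (fun h => k h + s h) (N + M).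
Proof.
move=> [a [Ha Hk]] [b [Hb Hs]]; exists (fun m => a m + b m); split.
  by apply: (summ_le (summD Ha Hb)) => m; rewrite mulrDl.
move=> h hr; have r0 : 0 <= rho by exact: le_trans (nc_ge0 _) hr.
rewrite Hk// Hs// -(csumD (summ_rho r0 Ha hr) (summ_rho r0 Hb hr)).
by congr csum; apply: funext => m; rewrite mulrDl.
Qed.

Lemma wiener_mulX rho k N : 0 <= rho -> wiener rho k N ->
  wiener rho (fun h => h * k h) (rho * N).
Proof.
move=> r0 [a [Ha Hk]].
pose b m : C := if m is m'.+1 then a m' else 0.
have H (h : C) L : summ (fun m => a m * h ^+ m) L ->
    summ (fun m => b m * h ^+ m) (nc h * L).
  move=> HL [|n]; first by rewrite big_ord0 mulr_ge0 ?nc_ge0// (summ_ge0 HL).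
  rewrite big_ord_recl mul0r nc0 add0r.
  apply: le_trans (ler_wpM2l (nc_ge0 h) (HL n)).
  rewrite mulr_sumr; apply: ler_sum => i _.
  have -> : b (lift ord0 i) * h ^+ lift ord0 i = h * (a i * h ^+ i).
    by rewrite lift0 exprS mulrCA.
  by rewrite [leLHS]ncM.
exists b; split.
  by move=> n; apply: (le_trans (H _ _ Ha n)); rewrite nc_rho.
move=> h hr; have Sh := summ_rho r0 Ha hr.
rewrite Hk// (csum_shift 1 (H _ _ Sh)) big_ord1 mul0r add0r -(csumZ _ Sh).
by congr csum; apply: funext => m; rewrite addn1 exprS mulrCA.
Qed.

Lemma wiener_mulXn rho k N n : 0 <= rho -> wiener rho k N ->
  wiener rho (fun h => h ^+ n * k h) (rho ^+ n * N).
Proof.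
move=> r0 H; elim: n => [|n IH].
  by rewrite expr0 mul1r; apply: wiener_eq H => h _; rewrite expr0 mul1r.
rewrite exprS -mulrA; apply: wiener_eq (wiener_mulX r0 IH) => h _.
by rewrite exprS mulrA.
Qed.

(** The product is the series over [n] of [a n * h ^+ n * s h], whose terms have summable Wiener
    norms; this replaces a Cauchy product. *)
Lemma wienerM rho k s N M : 0 < rho -> wiener rho k N -> wiener rho s M ->
  wiener rho (fun h => k h * s h) (N * M).
Proof.
move=> r0 [a [Ha Hk]] Hs.
have M0 : 0 <= M by case: Hs => b [Hb _]; exact: summ_ge0 Hb.
apply: (@wiener_eq _ (fun h => csum (fun n => a n * (h ^+ n * s h)))).
  move=> h hr; rewrite Hk// mulrC -(csumZ _ (summ_rho (ltW r0) Ha hr)).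
  by congr csum; apply: funext => n; ring.
apply: (@wiener_csum _ (fun n h => a n * (h ^+ n * s h))
  (fun n => nc (a n) * (rho ^+ n * M))) => //.
  by move=> n; apply: wiener_Z; apply: wiener_mulXn; rewrite // ltW.
move=> n; under eq_bigr do rewrite mulrA.
rewrite -mulr_suml ler_wpM2r//; apply: le_trans (Ha n).
by apply: ler_sum => i _; rewrite ncM ncX nc_rho// ltW.
Qed.

Lemma wienerX rho k N n : 0 < rho -> wiener rho k N ->
  wiener rho (fun h => k h ^+ n) (N ^+ n).
Proof.
move=> r0 H; elim: n => [|n IH].
  by rewrite expr0 -[X in wiener _ _ X](@nc1 R); exact: wiener_cst.
rewrite exprS; apply: wiener_eq (wienerM r0 H IH) => h _.
by rewrite exprS.
Qed.

Lemma wiener_comp rho s sigma (a : nat -> C) A : 0 < rho ->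
  wiener rho s sigma -> summ (fun n => a n * sigma%:C ^+ n) A ->
  wiener rho (fun h => csum (fun n => a n * s h ^+ n)) A.
Proof.
move=> r0 Hs Ha.
have s0 : 0 <= sigma by case: Hs => b [Hb _]; exact: summ_ge0 Hb.
apply: (@wiener_csum _ (fun n h => a n * s h ^+ n)
  (fun n => nc (a n) * sigma ^+ n)) => //.
  by move=> n; apply: wiener_Z; exact: wienerX.
move=> n; apply: le_trans (Ha n).
by apply: ler_sum => i _; rewrite ncM ncX nc_rho.
Qed.

(** Analyticity at the origin in the form used by [analytic_at]: [analytic_at g z] is convertible to
    [ana0] of [g] read in the chart at [z], so the closure properties below apply to both. *)
Definition ana0 k := exists (a : nat -> C) (r : R), 0 < r /\
  forall h : C, `|h| < r%:C ->
    series (fun n => (a n * h ^+ n : C^o)) @ \oo --> (k h : C^o).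

Lemma bigmax_bound (u : nat -> R) n :
  exists2 B, 0 <= B & forall m, (m < n)%N -> u m <= B.
Proof.
elim: n => [|n [B B0 HB]]; first by exists 0.
exists (B + `|u n|); first by rewrite addr_ge0.
move=> m; rewrite ltnS leq_eqVlt => /orP[/eqP->|/HB H].
  by apply: (le_trans (ler_norm _)); rewrite lerDr.
by apply: (le_trans H); rewrite lerDl.
Qed.

Lemma geom_sum_le (x : R) n : 0 <= x -> x < 1 -> \sum_(k < n) x ^+ k <= (1 - x)^-1.
Proof.
move=> x0 x1; have y0 : 0 < 1 - x by lra.
rewrite -(ler_pM2l y0) divff ?gt_eqF//.
have -> : (1 - x) * (\sum_(k < n) x ^+ k) = 1 - x ^+ n.
  by rewrite -[LHS]opprK -mulNr opprB -subrX1 opprB.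
have := exprn_ge0 n x0; lra.
Qed.

Lemma geom_half_le n : \sum_(k < n) (2^-1 : R) ^+ k <= 2.
Proof.
have h1 : (2^-1 : R) < 1 by lra.
have h0 : 0 <= (2^-1 : R) by lra.
apply: (le_trans (geom_sum_le n h0 h1)).
by rewrite (_ : 1 - 2^-1 = 2^-1 :> R) ?invrK//; lra.
Qed.

(** Convergence at the single radius [q = r / 2] bounds the terms there, and at [q / 2] they are
    dominated by a geometric series. *)
Lemma ana0P k : ana0 k <-> exists rho N, 0 < rho /\ wiener rho k N.
Proof.
split; last first.
  move=> [rho [N [r0 [a [Ha Hk]]]]]; exists a, rho; split=> // h.
  rewrite norm_nc ltcR => hr; rewrite Hk ?ltW// seriesEord; apply/cvg_tends.
  exact: csumP (summ_rho (ltW r0) Ha (ltW hr)).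
move=> [a [r [r0 H]]]; pose q := r / 2.
have q0 : 0 < q by rewrite divr_gt0.
have /H : `|q%:C| < r%:C :> C by rewrite norm_nc ltcR nc_rho ?ltW// /q; lra.
rewrite seriesEord => /cvg_tends /(_ 1 ltr01) [n0 Hn0].
have [B0 B00 HB0] := bigmax_bound (fun m => nc (a m * q%:C ^+ m)) n0.
(* From [n0] on, consecutive partial sums are both within 1 of the limit, so a term is at most 2;
   [B0] covers the earlier terms. *)
pose B := B0 + 2.
have HB m : nc (a m * q%:C ^+ m) <= B.
  have [/HB0|nm] := ltnP m n0; first by rewrite /B; lra.
  have := Hn0 m.+1 (leqW nm); rewrite /= big_ord_recr /= => H1.
  have H2 := Hn0 m nm; rewrite /= in H2.
  set S := \sum_(i < m) _ in H1 H2.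
  have -> : a m * q%:C ^+ m = (S + a m * q%:C ^+ m - k q%:C) - (S - k q%:C) by ring.
  apply: (le_trans (ncD _ _)); rewrite ncN /B.
  lra.
exists (q / 2), (2 * B); split; first by rewrite divr_gt0.
exists a; split.
  move=> n; apply: (@le_trans _ _ (\sum_(m < n) B * 2^-1 ^+ m)).
    apply: ler_sum => m _.
    have -> : ((q / 2)%:C = q%:C * (2^-1)%:C :> C) by rewrite -rmorphM.
    rewrite exprMn mulrA ncM [X in _ * X]ncX nc_rho ?invr_ge0//.
    by rewrite ler_wpM2r ?exprn_ge0 ?invr_ge0.
  have B1 : 0 <= B by rewrite /B; lra.
  by rewrite -mulr_sumr mulrC ler_wpM2r// geom_half_le.
move=> h hr; apply/esym/csumE.
have /H : `|h| < r%:C by rewrite norm_nc ltcR; rewrite /q in hr; lra.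
by rewrite seriesEord => /cvg_tends.
Qed.

Lemma ana0_eq k s r : 0 < r -> (forall h, nc h < r -> s h = k h) ->
  ana0 k -> ana0 s.
Proof.
move=> r0 E [a [r' [r'0 H]]]; exists a, (Num.min r r'); split.
  by rewrite lt_min r0.
move=> h; rewrite norm_nc ltcR lt_min => /andP[h1 h2]; rewrite E//.
by apply: H; rewrite norm_nc ltcR.
Qed.

Lemma ana0_cst c : ana0 (fun=> c).
Proof. by apply/ana0P; exists 1, (nc c); split=> //; exact: wiener_cst. Qed.

Lemma wiener_id rho : 0 <= rho -> wiener rho id rho.
Proof.
move=> r0; have := wiener_mulX r0 (wiener_cst rho 1).
by rewrite nc1 mulr1; apply: wiener_eq => h _; rewrite mulr1.
Qed.

Lemma ana0_id : ana0 id.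
Proof. by apply/ana0P; exists 1, 1; split=> //; exact: wiener_id. Qed.

Lemma ana0_common k s : ana0 k -> ana0 s ->
  exists rho N M, [/\ 0 < rho, wiener rho k N & wiener rho s M].
Proof.
move=> /ana0P[r [N [r0 H]]] /ana0P[r' [N' [r'0 H']]].
have m0 : 0 < Num.min r r' by rewrite lt_min r0.
exists (Num.min r r'), N, N'; split=> //.
  by apply: (wiener_mono (ltW m0) _ H); rewrite ge_min lexx.
by apply: (wiener_mono (ltW m0) _ H'); rewrite ge_min lexx orbT.
Qed.

Lemma ana0D k s : ana0 k -> ana0 s -> ana0 (fun h => k h + s h).
Proof.
move=> Hk Hs; have [rho [N [M [r0 H1 H2]]]] := ana0_common Hk Hs.
by apply/ana0P; exists rho, (N + M); split=> //; exact: wienerD.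
Qed.

Lemma ana0M k s : ana0 k -> ana0 s -> ana0 (fun h => k h * s h).
Proof.
move=> Hk Hs; have [rho [N [M [r0 H1 H2]]]] := ana0_common Hk Hs.
by apply/ana0P; exists rho, (N * M); split=> //; exact: wienerM.
Qed.

Lemma ana0B k s : ana0 k -> ana0 s -> ana0 (fun h => k h - s h).
Proof.
move=> Hk Hs; have := ana0D Hk (ana0M (ana0_cst (-1)) Hs).
by apply: (@ana0_eq _ _ 1) => // h _; rewrite mulN1r.
Qed.

Lemma ana0_sum (I : Type) (r : seq I) (P : pred I) (k : I -> C -> C) :
  (forall i, P i -> ana0 (k i)) -> ana0 (fun h => \sum_(i <- r | P i) k i h).
Proof.
move=> H; elim: r => [|i r IH].
  by apply: ana0_eq (ana0_cst 0) => [|h _]; [exact: ltr01|rewrite big_nil].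
case Pi: (P i).
  apply: ana0_eq (ana0D (H i Pi) IH) => [|h _]; [exact: ltr01|].
  by rewrite big_cons Pi.
by apply: ana0_eq IH => [|h _]; [exact: ltr01|rewrite big_cons Pi].
Qed.

Lemma ana0_sum_seq (I : eqType) (r : seq I) (k : I -> C -> C) :
  (forall i, i \in r -> ana0 (k i)) -> ana0 (fun h => \sum_(i <- r) k i h).
Proof.
move=> H; have -> : (fun h => \sum_(i <- r) k i h) =
    (fun h => \sum_(i <- r | i \in r) k i h).
  by apply: funext => h; rewrite big_seq.
exact: ana0_sum.
Qed.

Lemma ana0_comp k s : ana0 k -> ana0 s -> s 0 = 0 -> ana0 (fun h => k (s h)).
Proof.
move=> /ana0P[sg [A [sg0 Hk]]] /ana0P[rho [N [r0 Hs]]] s0.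
have N0 : 0 <= N by case: Hs => b [Hb _]; exact: summ_ge0 Hb.
(* At radius [t] the Wiener norm of [s] is at most [sg], where the series of [k] converges; [N + 1]
   keeps the quotient defined when [N] is 0. *)
pose t := Num.min rho (rho * sg / (N + 1)).
have t0 : 0 < t by rewrite lt_min r0 divr_gt0 ?mulr_gt0//; lra.
have tr : t <= rho by rewrite ge_min lexx.
have Ht := wiener_small r0 (ltW t0) tr Hs s0.
have Nt : N * (t / rho) <= sg.
  rewrite mulrA ler_pdivrMr//.
  have : t <= rho * sg / (N + 1) by rewrite ge_min lexx orbT.
  rewrite ler_pdivlMr; last by lra.
  by move=> ?; nra.
have Nt0 : 0 <= N * (t / rho) by rewrite mulr_ge0// divr_ge0// ltW.
have [a [Ha Hka]] := wiener_mono Nt0 Nt Hk.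
apply/ana0P; exists t, A; split=> //.
apply: wiener_eq (wiener_comp t0 Ht Ha) => h ht.
by rewrite Hka//; exact: (wiener_le (ltW t0) Ht).
Qed.

Lemma csum_geom (w : C) : nc w < 1 -> csum (fun n => w ^+ n) = (1 - w)^-1.
Proof.
move=> w1; have S : summ (fun n => w ^+ n) (1 - nc w)^-1.
  by move=> n; under eq_bigr do rewrite ncX; rewrite geom_sum_le ?nc_ge0.
have w0 : 1 - w != 0 by rewrite subr_eq0; apply/eqP => E; rewrite -E nc1 ltxx in w1.
apply: (mulfI w0); rewrite divff//.
rewrite mulrBl mul1r -(csumZ _ S) {1}(csum_shift 1 S) big_ord1 expr0.
rewrite -addrA; have -> : (fun n => w ^+ (n + 1)) = (fun n => w * w ^+ n).
  by apply: funext => n; rewrite addn1 exprS.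
by rewrite subrr addr0.
Qed.

Lemma ana0_geom : ana0 (fun w => (1 - w)^-1).
Proof.
apply/ana0P; exists 2^-1, 2; split; first by rewrite invr_gt0.
exists (fun=> 1); split.
  move=> n; under eq_bigr do rewrite mul1r ncX nc_rho ?invr_ge0//.
  exact: geom_half_le.
move=> h hr; rewrite -csum_geom; last by lra.
by congr csum; apply: funext => n; rewrite mul1r.
Qed.

(** With [s = 1 - k / k 0], which vanishes at 0, the inverse is the geometric series at [s] divided
    by [k 0]. *)
Lemma ana0V k : ana0 k -> k 0 != 0 -> ana0 (fun h => (k h)^-1).
Proof.
move=> Hk k0.
pose s h := 1 - (k 0)^-1 * k h.
have Hs : ana0 s by apply: ana0B (ana0_cst _) (ana0M (ana0_cst _) Hk).
have s0 : s 0 = 0 by rewrite /s mulVf// subrr.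
have := ana0M (ana0_cst (k 0)^-1) (ana0_comp ana0_geom Hs s0).
apply: (@ana0_eq _ _ 1) => // h _; rewrite /s.
by rewrite opprB addrC subrK invfM invrK mulrA mulVf ?mul1r.
Qed.

Lemma ana0_cont k : ana0 k -> forall eps : R, 0 < eps ->
  exists2 r, 0 < r & forall h, nc h < r -> nc (k h - k 0) < eps.
Proof.
move=> Hk eps e0.
have /ana0P[rho [N [r0 H]]] := ana0B Hk (ana0_cst (k 0)).
have N0 : 0 <= N by case: H => b [Hb _]; exact: summ_ge0 Hb.
pose t := Num.min rho (rho * eps / (N + 1)).
have t0 : 0 < t by rewrite lt_min r0 divr_gt0 ?mulr_gt0//; lra.
have tr : t <= rho by rewrite ge_min lexx.
exists t => // h ht.
have k00 : k 0 - k 0 = 0 by rewrite subrr.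
have := wiener_le (nc_ge0 h) (wiener_small r0 (nc_ge0 h) (le_trans (ltW ht) tr) H k00) (lexx _).
move=> /le_lt_trans; apply.
rewrite mulrA ltr_pdivrMr//.
have : nc h < rho * eps / (N + 1) by apply: lt_le_trans ht _; rewrite ge_min lexx orbT.
rewrite ltr_pdivlMr; last by lra.
have := nc_ge0 h; nra.
Qed.

(** The first nonzero coefficient dominates near 0. The second alternative serves both to isolate
    zeros and to control how fast inverses grow. *)
Lemma ana0_dichotomy k : ana0 k ->
  (exists2 r, 0 < r & forall h, nc h < r -> k h = 0) \/
  exists l c r, [/\ 0 < c, 0 < r & forall h, nc h < r -> c * nc h ^+ l <= nc (k h)].
Proof.
move=> /ana0P[rho [N [r0 [a [Ha Hk]]]]].
have N0 := summ_ge0 Ha.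
have [az|/existsNP[l0 al0]] := pselect (forall n, a n = 0).
  left; exists rho => // h hr; rewrite Hk ?ltW// (@csum_fin _ _ 0) ?big_ord0//.
  by move=> n _; rewrite az mul0r.
right.
have ex : exists n, a n != 0 by exists l0; apply/eqP.
case: (ex_minnP ex) => l al lmin {l0 al0 ex}.
have alow m : (m < l)%N -> a m = 0.
  by move=> ml; apply/eqP/negPn/negP => /lmin; rewrite leqNgt ml.
have c0 : 0 < nc (a l) by rewrite nc_gt0.
(* Below this radius the tail [T] is at most half of the leading term [a l * h ^+ l]. *)
pose t := Num.min rho (nc (a l) / 2 * rho ^+ l.+1 / (N + 1)).
have t0 : 0 < t.
  by rewrite lt_min r0 divr_gt0 ?mulr_gt0 ?divr_gt0 ?exprn_gt0//; lra.
exists l, (nc (a l) / 2), t; split; rewrite ?divr_gt0// => h ht.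
have hr : nc h < rho by apply: lt_le_trans ht _; rewrite ge_min lexx.
have Sh := summ_rho (ltW r0) Ha (ltW hr).
have E : k h = a l * h ^+ l + csum (fun n => a (n + l.+1)%N * h ^+ (n + l.+1)).
  rewrite Hk ?ltW// (csum_shift l.+1 Sh) big_ord_recr /= big1 ?add0r//.
  by move=> i _; rewrite alow ?mul0r.
set T := csum _ in E.
have HT : nc T <= (nc h / rho) ^+ l.+1 * N.
  apply: csum_le => n.
  apply: (@le_trans _ _ (\sum_(i < n) (nc h / rho) ^+ l.+1 * nc (a (i + l.+1)%N * rho%:C ^+ (i + l.+1)))); last first.
    rewrite -mulr_sumr ler_wpM2l//; last exact: (summ_shift l.+1 Ha).
    by rewrite exprn_ge0// divr_ge0 ?nc_ge0// ltW.
  have r0' := ltW r0; apply: ler_sum => i _; rewrite !ncM !ncX nc_rho// mulrCA.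
  rewrite ler_wpM2l ?nc_ge0// !exprD expr_div_n mulrCA divfK; last first.
    by rewrite expf_neq0// gt_eqF.
  by rewrite ler_wpM2r ?exprn_ge0 ?nc_ge0// lerXn2r ?nnegrE ?nc_ge0// ltW.
have HT2 : (nc h / rho) ^+ l.+1 * N <= nc (a l) / 2 * nc h ^+ l.
  rewrite expr_div_n exprSr mulrAC ler_pdivrMr ?exprn_gt0//.
  have -> : nc (a l) / 2 * nc h ^+ l * rho ^+ l.+1 =
    nc h ^+ l * (nc (a l) / 2 * rho ^+ l.+1) by ring.
  rewrite -[leLHS]mulrA; apply: ler_wpM2l; first by rewrite exprn_ge0 ?nc_ge0.
  have : nc h < nc (a l) / 2 * rho ^+ l.+1 / (N + 1).
    by apply: lt_le_trans ht _; rewrite ge_min lexx orbT.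
  rewrite ltr_pdivlMr; last by lra.
  have := nc_ge0 h; nra.
have : nc (a l * h ^+ l) <= nc (k h) + nc T.
  have -> : a l * h ^+ l = k h - T by rewrite E addrK.
  by apply: (le_trans (ncD _ _)); rewrite ncN.
rewrite ncM ncX; lra.
Qed.

(** The root is obtained from -1 by [n] successive square roots. If [w ^+ m = 1] with [m] equal to a
    power of 2, at most [2 ^ n], times an odd number, then raising to the missing power of 2 gives
    both 1 and -1. *)
Lemma root_pow2 n : exists w : C, [/\ nc w = 1, w ^+ (2 ^ n.+1) = 1 &
  forall m, (0 < m < 2 ^ n.+1)%N -> w ^+ m != 1].
Proof.
have [w Hw] : exists w : C, w ^+ (2 ^ n) = -1.
  elim: n => [|n [w Hw]]; first by exists (-1).
  by exists (sqrtc w); rewrite expnS exprM sqr_sqrtc.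
have n11 : -1 != 1 :> C by rewrite eq_sym -subr_eq0 opprK (pnatr_eq0 _ 2).
have w1 : w ^+ (2 ^ n.+1) = 1 by rewrite expnSr exprM Hw sqrrN expr1n.
exists w; split=> //.
  have : nc w ^+ (2 ^ n.+1) = 1 by rewrite -ncX w1 nc1.
  move/eqP; rewrite pexpr_eq1 ?nc_ge0// ?expn_gt0//.
  by move/eqP.
move=> m /andP[m0 mn]; apply/eqP => wm.
have E : m = (2 ^ logn 2 m * m`_2^')%N by rewrite -p_part partnC.
have ln : (logn 2 m <= n)%N.
  rewrite -ltnS -(ltn_exp2l _ _ (isT : (1 < 2)%N)) -p_part.
  by apply: leq_ltn_trans mn; apply: dvdn_leq => //; exact: dvdn_part.
have od : odd (m`_2^')%N by rewrite odd_2'nat; exact: part_pnat.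
have : w ^+ (m * 2 ^ (n - logn 2 m)) = -1.
  have -> : (m * 2 ^ (n - logn 2 m) = 2 ^ n * m`_2^')%N.
    by rewrite {1}E mulnAC -expnD subnKC.
  by rewrite exprM Hw -signr_odd od expr1.
by rewrite exprM wm expr1n => /esym/eqP; rewrite (negPf n11).
Qed.

(* The average of [k] over the [2^n]-th roots of unity of radius [r] is [k 0]
   up to the tail of the power series. *)
Lemma circle_average rho k N r eps : 0 < r -> r <= rho -> wiener rho k N ->
  0 < eps -> exists q (t : nat -> C), [/\ (0 < q)%N, forall j, nc (t j) = r,
    \sum_(j < q) t j = 0 & nc (k 0) <= q%:R^-1 * \sum_(j < q) nc (k (t j)) + eps].
Proof.
move=> r0 rr Hw e0; have [a [Ha Hk]] := wiener_mono (ltW r0) rr Hw.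
have k0 : k 0 = a 0%N.
  rewrite Hk ?nc0 ?ltW// (@csum_fin _ _ 1) ?big_ord1 ?expr0 ?mulr1//.
  by move=> [//|m] _; rewrite exprS mul0r mulr0.
have [J0 HJ] := tail_small (fun n => nc_ge0 (a n * r%:C ^+ n)) Ha e0.
pose n := J0; pose q := (2 ^ n.+1)%N.
have q0 : (0 < q)%N by rewrite expn_gt0.
have qJ : (J0 <= q)%N by apply: leq_trans (leqnSn _) (ltnW (ltn_expl _ _)).
have [w [w1 wq wm]] := root_pow2 n.
pose t j : C := r%:C * w ^+ j.
have tr j : nc (t j) = r by rewrite ncM ncX w1 expr1n mulr1 nc_rho// ltW.
have St j : summ (fun m => a m * t j ^+ m) N.
  by apply: (summ_rho (ltW r0) Ha); rewrite tr.
(* Mean of the [m]-th powers of the roots of unity: 1 at [m = 0], 0 for [0 < m < q], and of modulus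
   at most 1 beyond, where the coefficients already belong to the small tail. *)
pose A m : C := q%:R^-1 * \sum_(j < q) w ^+ (j * m).
have qC : (q%:R : C) != 0 by rewrite pnatr_eq0 -lt0n.
have A1 m : nc (A m) <= 1.
  rewrite ncM ncV nc_nat mulrC ler_pdivrMr ?ltr0n// mul1r.
  apply: (le_trans (nc_sum _ _ _)).
  under eq_bigr do rewrite ncX w1 expr1n.
  by rewrite sumr_const card_ord.
have A0 : A 0%N = 1.
  rewrite /A; under eq_bigr do rewrite muln0 expr0.
  by rewrite sumr_const card_ord mulVf.
have Am m : (0 < m < q)%N -> A m = 0.
  move=> mq; rewrite /A.
  have -> : \sum_(j < q) w ^+ (j * m) = \sum_(j < q) (w ^+ m) ^+ j.
    by apply: eq_bigr => j _; rewrite mulnC exprM.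
  have : (w ^+ m - 1) * (\sum_(j < q) (w ^+ m) ^+ j) = 0.
    by rewrite -subrX1 -exprM mulnC exprM wq expr1n subrr.
  move/eqP; rewrite mulf_eq0 subr_eq0 (negPf (wm m mq)) /= => /eqP->.
  by rewrite mulr0.
have E : q%:R^-1 * (\sum_(j < q) k (t j)) = csum (fun m => A m * (a m * r%:C ^+ m)).
  under eq_bigr do rewrite Hk ?tr//.
  rewrite -(@csum_sum _ _ _ _ (fun (j : 'I_q) m => a m * t j ^+ m) N) //.
  rewrite -(@csumZ _ _ _ (\sum_(j < q) N)); last first.
    move=> p; apply: (@le_trans _ _ (\sum_(m < p) \sum_(j < q) nc (a m * t j ^+ m))).
      by apply: ler_sum => m _; exact: nc_sum.
    by rewrite exchange_big /=; apply: ler_sum => j _; exact: St.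
  congr csum; apply: funext => m; rewrite /A -!mulrA; congr (_ * _).
  rewrite mulr_suml; apply: eq_bigr => j _.
  by rewrite /t exprMn -exprM; ring.
have SA : summ (fun m => A m * (a m * r%:C ^+ m)) N.
  by apply: (summ_le Ha) => m; rewrite ncM -[leRHS]mul1r ler_wpM2r ?nc_ge0.
have E2 : a 0%N = q%:R^-1 * (\sum_(j < q) k (t j)) -
    csum (fun m => A (m + q)%N * (a (m + q)%N * r%:C ^+ (m + q))).
  rewrite E (csum_shift q SA) addrK.
  rewrite -(big_mkord xpredT (fun m => A m * (a m * r%:C ^+ m))).
  rewrite big_ltn// A0 expr0 mulr1 mul1r big_nat_cond big1 ?addr0//.
  by move=> i; rewrite andbT => /Am->; rewrite mul0r.
exists q, t; split=> //.
  (* The sum of the points is the case [m = 1] of [Am]; the exponent [n.+1] makes [q] at least 2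
     even when [J0] is 0. *)
  have q1 : (0 < 1 < q)%N by rewrite /= /q -{1}(expn0 2) ltn_exp2l.
  have := Am 1%N q1; rewrite /A => /eqP; rewrite mulf_eq0 invr_eq0 (negPf qC) /=.
  move=> /eqP S1; rewrite /t -mulr_sumr.
  by under eq_bigr do rewrite -[X in _ ^+ X]muln1; rewrite S1 mulr0.
rewrite k0 E2; apply: (le_trans (ncD _ _)); rewrite ncN; apply: lerD.
  by rewrite ncM ncV nc_nat ler_wpM2l ?invr_ge0// nc_sum.
apply: csum_le => p; apply: le_trans (HJ q p qJ).
by apply: ler_sum => m _; rewrite ncM -[leRHS]mul1r ler_wpM2r ?nc_ge0.
Qed.

End Germs.

(** * The Riemann sphere *)

Section LocallyConstant.
Variable T : topologicalType.
Implicit Types A Q : set T.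

Definition locconst A Q :=
  forall z, A z -> nbhs z (fun z' => A z' -> (Q z' <-> Q z)).

(** A locally constant predicate cuts out a relatively open and relatively closed subset.
    Connectedness is exploited in this form throughout. *)
Lemma connected_locconst A Q : connected A -> locconst A Q ->
  forall x y, A x -> A y -> Q x -> Q y.
Proof.
move=> cA lQ x y Ax Ay Qx.
have E : A `&` Q = A.
  apply: cA; first by exists x.
    exists (interior (fun z => A z -> Q z)); first exact: open_interior.
    apply/seteqP; split=> z [Az].
      by move=> Qz; split=> //; apply: filterS (lQ z Az) => z' H /H ->.
    by move/interior_subset/(_ Az).
  exists (~` interior (fun z => A z -> ~ Q z)).
    exact/open_closedC/open_interior.
  apply/seteqP; split=> z [Az].
    by move=> Qz; split=> // /interior_subset/(_ Az).
  move=> H; split=> //; apply: contrapT => nQ; apply: H.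
  by apply: filterS (lQ z Az) => z' H /H ->.
by have : A y by []; rewrite -E => -[].
Qed.

Lemma locconst_connected A :
  (forall Q, locconst A Q -> forall x y, A x -> A y -> Q x -> Q y) ->
  connected A.
Proof.
move=> H B [x Bx] [W oW BW] [K cK BK].
have Ax : A x by move: Bx; rewrite BW => -[].
have lB : locconst A B.
  move=> z Az; have [Bz|nBz] := pselect (B z).
    have Oz : nbhs z W by apply: open_nbhs_nbhs; split=> //; move: Bz; rewrite BW => -[].
    by apply: filterS Oz => z' Oz' Az'; split=> // _; rewrite BW.
  have Kz : nbhs z (~` K).
    apply: open_nbhs_nbhs; split; first exact: closed_openC.
    by move=> Kz; apply: nBz; rewrite BK.
  by apply: filterS Kz => z' Kz' Az'; split=> //; rewrite BK => -[].
apply/seteqP; split=> y; first by rewrite BW => -[].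
by move=> Ay; exact: (H B lB x y).
Qed.

End LocallyConstant.

(** * Charts, punctured neighbourhoods and the identity principle on the sphere *)

Section Sphere.
Variable R : realType.
Local Notation C := R[i].
Local Notation cs := (csphere R).
Implicit Types (z : cs) (P Q : set cs).

Lemma nbhs_complexP (c : C) (B : set C) :
  nbhs (c : C^o) (B : set C^o) <->
  exists2 r : R, 0 < r & forall h, nc h < r -> B (c + h).
Proof.
split.
  move=> /nbhs_ballP[eps /= e0 H].
  have [k ek] : exists k, eps = k%:C by apply/complex_realP; rewrite realE ltW.
  rewrite ek ltcR in e0; exists k => // h hk; apply: H.
  by rewrite -ball_normE /= opprD addNKr normrN ek norm_nc ltcR.
move=> [r r0 H]; apply/nbhs_ballP; exists r%:C; first by rewrite /= ltcR.
move=> y; rewrite -ball_normE /= => yr.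
rewrite -[y](subrKC c); apply: H.
by rewrite ncBC -ltcR -norm_nc.
Qed.

Lemma nc_continuous : continuous ((@nc R) : C^o -> R^o).
Proof.
move=> c; apply/(@cvgrPdist_lt _ R^o _ (nbhs (c : C^o))) => eps e0.
apply/nbhs_complexP; exists eps => // h he.
apply: le_lt_trans he; rewrite ler_distl; apply/andP; split.
  by rewrite lerBlDr ncD.
by have := ncD (c + h) (- h); rewrite addrK ncN.
Qed.

Lemma compact_nc_bounded (K : set C^o) : compact K ->
  exists2 M : R, 0 < M & forall x : C, K x -> nc x < M.
Proof.
move=> cK.
have /compact_bounded [M [Mr HM]] : compact (((@nc R) : C^o -> R^o) @` K).
  by apply: continuous_compact => //; apply: continuous_subspaceT; exact: nc_continuous.
exists (`|M| + 2) => [|z Kz]; first by rewrite ltr_wpDl.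
have /HM /(_ (nc z)) : M < `|M| + 1 by rewrite (le_lt_trans (ler_norm M))// ltrDl.
rewrite /= ger0_norm ?nc_ge0// => H.
by apply: le_lt_trans (H _) _; [exists z|rewrite ltrD2l ltr1n].
Qed.

Lemma closed_disc (r : R) : closed ([set z : C^o | nc z <= r]).
Proof.
have -> : [set z : C^o | nc z <= r] = ((@nc R) : C^o -> R^o) @^-1` [set x | x <= r] by [].
by apply: closed_comp; [move=> x _; exact: nc_continuous|exact: closed_le].
Qed.

(** A closed subset of the image of a square under the continuous map from pairs of reals to
    [R[i]]. *)
Lemma compact_disc (r : R) : compact ([set z : C^o | nc z <= r]).
Proof.
pose f (p : R^o * R^o) : C^o := Complex p.1 p.2.
have cf : continuous f.
  move=> [x y]; apply/cvgrPdist_lt => eps e0.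
  have [k ek] : exists k, eps = k%:C by apply/complex_realP; rewrite realE ltW.
  rewrite ek ltcR in e0.
  have k2 : 0 < k / 2 by rewrite divr_gt0.
  near=> p; rewrite ek norm_nc ltcR; apply: (le_lt_trans (nc_le _)).
  rewrite /= [k]splitr; apply: ltrD.
    by near: p; apply: (@cvgr_dist_lt _ _ _ _ _ (fst : R^o * R^o -> R^o)) => //; exact: cvg_fst.
  by near: p; apply: (@cvgr_dist_lt _ _ _ _ _ (snd : R^o * R^o -> R^o)) => //; exact: cvg_snd.
have cS : compact (f @` (`[- r, r] `*` `[- r, r])).
  apply: continuous_compact; first exact: continuous_subspaceT.
  by apply: compact_setX; exact: segment_compact.
apply: (subclosed_compact (@closed_disc r) cS) => -[x y] /= H.
have H1 := le_trans (nc_Re (Complex x y)) H.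
have H2 := le_trans (nc_Im (Complex x y)) H.
by exists (x, y) => //=; split; rewrite /= in_itv /= -ler_norml.
Unshelve. all: by end_near. Qed.

Local Notation chart := (@csphere_chart R).

Lemma chart0 z : chart z 0 = z.
Proof. by case: z => [c|] /=; rewrite ?addr0// /csphere_inv eqxx. Qed.

(** At infinity, neighbourhoods are complements of closed compact sets: these are bounded by some
    [M], which yields the radius [M^-1] in the chart, and conversely closed discs are compact. *)
Lemma nbhs_chart z P :
  nbhs z P <-> exists2 r : R, 0 < r & forall h, nc h < r -> P (chart z h).
Proof.
case: z => [c|]; first exact: nbhs_complexP.
split.
  move=> [K [cK clK] /= KP]; have [M M0 HM] := compact_nc_bounded cK.
  exists M^-1; first by rewrite invr_gt0.
  move=> h hM; apply: KP; rewrite /csphere_inv.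
  have [h0|h0] := eqVneq h 0; first by right.
  left; exists h^-1 => // /HM; rewrite ncV => H.
  have p0 : 0 < nc h by rewrite nc_gt0.
  have H1 : 1 < M * nc h by rewrite -ltr_pdivrMr// div1r.
  have H2 : nc h * M < 1 by rewrite -ltr_pdivlMr// div1r.
  lra.
move=> [r r0 H]; exists [set z : C^o | nc z <= r^-1].
  by split; [exact: compact_disc|exact: closed_disc].
move=> y [[x /= xr <-]|->]; last by rewrite -(chart0 None); apply: H; rewrite nc0.
have xr' : r^-1 < nc x by rewrite ltNge; apply/negP.
have x0 : x != 0 by rewrite -nc_gt0; apply: lt_trans xr'; rewrite invr_gt0.
have := H x^-1; rewrite /= /csphere_inv invr_eq0 (negPf x0) invrK; apply.
by rewrite ncV -[ltRHS]invrK ltf_pV2 ?posrE ?invr_gt0 ?nc_gt0.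
Qed.

(** Holds on a punctured neighbourhood of [z]; the value at [z] itself is left free, as suits
    isolated exceptional points. *)
Definition punct z P :=
  exists2 r : R, 0 < r & forall h, h != 0 -> nc h < r -> P (chart z h).

Lemma nbhs_punct z P : nbhs z P -> punct z P.
Proof. by move=> /nbhs_chart[r r0 H]; exists r => // h _; exact: H. Qed.

Lemma punct_nbhs z P : punct z P -> P z -> nbhs z P.
Proof.
move=> [r r0 H] Pz; apply/nbhs_chart; exists r => // h hr.
by have [->|h0] := eqVneq h 0; [rewrite chart0|exact: H].
Qed.

Lemma punctI z P Q : punct z P -> punct z Q -> punct z (fun y => P y /\ Q y).
Proof.
move=> [r r0 H] [r' r'0 H']; exists (Num.min r r'); first by rewrite lt_min r0.
by move=> h h0; rewrite lt_min => /andP[? ?]; split; [exact: H|exact: H'].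
Qed.

Lemma punctS z P Q : (forall y, P y -> Q y) -> punct z P -> punct z Q.
Proof. by move=> PQ [r r0 H]; exists r => // h h0 hr; apply/PQ/H. Qed.

Lemma punct_ex z P : punct z P -> exists y, P y.
Proof.
move=> [r r0 H]; exists (chart z (r / 2)%:C); apply: H.
  by rewrite -nc_gt0 nc_real normr_gt0 gt_eqF// divr_gt0.
by rewrite nc_real ger0_norm; lra.
Qed.

Lemma nbhs_neq z y : y <> z -> nbhs y (fun y' => y' <> z).
Proof.
case: z y => [c|] [c'|] H; apply/nbhs_chart => /=.
- have d0 : 0 < nc (c - c').
    by rewrite nc_gt0 subr_eq0; apply/eqP => E; apply: H; rewrite E.
  exists (nc (c - c')) => // h hd [E]; move: hd.
  by rewrite -E addrC addKr ltxx.
- have [->|c0] := eqVneq c 0.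
    exists 1 => // h h1; rewrite /csphere_inv; case: eqVneq => // h0 [E].
    by move: h0; rewrite -invr_eq0 E eqxx.
  exists (nc c)^-1 => [|h hc]; first by rewrite invr_gt0 nc_gt0.
  rewrite /csphere_inv; case: eqVneq => // h0 [E].
  by move: hc; rewrite -E ncV invrK ltxx.
- by exists 1.
- by exfalso; apply: H.
Qed.

Lemma chart_inj0 z h : h != 0 -> chart z h <> z.
Proof.
case: z => [c|] h0 /=; last by rewrite /csphere_inv (negPf h0).
by case=> /eqP; rewrite -subr_eq0 addrC addKr (negPf h0).
Qed.

Lemma punct_punct z P : punct z P -> punct z (fun y => nbhs y P).
Proof.
move=> Pz; have : nbhs z (fun y => y = z \/ P y).
  by apply: punct_nbhs; [apply: punctS Pz; right|left].
move=> /(@nbhs_interior cs) /nbhs_chart[r r0 H]; exists r => // h h0 hr.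
have H1 := H h hr; have H2 := nbhs_neq (chart_inj0 (z := z) h0).
by apply: filterS2 H1 H2 => y [].
Qed.

Lemma csphere_inv_cont (h0 : C) (P : set cs) : nbhs (csphere_inv h0) P ->
  exists2 d : R, 0 < d & forall h, nc (h - h0) < d -> P (csphere_inv h).
Proof.
have [->|n0] := eqVneq h0 0.
  rewrite {1}/csphere_inv eqxx => /nbhs_chart[r r0 H]; exists r => // h.
  by rewrite subr0 => /H.
rewrite {1}/csphere_inv (negPf n0) => /nbhs_chart[r r0 H].
have : ana0 (fun h : C => (h0 + h)^-1).
  by apply: ana0V; [exact: ana0D (ana0_cst _) (@ana0_id R)|rewrite addr0].
move=> /ana0_cont/(_ r r0)[d d0 Hd].
exists (Num.min d (nc h0)); first by rewrite lt_min d0 nc_gt0.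
move=> h; rewrite lt_min => /andP[h1 h2].
have hn0 : h != 0 by apply: contraTneq h2 => ->; rewrite sub0r ncN ltxx.
rewrite /csphere_inv (negPf hn0).
have := H (h^-1 - h0^-1); rewrite /= subrKC; apply.
by have := Hd (h - h0) h1; rewrite subrKC addr0.
Qed.

Lemma chart_cont z (h0 : C) P : nbhs (chart z h0) P ->
  exists2 d : R, 0 < d & forall h, nc (h - h0) < d -> P (chart z h).
Proof.
case: z => [c|]; last exact: csphere_inv_cont.
move=> /nbhs_chart[r r0 H]; exists r => // h hr.
have := H _ hr; rewrite /= -addrA; congr (P (Some (_ + _))).
by rewrite addrC subrK.
Qed.

Definition convexC (K : set C) := forall h0 h1 (t : R), K h0 -> K h1 ->
  0 <= t -> t <= 1 -> K (h0 + t%:C * (h1 - h0)).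

(** A locally constant predicate is pulled back to the unit interval along the segment joining two
    points. *)
Lemma convex_connected z (K : set C) : convexC K -> connected (chart z @` K).
Proof.
move=> cK; apply: locconst_connected => Q lQ _ _ [h0 K0 <-] [h1 K1 <-] Q0.
pose p (t : R) := h0 + t%:C * (h1 - h0).
have Kp t : 0 <= t <= 1 -> K (p t) by move=> /andP[? ?]; exact: cK.
have := @connected_locconst R^o `[0, 1]%classic (fun t => Q (chart z (p t))).
move=> /(_ _ _ 0 1).
rewrite /p mul0r addr0 mul1r subrKC; apply=> //=; last 2 first.
- by rewrite in_itv /= lexx ler01.
- by rewrite in_itv /= lexx ler01.
- exact: segment_connected.
move=> t /=; rewrite in_itv /= => t01.
have := lQ (chart z (p t)) (ex_intro2 _ _ _ (Kp t t01) erefl).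
move=> /chart_cont[d d0 Hd].
have e0 : 0 < d / (nc (h1 - h0) + 1) by rewrite divr_gt0// ltr_wpDl ?nc_ge0.
apply/nbhs_ballP; exists (d / (nc (h1 - h0) + 1)) => // t'.
rewrite -ball_normE /= distrC ltr_pdivlMr ?ltr_wpDl ?nc_ge0// => tt.
rewrite in_itv /= => t'01; apply: Hd; last by exists (p t') => //; exact: Kp.
have -> : p t' - p t = (t' - t)%:C * (h1 - h0).
  by rewrite /p rmorphB /=; ring.
rewrite ncM nc_real; have := nc_ge0 (h1 - h0); have := normr_ge0 (t' - t); nra.
Qed.

Lemma convex_lt (t a b r : R) : 0 <= t -> t <= 1 -> a < r -> b < r ->
  (1 - t) * a + t * b < r.
Proof.
move=> t0 t1 ar br; have [->|tn0] := eqVneq t 0; first by lra.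
have H1 : 0 < t * (r - b) by rewrite mulr_gt0 ?subr_gt0// lt_def tn0.
have H2 : 0 <= (1 - t) * (r - a) by rewrite mulr_ge0 ?subr_ge0// ltW.
lra.
Qed.

Lemma convex_disc (r : R) : convexC [set h | nc h < r].
Proof.
move=> h0 h1 t /= H0 H1 t0 t1.
have -> : h0 + t%:C * (h1 - h0) = (1 - t)%:C * h0 + t%:C * h1.
  by rewrite rmorphB /= rmorph1; ring.
apply: le_lt_trans (ncD _ _) _; rewrite !ncM !nc_real !ger0_norm ?subr_ge0//.
exact: convex_lt.
Qed.

Lemma convexI (K L : set C) : convexC K -> convexC L -> convexC (K `&` L).
Proof.
by move=> cK cL h0 h1 t [? ?] [? ?] ? ?; split; [exact: cK|exact: cL].
Qed.

Lemma disc_connected z (r : R) : connected (chart z @` [set h | nc h < r]).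
Proof. exact: convex_connected (@convex_disc r). Qed.

Lemma punct_connected z (r : R) : 0 < r ->
  connected (chart z @` [set h | nc h < r /\ h != 0]).
Proof.
move=> r0.
pose H1 : set C := [set h | 0 < complex.Re h].
pose H2 : set C := [set h | 0 < complex.Im h].
pose H3 : set C := [set h | complex.Re h < 0].
pose H4 : set C := [set h | complex.Im h < 0].
pose K (H : set C) : set C := [set h | nc h < r] `&` H.
have RE (h0 h1 : C) (t : R) : complex.Re (h0 + t%:C * (h1 - h0)) =
    (1 - t) * complex.Re h0 + t * complex.Re h1.
  by case: h0 h1 => [a b] [a' b'] /=; ring.
have IE (h0 h1 : C) (t : R) : complex.Im (h0 + t%:C * (h1 - h0)) =
    (1 - t) * complex.Im h0 + t * complex.Im h1.
  by case: h0 h1 => [a b] [a' b'] /=; ring.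
have c1 : connected (chart z @` K H1).
  apply: convex_connected; apply: convexI; first exact: convex_disc.
  move=> h0 h1 t; rewrite /H1 /= RE => ? ? t0 t1.
  by rewrite -oppr_lt0 opprD -!mulrN convex_lt ?oppr_lt0.
have c2 : connected (chart z @` K H2).
  apply: convex_connected; apply: convexI; first exact: convex_disc.
  move=> h0 h1 t; rewrite /H2 /= IE => ? ? t0 t1.
  by rewrite -oppr_lt0 opprD -!mulrN convex_lt ?oppr_lt0.
have c3 : connected (chart z @` K H3).
  apply: convex_connected; apply: convexI; first exact: convex_disc.
  by move=> h0 h1 t; rewrite /H3 /= RE => ? ? t0 t1; exact: convex_lt.
have c4 : connected (chart z @` K H4).
  apply: convex_connected; apply: convexI; first exact: convex_disc.
  by move=> h0 h1 t; rewrite /H4 /= IE => ? ? t0 t1; exact: convex_lt.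
have pt (a b : R) : `|a| <= r / 4 -> `|b| <= r / 4 -> nc (Complex a b) < r.
  move=> ha hb; apply: le_lt_trans (nc_le _) _ => /=; lra.
have q0 : 0 < r / 4 by rewrite divr_gt0.
have nq : `|r / 4| <= r / 4 by rewrite ger0_norm// ltW.
have nq' : `|- (r / 4)| <= r / 4 by rewrite normrN.
(* The punctured disc is the union of its right, upper, left and lower open halves; each is convex,
   and neighbouring halves meet. *)
have E : chart z @` [set h | nc h < r /\ h != 0] =
    (chart z @` K H1 `|` chart z @` K H2) `|` (chart z @` K H3 `|` chart z @` K H4).
  rewrite -!image_setU; congr (_ @` _); apply/seteqP; split.
    move=> [a b] [/= hr]; rewrite eq_complex /= negb_and /K /H1 /H2 /H3 /H4 /=.
    case: (ltgtP a 0) => a0 /=; [by right; left|by left; left|].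
    by case: (ltgtP b 0) => b0 //= _; [right; right|left; right].
  move=> [a b]; rewrite /K /H1 /H2 /H3 /H4 /= eq_complex /=.
  by move=> [[]|[]] [hr] H; split=> //; rewrite ?(gt_eqF H) ?(lt_eqF H) ?andbF.
rewrite E; apply: connectedU.
- exists (chart z (Complex (- (r / 4)) (r / 4))); split.
    by right; exists (Complex (- (r / 4)) (r / 4)) => //; split=> //; exact: pt.
  left; exists (Complex (- (r / 4)) (r / 4)) => //; split; first exact: pt.
  by rewrite /H3 /= oppr_lt0.
- apply: connectedU => //.
  exists (chart z (Complex (r / 4) (r / 4))).
  by split; exists (Complex (r / 4) (r / 4)) => //; split=> //; exact: pt.
- apply: connectedU => //.
  exists (chart z (Complex (- (r / 4)) (- (r / 4)))).
  by split; exists (Complex (- (r / 4)) (- (r / 4))) => //;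
    (split; [exact: pt|rewrite /H3 /H4 /= oppr_lt0]).
Qed.

Lemma open_minus (A D : set cs) : open A ->
  (forall z, A z -> punct z (fun y => ~ D y)) -> open (A `\` D).
Proof.
move=> oA pD; rewrite openE => z [Az nDz]; rewrite /interior.
have HA : nbhs z A by apply: open_nbhs_nbhs.
by apply: filterS2 HA (punct_nbhs (pD z Az) nDz) => y; split.
Qed.

Lemma connected_minus (A D : set cs) : open A -> connected A ->
  (forall z, A z -> punct z (fun y => ~ D y)) -> connected (A `\` D).
Proof.
move=> oA cA pD; apply: locconst_connected => Q lQ x y [Ax nDx] [Ay nDy] Qx.
have near_const z : A z -> punct z Q \/ punct z (fun y => ~ Q y).
  move=> Az.
  have HA : nbhs z A by apply: open_nbhs_nbhs.
  have [r r0 Hr] := punctI (nbhs_punct HA) (pD z Az).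
  pose N := chart z @` [set h | nc h < r /\ h != 0].
  have lN : locconst N Q.
    move=> w [h [hr h0] <-]; have ADw : (A `\` D) (chart z h).
      by have [] := Hr h h0 hr; split.
    apply: filterS (lQ _ ADw) => u Hu [h' [hr' h0'] hu]; apply: Hu; rewrite -hu.
    by have [] := Hr h' h0' hr'; split.
  have cN := connected_locconst (@punct_connected z r r0) lN.
  have [[w [h [hr h0] hw] Qw]|nQ] := pselect (exists2 w, N w & Q w).
    left; exists r => // h' h0' hr'; apply: (cN w) => //; last by exists h'.
    by exists h.
  right; exists r => // h' h0' hr' Qh; apply: nQ.
  by exists (chart z h') => //; exists h'.
have excl z : punct z Q -> punct z (fun y => ~ Q y) -> False.
  by move=> h1 h2; have [w []] := punct_ex (punctI h1 h2).
have Qpunct z : A z -> ~ D z -> (Q z <-> punct z Q).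
  move=> Az nDz.
  have HA : nbhs z A by apply: open_nbhs_nbhs.
  have ADz : (A `\` D) z by [].
  have P1 := punctI (punctI (nbhs_punct (lQ z ADz)) (nbhs_punct HA)) (pD z Az).
  have P2 : punct z (fun y => Q y <-> Q z).
    by apply: punctS P1 => w [[H1 H2] H3]; apply: H1.
  split=> [Qz|pQ]; first by apply: punctS P2 => w ->.
  by have [w [H1 H2]] := punct_ex (punctI P2 pQ); apply/H1.
apply/(Qpunct y Ay nDy).
apply: (@connected_locconst _ A (fun z => punct z Q) cA _ x) => //; last first.
  exact/(Qpunct x Ax nDx).
move=> z Az; have [pQ|pQ] := near_const z Az.
  apply: punct_nbhs => //; apply: punctS (punct_punct pQ) => w Qw _.
  by split=> // _; exact: nbhs_punct.
apply: punct_nbhs => //; apply: punctS (punct_punct pQ) => w Qw _.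
by split=> H; exfalso; [exact: (excl w H (nbhs_punct Qw))|exact: (excl z)].
Qed.

Lemma analytic_eq (g g' : cs -> C) z : nbhs z (fun y => g' y = g y) ->
  analytic_at g z -> analytic_at g' z.
Proof. by move=> /nbhs_chart[r r0 H]; apply: (ana0_eq r0 H). Qed.

(** By [ana0_dichotomy] applied to the difference, agreement near a point is a locally constant
    property. *)
Lemma identity_principle (U : set cs) (g g' : cs -> C) z0 : connected U ->
  (forall z, U z -> analytic_at g z) -> (forall z, U z -> analytic_at g' z) ->
  U z0 -> nbhs z0 (fun y => g y = g' y) -> forall z, U z -> g z = g' z.
Proof.
move=> cU ag ag' Uz0 H0 z Uz.
suff : nbhs z (fun y => g y = g' y) by exact: nbhs_singleton.
apply: (@connected_locconst _ U (fun z => nbhs z (fun y => g y = g' y)) cU _ z0) => //.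
move=> {z0 Uz0 H0} {Uz}z Uz.
have [[r r0 H]|[l [c [r [c0 r0 H]]]]] := ana0_dichotomy (ana0B (ag z Uz) (ag' z Uz)).
  have Hz : nbhs z (fun y => g y = g' y).
    by apply/nbhs_chart; exists r => // h hr; apply/eqP; rewrite -subr_eq0 H.
  by apply: filterS (@nbhs_interior cs _ _ Hz) => w Hw _.
have Hz : punct z (fun y => g y <> g' y).
  exists r => // h h0 hr E; have := H h hr; rewrite E subrr nc0.
  by rewrite leNgt mulr_gt0// exprn_gt0// nc_gt0.
have nz : ~ nbhs z (fun y => g y = g' y).
  by move=> /nbhs_punct K; have [w []] := punct_ex (punctI Hz K).
apply: punct_nbhs => //; apply: punctS Hz => w Hw _; split=> //.
by move/nbhs_singleton.
Qed.

Lemma punct_all (T : eqType) (s : seq T) (P : T -> set cs) z :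
  (forall t, t \in s -> punct z (P t)) ->
  punct z (fun y => forall t, t \in s -> P t y).
Proof.
elim: s => [|a s IH] H; first by exists 1.
have H1 : punct z (P a) by apply: H; exact: mem_head.
have H2 : punct z (fun y => forall t, t \in s -> P t y).
  by apply: IH => t ts; apply: H; rewrite in_cons ts orbT.
apply: punctS (punctI H1 H2) => y [Pa Ps] t.
by rewrite in_cons => /orP[/eqP->//|]; exact: Ps.
Qed.

Lemma punct_neq (z a : cs) : punct z (fun y => y <> a).
Proof.
have [<-|za] := pselect (z = a); last exact/nbhs_punct/nbhs_neq.
by exists 1 => // h h0 _; exact: chart_inj0.
Qed.

End Sphere.

(** * Rational maps *)

Section RatMap.
Variable R : realType.
Local Notation C := R[i].
Local Notation cs := (csphere R).
Local Notation chart := (@csphere_chart R).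
Local Notation tofrac := (@FracField.tofrac {poly C}).
Implicit Types (r : ratfun R) (z : cs) (P Q : {poly C}).

Lemma tofrac_pi (x : {ratio {poly C}}) :
  tofrac (frac x).2 * (\pi_{fraction {poly C}} x)%qT = tofrac (frac x).1.
Proof.
rewrite /FracField.tofrac; unlock.
have -> : forall a b, (\pi_{fraction {poly C}} a)%qT * (\pi_{fraction {poly C}} b)%qT
  = (\pi_{fraction {poly C}} (FracField.mulf a b))%qT.
  by move=> a b; rewrite [RHS]FracField.pi_mul.
apply/eqmodP; rewrite /= FracField.equivfE /FracField.mulf.
have x20 := denom_ratioP x; have o0 := oner_neq0 {poly C}.
have Er a : (frac (Ratio a (1 : {poly C}))).1 = a by rewrite numer_Ratio.
have Dr a : (frac (Ratio a (1 : {poly C}))).2 = 1 by rewrite denom_Ratio.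
by rewrite !Er !Dr mul1r numer_Ratio// denom_Ratio// mulr1.
Qed.

Lemma rat_den_neq0 r : rat_den r != 0.
Proof.
rewrite /rat_den divpN0; last by rewrite gcdp_eq0 negb_and denom_ratioP orbT.
by rewrite dvdp_leq ?dvdp_gcdr ?denom_ratioP.
Qed.

Lemma rat_coprime r : coprimep (rat_num r) (rat_den r).
Proof. by apply: coprimep_div_gcd; rewrite denom_ratioP orbT. Qed.

Lemma rat_numden r : tofrac (rat_den r) * r = tofrac (rat_num r).
Proof.
set g := gcdp (frac (repr r)).1 (frac (repr r)).2.
have g0 : tofrac g != 0.
  by rewrite tofrac_eq0 gcdp_eq0 negb_and denom_ratioP orbT.
apply: (mulfI g0); rewrite mulrA -!tofracM ![g * _]mulrC.
rewrite /rat_den /rat_num !divpK ?dvdp_gcdl ?dvdp_gcdr//.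
by rewrite -tofrac_pi reprK.
Qed.

Lemma rat_cross r P Q : tofrac Q * r = tofrac P ->
  Q * rat_num r = P * rat_den r.
Proof.
move=> E; apply/eqP; rewrite -tofrac_eq !tofracM -rat_numden -E; apply/eqP.
by ring.
Qed.

(** Values may be computed from any fraction [P / Q] with [Q] nonzero at [c]: coprimality then keeps
    the reduced denominator from vanishing at [c]. *)
Lemma rat_map_val r P Q (c : C) : tofrac Q * r = tofrac P -> Q.[c] != 0 ->
  rat_map r (Some c) = Some (P.[c] / Q.[c]).
Proof.
move=> /rat_cross/(congr1 (fun f : {poly C} => f.[c])); rewrite !hornerM /= => E Qc.
have qc : (rat_den r).[c] != 0.
  apply/negP => /eqP q0; move: E; rewrite q0 mulr0 => /eqP.
  rewrite mulf_eq0 (negPf Qc) /= => pc.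
  by have := coprimep_root (rat_coprime r) pc; rewrite q0 eqxx.
rewrite (negPf qc); congr Some; apply/eqP.
by rewrite eqr_div// [X in X == _]mulrC E.
Qed.

Lemma ana0_horner P : ana0 (fun h => P.[h]).
Proof.
elim/poly_ind: P => [|P c IH].
  by apply: (ana0_eq ltr01 _ (ana0_cst 0)) => h _; rewrite horner0.
apply: (ana0_eq ltr01 _ (ana0D (ana0M IH (@ana0_id R)) (ana0_cst c))) => h _.
by rewrite hornerMXaddC.
Qed.

Lemma ana0_neq0 (k : C -> C) : ana0 k -> k 0 != 0 ->
  exists2 d : R, 0 < d & forall h, nc h < d -> k h != 0.
Proof.
move=> ak k0; have k00 : 0 < nc (k 0) by rewrite nc_gt0.
have [d d0 H] := ana0_cont ak k00.
exists d => // h /H; apply: contraTneq => ->.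
by rewrite sub0r ncN ltxx.
Qed.

(** The point of the sphere with homogeneous coordinates [a : b]. *)
Definition proj_pt (a b : C) : cs := if b == 0 then None else Some (a / b).

Lemma rev_horner (p : {poly C}) n (h : C) : h != 0 -> (size p <= n.+1)%N ->
  (\poly_(i < n.+1) p`_(n - i)).[h] = h ^+ n * p.[h^-1].
Proof.
move=> h0 sp; rewrite horner_poly (horner_coef_wide _ sp) mulr_sumr.
rewrite (reindex_inj rev_ord_inj) /=; apply: eq_bigr => i _.
have ile : (i <= n)%N by rewrite -ltnS.
rewrite subSS subKn// mulrCA; congr (_ * _).
have -> : h ^+ n = h ^+ (n - i) * h ^+ i by rewrite -exprD subnK.
by rewrite -mulrA -exprMn divff// expr1n mulr1.
Qed.

(** In each chart the map is a quotient of polynomials without common zero at the origin. At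
    infinity both polynomials are reversed with respect to their common degree bound [n], so that
    the powers of [h] cancel. *)
Lemma rat_map_poly r z : exists P Q, (P.[0] != 0) || (Q.[0] != 0) /\
  forall h, rat_map r (chart z h) = proj_pt P.[h] Q.[h].
Proof.
pose p := rat_num r; pose q := rat_den r.
case: z => [c|].
  exists (p \Po ('X + c%:P)), (q \Po ('X + c%:P)); split.
    rewrite !horner_comp !hornerE; have := rat_coprime r.
    case: eqP => //= pc /coprimep_root; apply; exact/eqP.
  by move=> h; rewrite !horner_comp !hornerE /= [h + c]addrC.
pose n := (maxn (size p) (size q)).-1.
have q0 : q != 0 by exact: rat_den_neq0.
have nE : maxn (size p) (size q) = n.+1.
  by rewrite prednK// leq_max orbC lt0n size_poly_eq0 q0.
have sp : (size p <= n.+1)%N by rewrite -nE leq_maxl.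
have sq : (size q <= n.+1)%N by rewrite -nE leq_maxr.
exists (\poly_(i < n.+1) p`_(n - i)), (\poly_(i < n.+1) q`_(n - i)).
have E0 (f : {poly C}) : (\poly_(i < n.+1) f`_(n - i)).[0] = f`_n.
  by rewrite horner_coef0 coef_poly /= subn0.
split.
  rewrite !E0; case: (leqP (size p) (size q)) => spq.
    have -> : n = (size q).-1 by rewrite /n (maxn_idPr spq).
    by rewrite -lead_coefE lead_coef_eq0 q0 orbT.
  have -> : n = (size p).-1 by rewrite /n (maxn_idPl (ltnW spq)).
  by rewrite -lead_coefE lead_coef_eq0 -size_poly_eq0 -lt0n (leq_ltn_trans _ spq).
move=> h; rewrite /= /csphere_inv; case: eqVneq => [->|h0].
  rewrite /= !E0 -/p -/q /proj_pt; case: ltnP => spq.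
    rewrite [q`_n]nth_default ?eqxx// /n (maxn_idPl (ltnW spq)).
    by rewrite -ltnS prednK// (leq_ltn_trans _ spq).
  have -> : n = (size q).-1 by rewrite /n (maxn_idPr spq).
  by rewrite -lead_coefE lead_coef_eq0 (negPf q0).
rewrite /= -/p -/q !rev_horner// /proj_pt mulf_eq0 expf_eq0 (negPf h0) andbF /=.
case: ifP => // _; congr Some.
by rewrite invfM mulrACA divff ?mul1r// expf_neq0.
Qed.

(** Holomorphy as a self-map of the sphere: [s] is the map read in the charts at [z] and at its
    image. Where the image is infinite the quotient is inverted. *)
Lemma rat_map_local r z : exists s : C -> C, [/\ ana0 s, s 0 = 0 &
  exists2 d : R, 0 < d &
    forall h, nc h < d -> rat_map r (chart z h) = chart (rat_map r z) (s h)].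
Proof.
have [P [Q [PQ0 E]]] := rat_map_poly r z.
have Ez : rat_map r z = proj_pt P.[0] Q.[0] by rewrite -E chart0.
have [Q0|Q0] := eqVneq Q.[0] 0.
  have P0 : P.[0] != 0 by move: PQ0; rewrite Q0 eqxx orbF.
  exists (fun h => Q.[h] * P.[h]^-1); split.
  - by apply: ana0M; [exact: ana0_horner|apply: ana0V => //; exact: ana0_horner].
  - by rewrite Q0 mul0r.
  have [d d0 H] := ana0_neq0 (ana0_horner P) P0.
  exists d => // h /H Ph; rewrite E Ez /proj_pt Q0 eqxx /= /csphere_inv.
  by rewrite mulf_eq0 invr_eq0 (negPf Ph) orbF invfM invrK [_^-1 * _]mulrC.
exists (fun h => P.[h] * Q.[h]^-1 - P.[0] / Q.[0]); split.
- apply: ana0B (ana0_cst _); apply: ana0M; first exact: ana0_horner.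
  by apply: ana0V => //; exact: ana0_horner.
- by rewrite subrr.
have [d d0 H] := ana0_neq0 (ana0_horner Q) Q0.
exists d => // h /H Qh; rewrite E Ez /proj_pt (negPf Q0) (negPf Qh) /=.
by rewrite subrKC.
Qed.

Lemma rat_map_cont r z (S : set cs) : nbhs (rat_map r z) S ->
  nbhs z (fun y => S (rat_map r y)).
Proof.
move=> /nbhs_chart[e e0 HS].
have [s [as_ s0 [d d0 Hd]]] := rat_map_local r z.
have [d' d'0 Hd'] := ana0_cont as_ e0.
apply/nbhs_chart; exists (Num.min d d'); first by rewrite lt_min d0.
move=> h; rewrite lt_min => /andP[h1 h2]; rewrite Hd//; apply: HS.
by have := Hd' h h2; rewrite s0 subr0.
Qed.

Lemma analytic_rat_comp r z (g : cs -> C) : analytic_at g (rat_map r z) ->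
  analytic_at (fun y => g (rat_map r y)) z.
Proof.
move=> ag; have [s [as_ s0 [d d0 Hd]]] := rat_map_local r z.
have /= := ana0_comp (k := fun h => g (chart (rat_map r z) h)) ag as_ s0.
by apply: (ana0_eq d0) => h /Hd ->.
Qed.

(** Poles receive the default value 0, so statements about [rval] need regularity or avoid the
    pole. *)
Definition rval r z : C := if rat_map r z is Some t then t else 0.

Lemma analytic_rval r z : rat_map r z <> None -> analytic_at (rval r) z.
Proof.
case Ez : (rat_map r z) => [t|//] _.
have [s [as_ s0 [d d0 Hd]]] := rat_map_local r z.
have : ana0 (fun h => t + s h) by apply: ana0D as_; exact: ana0_cst.
by apply: (ana0_eq d0) => h /Hd E; rewrite /rval E Ez.
Qed.

Lemma poly_nbhs0 z P (S : set cs) : nbhs z S ->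
  (forall c, S (Some c) -> P.[c] = 0) -> P = 0.
Proof.
move=> /nbhs_chart[d d0 H] PS; apply/eqP/negPn/negP => P0.
(* Infinitely many distinct points of the punctured disc, more than [P] can have roots; at infinity
   their inverses are used. *)
pose t k : C := (d / k.+2%:R)%:C.
have t0 k : t k != 0.
  by rewrite -nc_gt0 nc_real normr_gt0 gt_eqF// divr_gt0.
have td k : nc (t k) < d.
  rewrite nc_real ger0_norm ?divr_ge0// ?(ltW d0)// ltr_pdivrMr//.
  by rewrite -[ltLHS]mulr1 ltr_pM2l// ltr1n.
have tinj : injective t.
  move=> j k /complexI /(mulfI (lt0r_neq0 d0)) /invr_inj /eqP.
  by rewrite eqr_nat => /eqP [].
have [u [uinj Hu]] : exists u : nat -> C, injective u /\ forall k, S (Some (u k)).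
  case: z H => [c|] H.
    exists (fun k => c + t k); split; first by move=> j k /addrI /tinj.
    by move=> k; exact: H (td k).
  exists (fun k => (t k)^-1); split; first by move=> j k /invr_inj /tinj.
  by move=> k; have := H _ (td k); rewrite /= /csphere_inv (negPf (t0 k)).
have := @max_poly_roots _ P [seq u k | k <- iota 0 (size P)] P0.
rewrite size_map size_iota ltnn => H'; have : false; last by [].
apply: H'; last by rewrite map_inj_uniq ?iota_uniq.
by apply/allP => _ /mapP[k _ ->]; rewrite rootE PS.
Qed.

(** Numerator and [t] times denominator agree on infinitely many points, hence identically;
    coprimality then makes both constant. The value infinity would force the denominator to vanish
    identically. *)
Lemma rat_map_const r z (y : cs) : nbhs z (fun y' => rat_map r y' = y) ->
  y <> None /\ forall z', rat_map r z' = y.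
Proof.
move=> H; case: y H => [t|] H; last first.
  exfalso; have /negP := rat_den_neq0 r; apply; apply/eqP.
  by apply: (@poly_nbhs0 z _ _ H) => c /=; case: eqP.
split=> //.
have E : rat_num r = t *: rat_den r.
  apply/eqP; rewrite -subr_eq0; apply/eqP/(@poly_nbhs0 z _ _ H) => c /=.
  case: eqVneq => // qc [<-].
  by rewrite !hornerE /= divfK// subrr.
have sq : size (rat_den r) = 1%N.
  have := rat_coprime r; rewrite E => /(coprimep_dvdr (r := rat_den r)).
  by rewrite coprimepp -mul_polyC dvdp_mull ?dvdpp// => /(_ isT)/eqP.
have [a a0 qa] : exists2 a, a != 0 & rat_den r = a%:P.
  by have /eqP/size_poly1P := sq.
have pE : rat_num r = (t * a)%:P by rewrite E qa -mul_polyC -polyCM.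
case=> [c|] /=; first by rewrite qa pE !hornerC (negPf a0) mulfK.
rewrite sq pE size_polyC ltnNge leq_b1 /=.
by rewrite coefC /= qa lead_coefC mulfK.
Qed.

Definition nonconstant r := exists z1 z2, rat_map r z1 <> rat_map r z2.

(** The lower bound on the displacement [s h] is what converts a power of [1 / |s h|] into a power
    of [1 / |h|] when estimates are pulled back. *)
Lemma rat_map_growth r z (e : R) : nonconstant r -> 0 < e ->
  exists (s : C -> C) l c d, [/\ 0 < c, 0 < d & forall h, h != 0 -> nc h < d ->
    [/\ rat_map r (chart z h) = chart (rat_map r z) (s h), s h != 0,
        nc (s h) < e & c * nc h ^+ l <= nc (s h)]].
Proof.
move=> [z1 [z2 ncst]] e0; have [s [as_ s0 [d d0 Hd]]] := rat_map_local r z.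
have [[d1 d10 sz]|[l [c [d1 [c0 d10 sl]]]]] := ana0_dichotomy as_.
  exfalso; apply: ncst.
  have /rat_map_const[_ H] : nbhs z (fun y => rat_map r y = rat_map r z).
    apply/nbhs_chart; exists (Num.min d d1); first by rewrite lt_min d0.
    by move=> h; rewrite lt_min => /andP[h1 h2]; rewrite Hd// sz// chart0.
  by rewrite !H.
have [d2 d20 sc] := ana0_cont as_ e0.
exists s, l, c, (Num.min d (Num.min d1 d2)).
split=> // [|h h0]; first by rewrite !lt_min d0 d10.
rewrite !lt_min => /and3P[h1 h2 h3].
have sb := sl h h2; split=> //.
- exact: Hd.
- by rewrite -nc_gt0; apply: lt_le_trans sb; rewrite mulr_gt0// exprn_gt0// nc_gt0.
- by have := sc h h3; rewrite s0 subr0.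
Qed.

Lemma rat_map_punct r z (S : set cs) : nonconstant r ->
  punct (rat_map r z) S -> punct z (fun y => S (rat_map r y)).
Proof.
move=> ncr [e e0 HS].
have [s [l [c [d [c0 d0 H]]]]] := rat_map_growth z ncr e0.
exists d => // h h0 hd; have [E sn0 se _] := H h h0 hd.
by rewrite E; exact: HS.
Qed.

(** A pole is a zero of finite order of the coordinate at infinity. *)
Lemma rval_growth r z : exists A m d, [/\ 0 <= A, 0 < d &
  forall h, h != 0 -> nc h < d ->
    rat_map r (chart z h) <> None /\ nc (rval r (chart z h)) <= A * (nc h)^-1 ^+ m].
Proof.
have [s [as_ s0 [d d0 Hd]]] := rat_map_local r z.
case Ez : (rat_map r z) Hd => [t|] Hd.
  have [d1 d10 sc] := ana0_cont as_ (@ltr01 R).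
  exists (nc t + 1), 0%N, (Num.min d d1); split.
  - by rewrite addr_ge0 ?nc_ge0.
  - by rewrite lt_min d0.
  move=> h h0; rewrite lt_min => /andP[h1 h2]; rewrite /rval Hd// /= expr0 mulr1.
  split=> //; apply: le_trans (ncD _ _) _; rewrite lerD2l ltW//.
  by have := sc h h2; rewrite s0 subr0.
have [[d1 d10 sz]|[l [c [d1 [c0 d10 sl]]]]] := ana0_dichotomy as_.
  exfalso; have : nbhs z (fun y => rat_map r y = None).
    apply/nbhs_chart; exists (Num.min d d1); first by rewrite lt_min d0.
    by move=> h; rewrite lt_min => /andP[h1 h2]; rewrite Hd// sz// chart0.
  by move=> /rat_map_const[].
exists c^-1, l, (Num.min d d1); split.
- by rewrite invr_ge0 ltW.
- by rewrite lt_min d0.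
move=> h h0; rewrite lt_min => /andP[h1 h2].
have sb := sl h h2.
have p0 : 0 < c * nc h ^+ l by rewrite mulr_gt0// exprn_gt0// nc_gt0.
have sn0 : s h != 0 by rewrite -nc_gt0; exact: lt_le_trans sb.
rewrite /rval Hd//= /csphere_inv (negPf sn0); split=> //.
by rewrite ncV exprVn -invfM lef_pV2// posrE ?nc_gt0.
Qed.

Lemma rat_pole_punct r z : punct z (fun y => rat_map r y <> None).
Proof.
have [A [m [d [_ d0 H]]]] := rval_growth r z.
by exists d => // h h0 hd; have [] := H h h0 hd.
Qed.

End RatMap.

(** * Simple random walk and Green functions *)

Section PowSmall.
Variable R : realType.

Lemma pow_small (t eps : R) : 0 <= t -> t < 1 -> 0 < eps ->
  exists N, forall n, (N <= n)%N -> t ^+ n < eps.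
Proof.
move=> t0 t1 e0.
have : (fun n => t ^+ n : R^o) @ \oo --> (0 : R^o).
  by apply: cvg_expr; rewrite ger0_norm.
move=> /cvgrPdist_lt/(_ eps e0)[N _ H]; exists N => n /H /=.
by rewrite sub0r normrN ger0_norm// exprn_ge0.
Qed.

End PowSmall.

Lemma sum_delta (S : pzRingType) (V : eqType) (s : seq V) (x : V) (g : V -> S) :
  uniq s -> \sum_(y <- s) (y == x)%:R * g y = if x \in s then g x else 0.
Proof.
elim: s => [|a s IH] /=; first by rewrite big_nil.
move=> /andP[na us]; rewrite big_cons IH// in_cons [x == a]eq_sym.
case: eqVneq => [axE|ax] /=; last by rewrite mul0r add0r.
by rewrite mul1r -axE (negPf na) addr0.
Qed.

Section Walk.
Variables (R : realType) (V : choiceType) (e : rel V).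
Hypothesis Xgraph : graph_ax e.
Local Notation C := R[i].

Definition nb (x : V) : seq V := enum_fset (fset_set (gnbr e x)).

Lemma mem_nb x y : (y \in nb x) = e x y.
Proof.
have [_ _ _ fin _] := Xgraph.
by rewrite /nb in_fset_set//; apply/idP/idP; rewrite inE.
Qed.

Lemma uniq_nb x : uniq (nb x). Proof. exact: fset_uniq. Qed.

Lemma size_nb x : size (nb x) = gdeg e x. Proof. by []. Qed.

Lemma exists_other (x : V) : exists y, y <> x.
Proof.
have [_ _ _ _ inf] := Xgraph; apply: contrapT => H; apply: inf.
suff -> : [set: V] = [set x] by exact: finite_set1.
apply/seteqP; split=> // y _ /=; apply: contrapT => yx.
by apply: H; exists y.
Qed.

Lemma gdeg_gt0 x : (0 < gdeg e x)%N.
Proof.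
have [y yx] := exists_other x; have [_ _ conn _ _] := Xgraph.
have [[|u p] [/= pe le _]] := conn x y; first by rewrite le in yx.
move: pe => /andP[xu _]; rewrite -size_nb.
by case E : (nb x) => //; move: xu; rewrite -mem_nb E.
Qed.

Lemma gdegC_neq0 x : (gdeg e x)%:R != 0 :> C.
Proof. by rewrite pnatr_eq0 -lt0n gdeg_gt0. Qed.

Lemma gdegR_gt0 x : 0 < (gdeg e x)%:R :> R.
Proof. by rewrite ltr0n gdeg_gt0. Qed.

Lemma srw_opE (phi : V -> C) x :
  srw_op e phi x = (gdeg e x)%:R^-1 * \sum_(y <- nb x) phi y.
Proof.
have [_ _ _ fin _] := Xgraph.
rewrite /srw_op fsbig_finite//= mulr_sumr big_seq [RHS]big_seq.
by apply: eq_bigr => y; rewrite mem_nb /srw_p => ->.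
Qed.

Lemma sum_nb_cst x (c : R) : \sum_(y <- nb x) c = c *+ gdeg e x.
Proof. by rewrite big_const_seq count_predT size_nb iter_addr addr0. Qed.

Lemma srw_op_le (phi : V -> C) (B : R) x :
  (forall y, e x y -> nc (phi y) <= B) -> nc (srw_op e phi x) <= B.
Proof.
move=> H; rewrite srw_opE ncM ncV nc_nat mulrC ler_pdivrMr ?gdegR_gt0//.
apply: le_trans (nc_sum _ _ _) _; rewrite mulr_natr -sum_nb_cst.
by rewrite big_seq [leRHS]big_seq; apply: ler_sum => y; rewrite mem_nb => /H.
Qed.

Lemma srw_pnS n x y : srw_pn R e n.+1 x y =
  (gdeg e x)%:R^-1 * \sum_(u <- nb x) srw_pn R e n u y.
Proof. by rewrite /srw_pn iterS srw_opE. Qed.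

Lemma srw_pn_row n (s : seq V) x : uniq s ->
  \sum_(y <- s) nc (srw_pn R e n x y) <= 1.
Proof.
move=> us; elim: n x => [|n IH] x.
  have H (y : V) : nc (srw_pn R e 0 x y) = (y == x)%:R.
    by rewrite /srw_pn /= eq_sym nc_nat.
  under eq_bigr do rewrite H -[_%:R]mulr1.
  by rewrite sum_delta//; case: ifP.
under eq_bigr do rewrite srw_pnS ncM ncV nc_nat.
rewrite -mulr_sumr mulrC ler_pdivrMr ?gdegR_gt0//.
apply: (@le_trans _ _ (\sum_(y <- s) \sum_(u <- nb x) nc (srw_pn R e n u y))).
  by apply: ler_sum => y _; exact: nc_sum.
rewrite exchange_big /= mulr_natr -sum_nb_cst.
by apply: ler_sum => u _; exact: IH.
Qed.

Lemma srw_pn_le1 n x y : nc (srw_pn R e n x y) <= 1.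
Proof. by have := @srw_pn_row n [:: y] x isT; rewrite big_seq1. Qed.

Lemma iter_srw_sum (I : Type) (r : seq I) (c : I -> C) (phi : I -> V -> C) n x :
  iter n (srw_op (R := R) e) (fun u => \sum_(i <- r) c i * phi i u) x =
  \sum_(i <- r) c i * iter n (srw_op (R := R) e) (phi i) x.
Proof.
elim: n x => [//|n IH] x; rewrite iterS srw_opE.
under eq_bigr do rewrite IH.
rewrite exchange_big /= mulr_sumr; apply: eq_bigr => i _.
by rewrite -mulr_sumr mulrCA srw_opE.
Qed.

Lemma srw_pn_rev n x y :
  (gdeg e x)%:R * srw_pn R e n x y = (gdeg e y)%:R * srw_pn R e n y x.
Proof.
have [sym _ _ _ _] := Xgraph.
elim: n x y => [|n IH] x y.
  rewrite /srw_pn /= [y == x]eq_sym; case: eqVneq => [->//|_].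
  by rewrite !mulr0.
rewrite {1}/srw_pn iterSr.
(* One step applied to a delta function is a combination of deltas at the neighbours of [y], with
   weights [1 / gdeg e t]; the induction hypothesis then applies at each neighbour. *)
have -> : srw_op e (fun u => (u == y)%:R) =
    (fun u => \sum_(t <- nb y) (gdeg e t)%:R^-1 * (u == t)%:R) :> (V -> C).
  apply: funext => u; rewrite srw_opE.
  have -> : \sum_(t <- nb u) (t == y)%:R = (e u y)%:R :> C.
    under eq_bigr do rewrite -[_%:R]mulr1.
    by rewrite sum_delta ?uniq_nb// mem_nb; case: (e u y).
  transitivity (\sum_(t <- nb y) (t == u)%:R * (gdeg e t)%:R^-1 : C).
    by rewrite sum_delta ?uniq_nb// mem_nb sym; case: (e y u); rewrite ?mulr1 ?mulr0.
  by apply: eq_bigr => t _; rewrite mulrC [u == t]eq_sym.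
rewrite iter_srw_sum mulr_sumr srw_pnS mulrA divff ?gdegC_neq0// mul1r.
apply: eq_bigr => t _; rewrite mulrCA.
have -> : iter n (srw_op (R := R) e) (fun u => (u == t)%:R) x = srw_pn R e n x t by [].
by rewrite IH mulrA mulVf ?gdegC_neq0// mul1r.
Qed.

Lemma green_csum x y z : green e x y z = csum (fun n => srw_pn R e n x y * z ^+ n).
Proof. by []. Qed.

Lemma green_summ (z : C) x y : nc z < 1 ->
  summ (fun n => srw_pn R e n x y * z ^+ n) (1 - nc z)^-1.
Proof.
move=> z1 n; apply: le_trans (geom_sum_le n (nc_ge0 z) z1).
apply: ler_sum => k _; rewrite ncM ncX -[leRHS]mul1r.
by rewrite ler_wpM2r ?exprn_ge0 ?nc_ge0 ?srw_pn_le1.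
Qed.

(** The powers of the transition operator have row sums at most 1, so the geometric bound holds for
    whole rows and does not depend on [x] or [s]. *)
Lemma green_row (z : C) x (s : seq V) : nc z < 1 -> uniq s ->
  \sum_(y <- s) nc (green e x y z) <= (1 - nc z)^-1.
Proof.
move=> z1 us.
have /choice[u Hu] : forall y, exists u : C, nc u <= 1 /\
    u * green e x y z = (nc (green e x y z))%:C.
  by move=> y; have [u ? ?] := phase (green e x y z : C); exists u.
have -> : \sum_(y <- s) nc (green e x y z) =
    nc (csum (fun n => \sum_(y <- s) u y * (srw_pn R e n x y * z ^+ n))).
  rewrite (@csum_sum _ _ _ _ (fun y n => u y * (srw_pn R e n x y * z ^+ n))
    (1 * (1 - nc z)^-1)).
    under [in RHS]eq_bigr => y _.
      rewrite (csumZ _ (green_summ x y z1)) -green_csum (Hu y).2; over.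
    rewrite -rmorph_sum nc_real ger0_norm//.
    by apply: sumr_ge0 => y _; exact: nc_ge0.
  move=> y _ n; apply: le_trans (summZ (u y) (green_summ x y z1) n) _.
  by rewrite ler_wpM2r ?(Hu y).1 ?invr_ge0 ?subr_ge0 ?(ltW z1).
apply: csum_le => n; apply: le_trans (geom_sum_le n (nc_ge0 z) z1).
apply: ler_sum => k _; apply: le_trans (nc_sum _ _ _) _.
apply: (@le_trans _ _ (\sum_(y <- s) nc (srw_pn R e k x y) * nc z ^+ k)).
  apply: ler_sum => y _; rewrite !ncM ncX -[leRHS]mul1r.
  by rewrite ler_wpM2r ?(Hu y).1 ?mulr_ge0 ?exprn_ge0 ?nc_ge0.
rewrite -mulr_suml -[leRHS]mul1r ler_wpM2r ?exprn_ge0 ?nc_ge0//.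
exact: srw_pn_row.
Qed.

Lemma green_le (z : C) x y : nc z < 1 -> nc (green e x y z) <= (1 - nc z)^-1.
Proof. by move=> z1; have := @green_row z x [:: y] z1 isT; rewrite big_seq1. Qed.

Lemma green_eq (z : C) x y : nc z < 1 ->
  green e x y z = (x == y)%:R + z * srw_op e (fun u => green e u y z) x.
Proof.
move=> z1; rewrite green_csum (csum_shift 1 (green_summ x y z1)) big_ord1.
rewrite {1}/srw_pn /= expr0 mulr1; congr (_ + _).
rewrite srw_opE mulrA.
have S u := green_summ u y z1.
rewrite -(@csum_sum _ _ _ _ (fun u n => srw_pn R e n u y * z ^+ n) (1 - nc z)^-1) //.
rewrite -(@csumZ _ _ _ (\sum_(u <- nb x) (1 - nc z)^-1)).
  congr csum; apply: funext => n; rewrite addn1 srw_pnS exprS -mulr_suml; ring.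
move=> n; apply: (@le_trans _ _ (\sum_(k < n) \sum_(u <- nb x) nc (srw_pn R e k u y * z ^+ k))).
  by apply: ler_sum => k _; exact: nc_sum.
by rewrite exchange_big /=; apply: ler_sum => u _; exact: S.
Qed.

Lemma green_rev (z : C) x y : nc z < 1 ->
  (gdeg e x)%:R * green e x y z = (gdeg e y)%:R * green e y x z.
Proof.
move=> z1; rewrite !green_csum -(csumZ _ (green_summ x y z1)).
rewrite -(csumZ _ (green_summ y x z1)); congr csum; apply: funext => n.
by rewrite !mulrA srw_pn_rev.
Qed.

(** Iterating the equation [n] times bounds [k] by [nc z ^+ n * B]. This gives uniqueness for the
    Green equation inside the disc. *)
Lemma bounded_harmonic0 (z : C) (k : V -> C) B : nc z < 1 ->
  (forall x, nc (k x) <= B) -> (forall x, k x = z * srw_op e k x) ->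
  forall x, k x = 0.
Proof.
move=> z1 kB kz.
have H n x : nc (k x) <= nc z ^+ n * B.
  elim: n x => [|n IH] x; first by rewrite expr0 mul1r.
  rewrite kz ncM exprS -mulrA ler_wpM2l ?nc_ge0//.
  by apply: srw_op_le => y _.
move=> x; apply/eqP; rewrite -nc_eq0 eq_le nc_ge0 andbT.
apply/ler_addgt0Pr => eps e0; rewrite add0r.
have B0 : 0 <= B by apply: le_trans (kB x); exact: nc_ge0.
have B1 : 0 < B + 1 by lra.
have [N HN] := pow_small (nc_ge0 z) z1 (divr_gt0 e0 B1).
apply: le_trans (H N x) _; have := HN N (leqnn N).
rewrite ltr_pdivlMr// => H1; have := exprn_ge0 N (nc_ge0 z); nra.
Qed.

(* The value at infinity is junk. *)
Definition green_sphere x y (z : csphere R) : C :=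
  if z is Some c then green e x y c else 0.

Lemma analytic_green x y (c : C) : nc c < 1 ->
  analytic_at (green_sphere x y) (Some c).
Proof.
(* With this radius the Wiener norm of [c + h] stays below 1, so it can be substituted into the
   series. *)
move=> c1; pose rho := (1 - nc c) / 2.
have r0 : 0 < rho by rewrite /rho; lra.
have s1 : nc c + rho < 1 by rewrite /rho; lra.
have s0 : 0 <= nc c + rho by have := nc_ge0 c; lra.
apply/ana0P; exists rho, (1 - nc ((nc c + rho)%:C : C))^-1; split=> //.
have Ws : wiener rho (fun h => c + h) (nc c + rho).
  by apply: wienerD; [exact: wiener_cst|exact: wiener_id (ltW r0)].
have := @wiener_comp _ _ _ _ (fun n => srw_pn R e n x y)
  (1 - nc ((nc c + rho)%:C : C))^-1 r0 Ws; apply.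
by apply: green_summ; rewrite nc_rho.
Qed.

End Walk.

(** * Cells *)

Section Contraction.
Variable R : realType.
Local Notation C := R[i].
Local Notation tofrac := (@FracField.tofrac {poly C}).

(** If [1 - M] were singular, [M] would fix a nonzero vector, and its entry of largest modulus would
    be at most [t] times itself. *)
Lemma unitmx_contract n (M : 'M[C]_n) (t : R) : t < 1 ->
  (forall i, \sum_j nc (M i j) <= t) -> 1%:M - M \in unitmx.
Proof.
move=> t1 HM; rewrite unitmxE unitfE; apply/negP.
rewrite -det_tr => /det0P[u /rV0Pn[i0 ui0] uA].
have E i : u 0 i = \sum_j M i j * u 0 j.
  have := congr1 (fun A : 'rV[C]_n => A 0 i) uA; rewrite !mxE => H.
  apply/eqP; rewrite -subr_eq0; apply/eqP; rewrite -[RHS]H.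
  under [in RHS]eq_bigr do rewrite !mxE mulrBr.
  rewrite sumrB; congr (_ - _); last by apply: eq_bigr => j _; rewrite mulrC.
  rewrite (bigD1 i)//= eqxx mulr1 big1 ?addr0// => j ji.
  by rewrite eq_sym (negPf ji) mulr0.
have [i _ imax] := @arg_maxP _ R _ i0 xpredT (fun i => nc (u 0 i)) isT.
have ui : 0 < nc (u 0 i) by apply: lt_le_trans (imax i0 isT); rewrite nc_gt0.
have : nc (u 0 i) <= t * nc (u 0 i).
  rewrite {1}E; apply: le_trans (nc_sum _ _ _) _.
  apply: (@le_trans _ _ (\sum_j nc (M i j) * nc (u 0 i))).
    by apply: ler_sum => j _; rewrite ncM ler_wpM2l ?nc_ge0//; exact: (imax j isT).
  by rewrite -mulr_suml ler_wpM2r ?nc_ge0.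
by nra.
Qed.

Lemma invmx_morph (S : comNzRingType) (K : fieldType) (f : {rmorphism S -> K}) n
    (A : 'M[S]_n) i j : f (\det A) != 0 ->
  f (\det A) * invmx (map_mx f A) i j = f (\adj A i j).
Proof.
move=> dA; have uA : map_mx f A \in unitmx by rewrite unitmxE det_map_mx unitfE.
by rewrite /invmx uA det_map_mx -map_mx_adj !mxE mulrA divff ?mul1r.
Qed.

(** Inverting over the rational functions and then specialising at [z] is the same as inverting the
    specialised matrix: both are the adjugate over the determinant, and the latter does not vanish
    at [z]. *)
Lemma invmx_rat_val n (Q : 'M[C]_n) (z : C) i j : 1%:M - z *: Q \in unitmx ->
  rat_map (invmx (1%:M - map_mx (fun a => tofrac ('X * a%:P)) Q) i j) (Some z) =
  Some (invmx (1%:M - z *: Q) i j).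
Proof.
move=> uz.
pose A : 'M[{poly C}]_n := 1%:M - map_mx (fun a => 'X * a%:P) Q.
have EF : 1%:M - map_mx (fun a => tofrac ('X * a%:P)) Q = map_mx tofrac A.
  rewrite /A map_mxB map_mx1; congr (_ - _); apply/matrixP => i' j'.
  by rewrite !mxE.
have Ez : 1%:M - z *: Q = map_mx (horner_eval z) A.
  apply/matrixP => i' j'; rewrite !mxE /horner_eval !hornerE.
  by congr (_ - _); case: (i' == j'); rewrite /= ?mulr1n ?mulr0n ?hornerE.
have dz : (\det A).[z] != 0.
  by move: uz; rewrite unitmxE Ez det_map_mx unitfE.
have dA : tofrac (\det A) != 0.
  by rewrite tofrac_eq0; apply: contraNneq dz => ->; rewrite horner0.
rewrite EF (@rat_map_val _ _ (\adj A i j) (\det A) z (invmx_morph _ _ dA) dz).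
rewrite Ez; congr Some; apply: (mulfI dz).
by rewrite (@invmx_morph _ _ (horner_eval z)) // mulrC divfK.
Qed.

Lemma rat_mapZ (k : nat) (r : ratfun R) (z t : C) :
  rat_map r (Some z) = Some t ->
  rat_map ((k%:R - 1) * r) (Some z) = Some ((k%:R - 1) * t).
Proof.
rewrite {1}/rat_map; case: eqVneq => // qz [<-].
have kE : (k%:R - 1 : {poly C}) = (k%:R - 1)%:P.
  by rewrite rmorphB rmorph1 rmorph_nat.
rewrite (@rat_map_val _ _ ((k%:R - 1) * rat_num r) (rat_den r))//.
  by rewrite hornerM kE hornerC mulrA.
by rewrite tofracM tofracB tofrac1 rmorph_nat mulrCA rat_numden.
Qed.

End Contraction.

(** * Dirichlet problems on a closed cell *)

Section CellSolve.
Variables (R : realType) (V : choiceType) (e : rel V) (D : set V).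
Hypothesis finD : finite_set (gbar e D).
Local Notation C := R[i].

Definition gb : seq V := enum_fset (fset_set (gbar e D)).
Definition cnb (x : V) : seq V := enum_fset (fset_set (gnbr e x `&` gbar e D)).

Lemma mem_gb x : (x \in gb) = `[< gbar e D x >].
Proof. by rewrite /gb in_fset_set//; apply/idP/asboolP; rewrite inE. Qed.

Lemma gbP x : reflect (gbar e D x) (x \in gb).
Proof. by rewrite mem_gb; exact: asboolP. Qed.

Lemma uniq_gb : uniq gb. Proof. exact: fset_uniq. Qed.
Lemma uniq_cnb x : uniq (cnb x). Proof. exact: fset_uniq. Qed.

Lemma mem_cnb x y : (y \in cnb x) = e x y && (y \in gb).
Proof.
rewrite /cnb in_fset_set; last exact: finite_setIr.
by apply/idP/andP; rewrite inE => -[? /gbP].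
Qed.

Lemma size_cnb x : size (cnb x) = cell_deg e D x. Proof. by []. Qed.

Lemma perm_cnb x : perm_eq [seq y <- gb | e x y] (cnb x).
Proof.
apply: uniq_perm; [by rewrite filter_uniq ?uniq_gb|exact: uniq_cnb|].
by move=> y; rewrite mem_filter mem_cnb.
Qed.

(** The operator with matrix [Q_mx] acting on functions of vertices: one step of the walk on the
    closed cell, absorbed in [B]. *)
Definition cell_op (B : set V) (k : V -> C) x : C :=
  if x \in B then 0 else (cell_deg e D x)%:R^-1 * \sum_(y <- cnb x) k y.

Lemma sum_Q_coef B (k : V -> C) x :
  \sum_(y <- gb) Q_coef R e D B x y * k y = cell_op B k x.
Proof.
rewrite /cell_op /Q_coef; case: ifP => xB /=.
  by rewrite big1// => y _; rewrite andbF mul0r.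
rewrite -(perm_big _ (perm_cnb x)) big_filter mulr_sumr [RHS]big_mkcond /=.
by apply: eq_bigr => y _; rewrite andbT; case: ifP; rewrite ?mul0r.
Qed.

Lemma sum_Q_nc B x : \sum_(y <- gb) nc (Q_coef R e D B x y) <= 1.
Proof.
rewrite /Q_coef; case: (boolP (x \in B)) => xB /=.
  by rewrite big1// => y _; rewrite andbF nc0.
under eq_bigr do rewrite andbT.
rewrite (bigID (e x)) /= [X in _ + X]big1 ?addr0; last first.
  by move=> y /negPf->; rewrite nc0.
rewrite -big_filter (perm_big _ (perm_cnb x)) /=.
rewrite big_seq (eq_bigr (fun=> (cell_deg e D x)%:R^-1)); last first.
  by move=> y; rewrite mem_cnb => /andP[-> _]; rewrite ncV nc_nat.
rewrite -big_seq big_const_seq count_predT size_cnb iter_addr addr0 -[leLHS]mulr_natr.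
by case: (cell_deg e D x) => [|n]; rewrite ?mulr0// mulVf// pnatr_eq0.
Qed.

Local Notation n := #|{: fset_set (gbar e D)}|.

Lemma sum_gb_ord (S : nmodType) (g : V -> S) :
  \sum_(j < n) g (val (enum_val j)) = \sum_(y <- gb) g y.
Proof.
by rewrite /gb big_seq_fsetE /= (big_enum_val (A := {: fset_set (gbar e D)})).
Qed.

Lemma Q_unit B (z : C) : nc z < 1 -> 1%:M - z *: Q_mx R e D B \in unitmx.
Proof.
move=> z1; apply: (@unitmx_contract _ _ _ (nc z)) => // i.
under eq_bigr do rewrite !mxE ncM.
rewrite -mulr_sumr (sum_gb_ord (fun y => nc (Q_coef R e D B (val (enum_val i)) y))).
by rewrite -[leRHS]mulr1 ler_wpM2l ?nc_ge0 ?sum_Q_nc.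
Qed.

Lemma QstarE B x y (gx : x \in fset_set (gbar e D)) (gy : y \in fset_set (gbar e D)) :
  Qstar R e D B x y =
  Qstar_mx R e D B (enum_rank [` gx]%fset) (enum_rank [` gy]%fset).
Proof. by rewrite /Qstar !insubT. Qed.

Lemma cell_regular B (z : C) x y : nc z < 1 -> gbar e D x -> gbar e D y ->
  rat_map (Qstar R e D B x y) (Some z) <> None.
Proof.
move=> z1 /gbP gx /gbP gy; rewrite (QstarE B gx gy) invmx_rat_val//.
exact: Q_unit.
Qed.

Lemma rval_Qstar B (z : C) x y (gx : x \in fset_set (gbar e D))
    (gy : y \in fset_set (gbar e D)) : nc z < 1 ->
  rval (Qstar R e D B x y) (Some z) = invmx (1%:M - z *: Q_mx R e D B)
    (enum_rank [` gx]%fset) (enum_rank [` gy]%fset).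
Proof.
by move=> z1; rewrite /rval (QstarE B gx gy) invmx_rat_val//; exact: Q_unit.
Qed.

(** On [B] the equation prescribes the value [rhs], elsewhere [rhs] is a source; the matrix is
    invertible since its row sums are at most [nc z]. The lemma thus solves the Dirichlet problem
    and gives uniqueness at once. *)
Lemma cell_solve B (z : C) (k rhs : V -> C) : nc z < 1 ->
  (forall x, gbar e D x -> k x = rhs x + z * cell_op B k x) ->
  forall x, gbar e D x ->
    k x = \sum_(y <- gb) rval (Qstar R e D B x y) (Some z) * rhs y.
Proof.
move=> z1 H x /gbP gx.
pose K : 'cV[C]_n := \col_i k (val (enum_val i)).
pose G : 'cV[C]_n := \col_i rhs (val (enum_val i)).
have E : (1%:M - z *: Q_mx R e D B) *m K = G.
  apply/matrixP => i j; rewrite mulmxBl mul1mx -scalemxAl !mxE.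
  under eq_bigr do rewrite !mxE.
  rewrite (sum_gb_ord (fun y => Q_coef R e D B (val (enum_val i)) y * k y)).
  rewrite sum_Q_coef H ?addrK//; apply/gbP; exact: valP.
have {}E : K = invmx (1%:M - z *: Q_mx R e D B) *m G.
  by rewrite -E mulKmx// Q_unit.
have := congr1 (fun A : 'cV[C]_n => A (enum_rank [` gx]%fset) 0) E.
rewrite !mxE enum_rankK /= => ->.
rewrite -(sum_gb_ord (fun y => rval (Qstar R e D B x y) (Some z) * rhs y)).
apply: eq_bigr => j _; rewrite !mxE; congr (_ * _).
have gj : val (enum_val j) \in fset_set (gbar e D) by exact: valP.
rewrite (rval_Qstar B gx gj z1); congr (invmx _ _ _).
by rewrite -[LHS]enum_valK; congr enum_rank; exact: val_inj.
Qed.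

Lemma cell_fundamental B (z : C) y : nc z < 1 -> gbar e D y ->
  forall x, gbar e D x -> rval (Qstar R e D B x y) (Some z) =
    (x == y)%:R + z * cell_op B (fun t => rval (Qstar R e D B t y) (Some z)) x.
Proof.
move=> z1 /gbP gy x /gbP gx.
have := mulmxV (Q_unit B z1).
move=> /(congr1 (fun A : 'M[C]_n => A (enum_rank [` gx]%fset) (enum_rank [` gy]%fset))).
rewrite mulmxBl mul1mx -scalemxAl !mxE -(rval_Qstar B gx gy z1) => /eqP.
rewrite subr_eq => /eqP ->; congr (_ + _).
  by rewrite (inj_eq enum_rank_inj) -val_eqE.
rewrite -sum_Q_coef; congr (_ * _).
rewrite -(sum_gb_ord (fun t => Q_coef R e D B x t * rval (Qstar R e D B t y) (Some z))).
apply: eq_bigr => j _; rewrite !mxE enum_rankK /=; congr (_ * _).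
have gj : val (enum_val j) \in fset_set (gbar e D) by exact: valP.
rewrite (rval_Qstar B gj gy z1); congr (invmx _ _ _).
by rewrite -[LHS]enum_valK; congr enum_rank; exact: val_inj.
Qed.

Lemma cell_op_le B (k : V -> C) (b : R) x : 0 <= b ->
  (forall y, e x y -> gbar e D y -> nc (k y) <= b) -> nc (cell_op B k x) <= b.
Proof.
move=> b0 H; rewrite -sum_Q_coef; apply: le_trans (nc_sum _ _ _) _.
apply: (@le_trans _ _ (\sum_(y <- gb) nc (Q_coef R e D B x y) * b)).
  rewrite big_seq [leRHS]big_seq; apply: ler_sum => y /gbP gy; rewrite ncM.
  rewrite /Q_coef; case: ifP => [/andP[exy _]|_]; last by rewrite nc0 !mul0r.
  by rewrite ler_wpM2l ?nc_ge0// H.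
by rewrite -mulr_suml -[leRHS]mul1r ler_wpM2r// sum_Q_nc.
Qed.

End CellSolve.

(** * Reachability and the structure of cells *)

Section Reach.
Variables (V : choiceType) (e : rel V).
Hypothesis sym : symmetric e.
Implicit Types A : set V.

Lemma greach_refl A x : A x -> greach e A x x.
Proof. by move=> Ax; exists [::]; split=> // u; rewrite inE => /eqP->. Qed.

Lemma greach_in A x y : greach e A x y -> A x /\ A y.
Proof.
move=> [p [_ <- H]]; split; apply: H; first exact: mem_head.
exact: mem_last.
Qed.

Lemma greach_trans A x y z : greach e A x y -> greach e A y z -> greach e A x z.
Proof.
move=> [p [pp lp Hp]] [q [pq lq Hq]]; exists (p ++ q); split.
- by rewrite cat_path pp lp.
- by rewrite last_cat lp.
- move=> u; rewrite -cat_cons mem_cat => /orP[/Hp//|uq].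
  by apply: Hq; rewrite in_cons uq orbT.
Qed.

Lemma greach_step A x y : A x -> A y -> e x y -> greach e A x y.
Proof.
move=> Ax Ay exy; exists [:: y]; split=> //=; first by rewrite exy.
by move=> u; rewrite !inE => /orP[]/eqP->.
Qed.

Lemma greach_sym A x y : greach e A x y -> greach e A y x.
Proof.
move=> [p [pe lp Hp]]; elim: p x pe lp Hp => [|a p IH] x /=.
  by move=> _ -> H; apply: greach_refl; apply: H; exact: mem_head.
move=> /andP[xa pe] lp H.
have H' u : u \in a :: p -> A u by move=> ua; apply: H; rewrite in_cons ua orbT.
apply: (greach_trans (IH a pe lp H')); apply: greach_step; last by rewrite sym.
  exact/H'/mem_head.
exact/H/mem_head.
Qed.

End Reach.

Section Cells.
Variables (V : choiceType) (e : rel V) (F : set V).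
Hypothesis Xgraph : graph_ax e.

Definition cell_of x : set V := [set y | greach e (~` F) x y].

Lemma adjC x y : e x y = e y x. Proof. by have [s _ _ _ _] := Xgraph. Qed.

Lemma cell_of_cells x : ~ F x -> cells e F (cell_of x).
Proof. by move=> Fx; exists x. Qed.

Lemma cell_of_refl x : ~ F x -> cell_of x x.
Proof. by move=> nF; apply: (@greach_refl _ _ (~` F)). Qed.

Lemma cell_eq D x : cells e F D -> D x -> D = cell_of x.
Proof.
move=> [x0 _ ->] /= rx; apply/seteqP; split=> y /= ry.
  by apply: greach_trans ry; apply: greach_sym => //; exact: adjC.
exact: greach_trans ry.
Qed.

Lemma cell_notF D x : cells e F D -> D x -> ~ F x.
Proof. by move=> [x0 _ ->] r; have [] := greach_in r. Qed.

Lemma cell_nbr D x y : cells e F D -> D x -> e x y -> ~ F y -> D y.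
Proof.
move=> cD Dx exy Fy; rewrite (cell_eq cD Dx); apply: greach_step => //.
exact: cell_notF Dx.
Qed.

Lemma theta_F D y : cells e F D -> theta e D y -> F y.
Proof.
move=> cD [nDy [x Dx exy]]; apply: contrapT => Fy; apply: nDy.
exact: cell_nbr exy Fy.
Qed.

Lemma theta_gbar D y : theta e D y -> gbar e D y.
Proof. by right. Qed.

Lemma cell_nbr_gbar D x y : cells e F D -> D x -> e x y -> gbar e D y.
Proof.
move=> cD Dx exy; have [Dy|nDy] := pselect (D y); first by left.
by right; split=> //; exists x.
Qed.

Hypothesis F1 : forall x y, F x -> F y -> ~~ e x y.
Hypothesis S1 : forall D, cells e F D -> finite_set D.

Lemma F_nbr u y : F u -> e u y -> ~ F y.
Proof. by move=> Fu euy Fy; have := F1 Fu Fy; rewrite euy. Qed.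

Lemma F_nbr_theta u y : F u -> e u y -> theta e (cell_of y) u.
Proof.
move=> Fu euy; have nFy := F_nbr Fu euy; split.
  by move=> /(cell_notF (cell_of_cells nFy)).
by exists y; [exact: cell_of_refl|rewrite adjC].
Qed.

Lemma gbar_finite D : cells e F D -> finite_set (gbar e D).
Proof.
move=> cD; have [_ _ _ fin _] := Xgraph.
rewrite /gbar finite_setU; split; first exact: S1.
apply: (@sub_finite_set _ _ (\bigcup_(x in D) gnbr e x)).
  by move=> y [_ [x Dx exy]]; exists x.
by apply: bigcup_finite => [|x _]; [exact: S1|exact: fin].
Qed.

Definition ts (D : set V) : seq V := enum_fset (fset_set (theta e D)).

Lemma uniq_ts D : uniq (ts D). Proof. exact: fset_uniq. Qed.

Lemma tsP D x : cells e F D -> reflect (theta e D x) (x \in ts D).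
Proof.
move=> cD; have fin : finite_set (theta e D).
  by apply: sub_finite_set (gbar_finite cD) => y; right.
by rewrite /ts in_fset_set//; apply: (iffP idP); rewrite inE.
Qed.

Lemma size_ts D : size (ts D) = theta_card e D. Proof. by []. Qed.

Lemma cnb_nb D x : cells e F D -> D x -> perm_eq (cnb e D x) (nb e x).
Proof.
move=> cD Dx; have fD := gbar_finite cD.
apply: uniq_perm; [exact: uniq_cnb|exact: uniq_nb|move=> y].
rewrite mem_cnb// mem_nb//; case exy : (e x y) => //=.
by apply/gbP => //; exact: cell_nbr_gbar exy.
Qed.

(** By (F1) a boundary vertex has no neighbour on the boundary, so its neighbours in the closed cell
    lie in the cell itself. *)
Lemma cnb_boundary D u : cells e F D -> theta e D u ->
  perm_eq (cnb e D u) [seq y <- nb e u | `[< D y >]].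
Proof.
move=> cD Du; have fD := gbar_finite cD.
apply: uniq_perm; [exact: uniq_cnb|by rewrite filter_uniq ?uniq_nb|move=> y].
rewrite mem_cnb// mem_filter mem_nb// andbC; case euy : (e u y); rewrite ?andbF// !andbT.
apply/gbP/asboolP => // [[//|Dy]|]; last by left.
by have := F_nbr (theta_F cD Du) euy (theta_F cD Dy).
Qed.

(** * Transport along cell isomorphisms *)

Section Iso.
Variables (C D : set V) (a : V -> V).
Hypotheses (cC : cells e F C) (cD : cells e F D) (iso : cell_iso e C D a).

Lemma iso_gbar x : gbar e C x -> gbar e D (a x).
Proof. by case: iso => [[f _ _] _ _]; exact: f. Qed.

Lemma iso_inj x y : gbar e C x -> gbar e C y -> a x = a y -> x = y.
Proof.
by case: iso => [[_ i _] _ _] Cx Cy; apply: i; rewrite inE.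
Qed.

Lemma iso_surj y : gbar e D y -> exists2 x, gbar e C x & a x = y.
Proof. by case: iso => [[_ _ s] _ _] /s[x Cx <-]; exists x. Qed.

Lemma iso_edge x y : gbar e C x -> gbar e C y -> e (a x) (a y) = e x y.
Proof. by case: iso => [_ h _]; exact: h. Qed.

Lemma iso_theta x : gbar e C x -> theta e D (a x) <-> theta e C x.
Proof.
case: iso => [_ _ E] Cx; split=> [|Tx]; last by rewrite -E; exists x.
rewrite -E => -[x' Tx' ax]; rewrite -(iso_inj _ Cx ax)//.
exact: theta_gbar.
Qed.

Lemma iso_cell x : gbar e C x -> D (a x) <-> C x.
Proof.
move=> Cx; split=> H.
  case: (Cx) => // /(iso_theta Cx) T.
  by exfalso; exact: (cell_notF cD H (theta_F cD T)).
case: (iso_gbar Cx) => // /(iso_theta Cx) T.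
by exfalso; exact: (cell_notF cC H (theta_F cC T)).
Qed.

Lemma iso_uniq (s : seq V) : uniq s -> (forall x, x \in s -> gbar e C x) ->
  uniq (map a s).
Proof.
move=> us H; rewrite map_inj_in_uniq// => x y xs ys.
by apply: iso_inj; exact: H.
Qed.

Lemma iso_cnb x : gbar e C x -> perm_eq (map a (cnb e C x)) (cnb e D (a x)).
Proof.
move=> Cx; have fC := gbar_finite cC; have fD := gbar_finite cD.
apply: uniq_perm; [|exact: uniq_cnb|].
  apply: iso_uniq; first exact: uniq_cnb.
  by move=> y; rewrite mem_cnb// => /andP[_ /(gbP fC)].
move=> y; apply/mapP/idP => [[x' + ->]|].
  rewrite !mem_cnb// => /andP[exx' /(gbP fC) Cx'].
  by rewrite iso_edge// exx'; apply/gbP => //; exact: iso_gbar.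
rewrite mem_cnb// => /andP[eay /(gbP fD)/iso_surj[x' Cx' E]].
exists x' => //; rewrite mem_cnb//; apply/andP; split; last exact/gbP.
by rewrite -iso_edge// E.
Qed.

Lemma iso_deg x : gbar e C x -> cell_deg e D (a x) = cell_deg e C x.
Proof.
by move=> /iso_cnb/perm_size; rewrite size_map !size_cnb.
Qed.

Lemma iso_ts : perm_eq (map a (ts C)) (ts D).
Proof.
apply: uniq_perm; [|exact: uniq_ts|].
  apply: iso_uniq; first exact: uniq_ts.
  by move=> y /(tsP _ cC); exact: theta_gbar.
move=> y; apply/mapP/idP => [[x' /(tsP _ cC) Tx' ->]|].
  by apply/tsP => //; apply/iso_theta => //; exact: theta_gbar.
move=> /(tsP _ cD) Ty; have [x Cx E] := iso_surj (theta_gbar Ty).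
by exists x => //; apply/tsP => //; apply/(iso_theta Cx); rewrite E.
Qed.

Lemma iso_cell_nb x : C x -> perm_eq (map a (cnb e C x)) (nb e (a x)).
Proof.
move=> Cx; have Gx : gbar e C x by left.
by apply: perm_trans (iso_cnb Gx) (cnb_nb cD _); exact/(iso_cell Gx).
Qed.

Lemma iso_cell_deg x : C x -> gdeg e (a x) = cell_deg e C x.
Proof. by move=> /iso_cell_nb/perm_size; rewrite size_map size_cnb size_nb. Qed.

Lemma iso_srw (R : realType) (g : V -> R[i]) (B : set V) x : C x -> x \notin B ->
  srw_op e g (a x) = cell_op e C B (g \o a) x.
Proof.
move=> Cx xB; rewrite srw_opE// /cell_op (negPf xB) iso_cell_deg//.
by rewrite -(perm_big _ (iso_cell_nb Cx)) big_map.
Qed.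

End Iso.

Lemma iso_comp C D (a b : V -> V) : cell_iso e C C b -> cell_iso e C D a ->
  cell_iso e C D (a \o b).
Proof.
move=> [bb eb tb] [ba ea ta].
have fb : set_fun (gbar e C) (gbar e C) b by case: bb.
split.
- exact: set_bij_comp bb ba.
- by move=> x y Cx Cy; rewrite /= ea ?eb//; exact: fb.
- by rewrite -ta -[in RHS]tb image_comp.
Qed.

End Cells.

(** * The functional equation *)

Lemma seq_max (R : realType) (T : eqType) (g : T -> R) (s : seq T) : s != [::] ->
  exists2 t0, t0 \in s & forall t, t \in s -> g t <= g t0.
Proof.
elim: s => [//|a [|b s] IH] _.
  by exists a; rewrite ?mem_head// => t; rewrite inE => /eqP->.
have [//|t0 t0s H] := IH.
have [le|/ltW le] := leP (g t0) (g a).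
  exists a; rewrite ?mem_head// => t; rewrite in_cons => /orP[/eqP->//|/H ht].
  exact: le_trans le.
exists t0; first by rewrite in_cons t0s orbT.
by move=> t; rewrite in_cons => /orP[/eqP->//|/H].
Qed.

Section FunctionalEquation.
Variables (R : realType) (V : choiceType) (e : rel V) (F : set V) (C : set V).
Variables (v w : V).
Hypotheses (Xgraph : graph_ax e) (Xsym : symmetrically_self_similar e F).
Hypotheses (Ccell : cells e F C) (Cv : theta e C v) (Cw : theta e C w).
Hypothesis neq_vw : v <> w.

Let F1 : forall x y, F x -> F y -> ~~ e x y.
Proof. by case: Xsym => -[]. Qed.

Let F2 : forall D E, cells e F D -> cells e F E -> D <> E ->
  (gbar e D `&` gbar e E #<= `I_1)%card.
Proof. by case: Xsym => -[]. Qed.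

Let S1 : forall D, cells e F D -> finite_set D.
Proof. by case: Xsym => _ []. Qed.

Let gfin : forall D, cells e F D -> finite_set (gbar e D) := gbar_finite Xgraph S1.

Definition bnd : set V := theta e C `\ v.

(** Double transitivity moves [v] to any boundary vertex of the model cell before passing to [D]. *)
Lemma cell_iso_pt D u : cells e F D -> theta e D u ->
  exists2 a, cell_iso e C D a & a v = u.
Proof.
case: Xsym => _ [_ S2] S3 cD Du; have [b ib] := S2 C D Ccell cD.
have [v' Tv' bv'] : exists2 v', theta e C v' & b v' = u.
  by case: (ib) => _ _ E; move: Du; rewrite -E.
(* (S3) moves pairs of distinct vertices, so the target [v'] is completed to such a pair by [v] or
   by [w]. *)
have [w' Tw' vw'] : exists2 w', theta e C w' & v' <> w'.
  have [vE|vN] := pselect (v' = v); last by exists v.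
  by exists w => //; rewrite vE.
have [c [ic cv _]] := S3 C Ccell v w v' w' Cv Cw neq_vw Tv' Tw' vw'.
by exists (b \o c); [exact: iso_comp ib|rewrite /= cv].
Qed.

Definition delta := cell_deg e C v.

Lemma cell_deg_boundary D u : cells e F D -> theta e D u ->
  cell_deg e D u = delta.
Proof.
move=> cD Du; have [a ia av] := cell_iso_pt cD Du.
by rewrite -av (iso_deg Xgraph S1 Ccell cD ia)//; right.
Qed.

Lemma theta_card_cell D : cells e F D -> theta_card e D = theta_card e C.
Proof.
move=> cD; case: Xsym => _ [_ S2] _; have [b ib] := S2 C D Ccell cD.
by have /perm_size := iso_ts Xgraph S1 Ccell cD ib; rewrite size_map !size_ts.
Qed.

Lemma delta_gt0 : (0 < delta)%N.
Proof.
have fC := gfin Ccell.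
case: (Cv) => _ [x Cx exv]; rewrite /delta -size_cnb.
case E : (cnb e C v) => //.
have : x \in cnb e C v.
  by rewrite mem_cnb// (adjC Xgraph) exv /=; apply/gbP => //; left.
by rewrite E.
Qed.

(** (F2) in its working form: two distinct vertices belong to at most one closed cell. *)
Lemma cells_meet D E u t : cells e F D -> cells e F E -> u <> t ->
  gbar e D u -> gbar e E u -> gbar e D t -> gbar e E t -> D = E.
Proof.
move=> cD cE ut Du Eu Dt Et; apply: contrapT => DE.
have := F2 cD cE DE; set A := gbar e D `&` gbar e E => cA.
have fA : finite_set A by apply: finite_setIl; exact: gfin.
have := geq_card_fset_set cA.
have uA : u \in enum_fset (fset_set A) by rewrite in_fset_set// inE.
have tA : t \in enum_fset (fset_set A) by rewrite in_fset_set// inE.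
case: (enum_fset _) uA tA => [//|a [|//]].
by rewrite !inE => /eqP ua /eqP ta _; apply: ut; rewrite ua ta.
Qed.

Lemma cell_op_iso (D : set V) a (B B' : set V) (K : V -> R[i]) t :
  cells e F D -> cell_iso e C D a -> gbar e C t -> (a t \in B') = (t \in B) ->
  cell_op e D B' K (a t) = cell_op e C B (K \o a) t.
Proof.
move=> cD ia Ct EB; rewrite /cell_op EB; case: ifP => // _.
rewrite (iso_deg Xgraph S1 Ccell cD ia)// -(perm_big _ (iso_cnb Xgraph S1 Ccell cD ia Ct)).
by rewrite big_map.
Qed.

Lemma bnd_notin x : C x -> x \notin bnd.
Proof.
move=> Cx; apply/negP; rewrite inE => -[/(theta_F Xgraph Ccell) Fx _].
exact: (cell_notF Ccell Cx).
Qed.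

Lemma v_notin_bnd : v \notin bnd.
Proof. by apply/negP; rewrite inE => -[_]; apply. Qed.

(** An automorphism of the cell fixing [v] and sending [w] to [s] pulls the column of [s] back to a
    solution of the problem that defines the column of [w]; solutions are unique. Hence a single
    entry describes all boundary values seen from [v]. *)
Lemma Qstar_boundary_sym (z : R[i]) s : nc z < 1 -> theta e C s -> s <> v ->
  rval (Qstar R e C bnd v s) (Some z) = rval (Qstar R e C bnd v w) (Some z).
Proof.
move=> z1 Ts sv; have fC := gfin Ccell; case: Xsym => _ _ S3.
have [a [ia av aw]] := S3 C Ccell v w v s Cv Cw neq_vw Cv Ts (nesym sv).
have Gv := theta_gbar Cv; have Gs := theta_gbar Ts; have Gw := theta_gbar Cw.
pose k t := rval (Qstar R e C bnd (a t) s) (Some z).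
have kE t : gbar e C t -> k t = (t == w)%:R + z * cell_op e C bnd k t.
  move=> Gt; rewrite /k (cell_fundamental fC bnd z1 Gs (iso_gbar ia Gt)).
  congr (_ + _ * _).
    congr ((nat_of_bool _)%:R); apply/eqP/eqP => [|->//].
    by rewrite -aw; exact: (iso_inj ia).
  apply: (cell_op_iso _ Ccell ia Gt).
  apply/idP/idP; rewrite !inE => -[T tv]; split.
  - exact/(iso_theta ia Gt).
  - by move=> tE; apply: tv; rewrite tE.
  - exact/(iso_theta ia Gt).
  - by rewrite -av => /(iso_inj ia Gt Gv).
have := cell_solve fC z1 kE Gv; rewrite /k av => ->.
under eq_bigr do rewrite mulrC.
by rewrite sum_delta ?uniq_gb// ifT//; apply/gbP.
Qed.

Local Notation f := (f_fun R e C v).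
Local Notation dq := (Qstar R e C bnd v w).

Lemma cell_equation (z : R[i]) (g : V -> R[i]) D u : nc z < 1 ->
  cells e F D -> theta e D u -> (forall t, D t -> g t = z * srw_op e g t) ->
  rval f (Some z) * (g u - z * (delta%:R^-1 * \sum_(y <- nb e u | `[< D y >]) g y)) =
  g u - rval dq (Some z) * \sum_(t <- ts e D | t != u) g t.
Proof.
move=> z1 cD Du gD; have fC := gfin Ccell.
have [a ia av] := cell_iso_pt cD Du.
have Gv := theta_gbar Cv.
pose k := g \o a.
(* Dirichlet data for [g] in the model cell: its values on the boundary other than [v], the defect
   of the equation at [v], and 0 inside. *)
pose rhs t := if t == v then k v - z * cell_op e C bnd k v
  else if t \in ts e C then k t else 0.
have kE t : gbar e C t -> k t = rhs t + z * cell_op e C bnd k t.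
  move=> Gt; rewrite /rhs; case: eqP => [->|tv]; first by rewrite subrK.
  case: (tsP Xgraph S1 t Ccell) => Tt.
    have tB : t \in bnd by rewrite inE.
    by rewrite /cell_op tB mulr0 addr0.
  have Ct : C t by case: Gt.
  rewrite add0r -(iso_srw Xgraph S1 Ccell cD ia g Ct (bnd_notin Ct)).
  by apply: gD; exact/(iso_cell Xgraph Ccell cD ia Gt).
have rv : rhs v = g u - z * cell_op e C bnd k v by rewrite /rhs eqxx /k /= av.
have := cell_solve fC z1 kE Gv.
rewrite (bigD1_seq v) ?uniq_gb//=; last exact/gbP.
rewrite rv {1}/k /= av.
have -> : cell_op e C bnd k v = delta%:R^-1 * \sum_(y <- nb e u | `[< D y >]) g y.
  rewrite /cell_op (negPf v_notin_bnd) -/delta; congr (_ * _).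
  rewrite -(big_map a xpredT g) (perm_big _ (iso_cnb Xgraph S1 Ccell cD ia Gv)) av.
  by rewrite (perm_big _ (cnb_boundary Xgraph F1 S1 cD Du)) big_filter.
move=> E; apply: (canRL (addrK _)); apply/esym; rewrite [LHS]E; congr (_ + _).
rewrite -(perm_big _ (iso_ts Xgraph S1 Ccell cD ia)) big_map mulr_sumr.
rewrite big_seq_cond [RHS]big_seq_cond.
transitivity (\sum_(y <- gb e C | (y \in ts e C) && (y != v)) rval dq (Some z) * g (a y)).
  rewrite [RHS]big_mkcond [LHS]big_mkcond; apply: eq_big_seq => y /(gbP fC) Gy.
  rewrite (introT (gbP fC y) Gy) /= /rhs; case: eqP => [->|yv] /=; first by rewrite andbF.
  rewrite andbT; case: (tsP Xgraph S1 y Ccell) => Ty; last by rewrite mulr0.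
  by rewrite Qstar_boundary_sym.
rewrite -[LHS]big_filter -[RHS]big_filter; apply: perm_big; apply: uniq_perm.
- by rewrite filter_uniq ?uniq_gb.
- by rewrite filter_uniq ?uniq_ts.
move=> y; rewrite !mem_filter -andbA.
case: (tsP Xgraph S1 y Ccell) => Ty //=.
have Gy := theta_gbar Ty; rewrite (introT (gbP fC y) Gy) !andbT -av.
by congr negb; apply/eqP/eqP => [->//|]; exact: (iso_inj ia).
Qed.

(** * The reduced graph and the averaged equation *)

Variable psi : V -> V.
Hypothesis psi_bij : set_bij setT F psi.
Hypothesis psi_adj : forall x y, e x y <-> reduced_adj e F (psi x) (psi y).

Lemma psi_F x : F (psi x).
Proof. by case: psi_bij => f _ _; exact: f. Qed.

Lemma psi_inj : injective psi.
Proof. by case: psi_bij => _ i _ x y; apply: i; rewrite inE. Qed.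

Lemma psi_surj u : F u -> exists x, psi x = u.
Proof. by case: psi_bij => _ _ s /s[x _ <-]; exists x. Qed.

Lemma theta_psi_nb x y t : e (psi x) y ->
  (t \in map psi (nb e x)) && `[< theta e (cell_of e F y) t >] =
  (t \in ts e (cell_of e F y)) && (t != psi x).
Proof.
move=> exy; have nFy := F_nbr F1 (psi_F x) exy.
have cD := cell_of_cells e nFy.
have Tx := F_nbr_theta Xgraph F1 (psi_F x) exy.
apply/andP/andP => -[].
  move=> /mapP[x' + ->] /asboolP T; rewrite mem_nb// => exx'; split.
    exact/(tsP Xgraph S1 _ cD).
  by have /psi_adj[_ _ + _] := exx'; move=> /eqP; rewrite eq_sym.
move=> /(tsP Xgraph S1 _ cD) T /eqP tx; split; last exact/asboolP.
have [x' x't] := psi_surj (theta_F Xgraph cD T); rewrite -x't.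
rewrite map_f// mem_nb//; apply/psi_adj; split; rewrite ?x't.
- exact: psi_F.
- exact: theta_F T.
- exact/nesym.
- by exists (cell_of e F y).
Qed.

(** By [cells_meet] only one cell has both [psi x] and [psi t] on its boundary; the neighbours
    counted are those of [psi x] in that cell. *)
Lemma count_nb_theta x t : e x t ->
  count (fun y => `[< theta e (cell_of e F y) (psi t) >]) (nb e (psi x)) = delta.
Proof.
move=> /psi_adj[_ _ xt [D [cD Dx Dt]]].
rewrite -(cell_deg_boundary cD Dx) -size_cnb.
rewrite (perm_size (cnb_boundary Xgraph F1 S1 cD Dx)) size_filter.
apply: eq_in_count => y; rewrite mem_nb// => exy.
have nFy := F_nbr F1 (psi_F x) exy.
have cE := cell_of_cells e nFy.
apply/asboolP/asboolP => [Ty|Dy]; last by rewrite -(cell_eq Xgraph cD Dy).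
have Tx := F_nbr_theta Xgraph F1 (psi_F x) exy.
rewrite (@cells_meet D (cell_of e F y) (psi x) (psi t)) //.
- exact: cell_of_refl.
- exact: theta_gbar.
- exact: theta_gbar.
- exact: theta_gbar.
- exact: theta_gbar.
Qed.

Lemma double_count (g : V -> R[i]) x :
  \sum_(y <- nb e (psi x)) \sum_(t <- ts e (cell_of e F y) | t != psi x) g t =
  delta%:R * \sum_(t <- nb e x) g (psi t).
Proof.
transitivity (\sum_(y <- nb e (psi x)) \sum_(t <- map psi (nb e x))
    if `[< theta e (cell_of e F y) t >] then g t else 0).
  apply: eq_big_seq => y; rewrite mem_nb// => exy.
  rewrite -big_mkcond -[LHS]big_filter -[RHS]big_filter; apply: perm_big.
  apply: uniq_perm; rewrite ?filter_uniq ?uniq_ts//.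
    by rewrite map_inj_uniq ?uniq_nb//; exact: psi_inj.
  by move=> t; rewrite !mem_filter [RHS]andbC theta_psi_nb// andbC.
rewrite exchange_big big_map mulr_sumr; apply: eq_big_seq => t.
rewrite mem_nb// => ext; rewrite -big_mkcond big_const_seq count_nb_theta//.
by rewrite iter_addr addr0 mulr_natl.
Qed.

Lemma count_neq_ts D u : cells e F D -> theta e D u ->
  count (fun t => t != u) (ts e D) = (theta_card e C).-1.
Proof.
move=> cD Du; rewrite -(theta_card_cell cD) -size_ts.
have := count_predC (pred1 u) (ts e D).
rewrite count_uniq_mem ?uniq_ts// (introT (tsP Xgraph S1 u cD) Du).
by rewrite add1n => <-.
Qed.

Lemma theta_card_ge2 : (1 < theta_card e C)%N.
Proof.
rewrite -size_ts.
have := introT (tsP Xgraph S1 v Ccell) Cv; have := introT (tsP Xgraph S1 w Ccell) Cw.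
case: (ts e C) => [//|a [|//]]; rewrite !inE => /eqP wa /eqP va.
by exfalso; apply: neq_vw; rewrite wa va.
Qed.

(** The case [g = 1] of the double count: the cell of each neighbour of [psi x] has
    [theta_card e C - 1] boundary vertices other than [psi x]. *)
Lemma degree_identity x :
  ((gdeg e (psi x))%:R * ((theta_card e C)%:R - 1) = delta%:R * (gdeg e x)%:R :> R[i]).
Proof.
have := double_count (fun=> 1) x.
rewrite [in RHS]big_const_seq count_predT size_nb iter_addr addr0 -[1 *+ _]/(_%:R).
move=> <-; transitivity (\sum_(y <- nb e (psi x)) (theta_card e C).-1%:R : R[i]).
  rewrite big_const_seq count_predT size_nb iter_addr addr0 -[RHS]mulr_natl.
  congr (_ * _); rewrite -[in LHS](prednK (ltnW theta_card_ge2)) -natr1; ring.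
apply: eq_big_seq => y; rewrite mem_nb// => exy.
have nFy := F_nbr F1 (psi_F x) exy.
rewrite big_const_seq (count_neq_ts (cell_of_cells e nFy)) ?iter_addr ?addr0//.
exact: (F_nbr_theta Xgraph F1 (psi_F x) exy).
Qed.

Definition dval (z : R[i]) : R[i] := ((theta_card e C)%:R - 1) * rval dq (Some z).

(** [cell_equation] is summed over the neighbours [y] of [psi x], taking the cell of [y]. On the
    left each neighbour occurs [delta] times, once for every [y] in its cell, which cancels
    [delta^-1]; on the right [double_count] produces the neighbours in the reduced graph and
    [degree_identity] normalises them. *)
Lemma averaged_equation (z : R[i]) (g : V -> R[i]) x : nc z < 1 ->
  (forall t, ~ F t -> g t = z * srw_op e g t) ->
  rval f (Some z) * (g (psi x) - z * srw_op e g (psi x)) =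
  g (psi x) - dval z * srw_op e (g \o psi) x.
Proof.
move=> z1 gF; set u := psi x.
have Fu : F u := psi_F x.
have mu0 := gdegC_neq0 R Xgraph u; have mx0 := gdegC_neq0 R Xgraph x.
have d0 : (delta%:R : R[i]) != 0 by rewrite pnatr_eq0 -lt0n delta_gt0.
have E : \sum_(y <- nb e u) rval f (Some z) * (g u - z * (delta%:R^-1 *
      \sum_(y' <- nb e u | `[< cell_of e F y y' >]) g y')) =
    \sum_(y <- nb e u) (g u - rval dq (Some z) *
      \sum_(t <- ts e (cell_of e F y) | t != u) g t).
  apply: eq_big_seq => y; rewrite mem_nb// => euy.
  have nFy := F_nbr F1 Fu euy; have cD := cell_of_cells e nFy.
  apply: cell_equation => //; first exact: F_nbr_theta.
  by move=> t /(cell_notF cD); exact: gF.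
apply: (mulfI mu0).
transitivity (\sum_(y <- nb e u) rval f (Some z) * (g u - z * (delta%:R^-1 *
      \sum_(y' <- nb e u | `[< cell_of e F y y' >]) g y'))).
  rewrite -mulr_sumr mulrCA; congr (_ * _).
  rewrite sumrB -!mulr_sumr big_const_seq count_predT size_nb iter_addr addr0.
  rewrite mulrBr mulr_natl; congr (_ - _).
  rewrite srw_opE// mulrCA; congr (_ * _); rewrite mulrA divff// mul1r.
  transitivity (delta%:R^-1 * \sum_(y' <- nb e u) delta%:R * g y').
    by rewrite -mulr_sumr mulrA mulVf// mul1r.
  congr (_ * _); under [RHS]eq_bigr do rewrite big_mkcond.
  rewrite exchange_big; apply: eq_big_seq => y'; rewrite mem_nb// => euy'.
  rewrite -big_mkcond big_const_seq iter_addr addr0 -[RHS]mulr_natl; congr (_%:R * _).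
  have nFy' := F_nbr F1 Fu euy'; have cD := cell_of_cells e nFy'.
  have Tu := F_nbr_theta Xgraph F1 Fu euy'.
  rewrite -(cell_deg_boundary cD Tu) -size_cnb.
  rewrite (perm_size (cnb_boundary Xgraph F1 S1 cD Tu)) size_filter.
  apply: eq_in_count => y; rewrite mem_nb// => euy.
  have nFy := F_nbr F1 Fu euy; have cE := cell_of_cells e nFy.
  apply/asboolP/asboolP => H.
    by rewrite -(cell_eq Xgraph cD H); exact: cell_of_refl.
  by rewrite -(cell_eq Xgraph cE H); exact: cell_of_refl.
rewrite E sumrB -mulr_sumr double_count big_const_seq count_predT size_nb.
rewrite iter_addr addr0 mulrBr; congr (_ - _); first by rewrite mulr_natl.
rewrite srw_opE// /dval.
transitivity (rval dq (Some z) * (((gdeg e u)%:R * ((theta_card e C)%:R - 1)) *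
    ((gdeg e x)%:R^-1 * \sum_(t <- nb e x) g (psi t)))); last first.
  by move: (rval _ _) (_%:R) (_%:R - 1) (_^-1) (\sum_(_ <- _) _) => *; ring.
rewrite degree_identity -!mulrA; congr (_ * (_ * _)).
by rewrite mulrA divff// mul1r.
Qed.

(** By symmetry [dval z] is the value at [v] of the solution [k] that equals 1 on the rest of the
    boundary. The maximum principle gives [nc (k t) <= 1], and two steps from [v] are made before
    the boundary can be reached, each contributing a factor [nc z]. *)
Lemma dval_le (z : R[i]) : nc z < 1 -> nc (dval z) <= nc z ^+ 2.
Proof.
move=> z1; have fC := gfin Ccell; have Gv := theta_gbar Cv.
pose tsv := [seq s <- ts e C | s != v].
have mem_tsv s : s \in tsv -> theta e C s /\ s <> v.
  by rewrite mem_filter => /andP[/eqP ? /(tsP Xgraph S1 s Ccell)].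
pose k t := \sum_(s <- tsv) rval (Qstar R e C bnd t s) (Some z).
have kv : k v = dval z.
  rewrite /k /dval (eq_big_seq (fun=> rval dq (Some z))); last first.
    by move=> s /mem_tsv[Ts sv]; exact: Qstar_boundary_sym.
  rewrite big_const_seq count_predT size_filter (count_neq_ts Ccell Cv).
  rewrite iter_addr addr0 -[LHS]mulr_natl; congr (_ * _).
  rewrite -[in RHS](prednK (ltnW theta_card_ge2)) -natr1; ring.
have kE t : gbar e C t -> k t = (t \in tsv)%:R + z * cell_op e C bnd k t.
  move=> Gt; rewrite /k.
  rewrite (eq_big_seq (fun s => (t == s)%:R + z *
    cell_op e C bnd (fun t => rval (Qstar R e C bnd t s) (Some z)) t)); last first.
    by move=> s /mem_tsv[Ts _]; apply: cell_fundamental => //; exact: theta_gbar.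
  rewrite big_split /= -mulr_sumr; congr (_ + _ * _).
    under eq_bigr do rewrite eq_sym -[_%:R]mulr1.
    rewrite (sum_delta (V := V) t (fun=> 1)) ?filter_uniq ?uniq_ts//.
    by case: (t \in tsv).
  rewrite -(sum_Q_coef fC); under eq_bigr do rewrite -(sum_Q_coef fC).
  by rewrite exchange_big /=; apply: eq_bigr => y _; rewrite mulr_sumr.
have bndE t : gbar e C t -> (t \in bnd) = (t \in tsv).
  move=> Gt; rewrite mem_filter; apply/idP/andP; rewrite inE.
    by move=> [Tt tv]; split; [exact/eqP|exact/(tsP Xgraph S1 _ Ccell)].
  by move=> [/eqP tv /(tsP Xgraph S1 t Ccell) Tt].
have kB t : gbar e C t -> t \in tsv -> k t = 1.
  move=> Gt tt; rewrite kE// tt /cell_op bndE// tt mulr0 addr0 //.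
have kN t (b : R) : gbar e C t -> t \notin tsv -> 0 <= b ->
    (forall y, e t y -> gbar e C y -> nc (k y) <= b) -> nc (k t) <= nc z * b.
  move=> Gt tt b0 H; rewrite kE// (negPf tt) add0r ncM ler_wpM2l ?nc_ge0//.
  exact: cell_op_le.
have [t0 Gt0 tmax] : exists2 t0, gbar e C t0 &
    forall t, gbar e C t -> nc (k t) <= nc (k t0).
  have := @seq_max _ V (fun t => nc (k t)) (gb e C).
  case.
    by apply/eqP => E; have := introT (gbP fC v) Gv; rewrite E.
  by move=> t0 /(gbP fC) ? H; exists t0 => // t /(gbP fC)/H.
have M1 : nc (k t0) <= 1.
  case: (boolP (t0 \in tsv)) => tt; first by rewrite kB// nc1.
  have := kN t0 _ Gt0 tt (nc_ge0 _) (fun y _ => tmax y).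
  have := nc_ge0 (k t0); nra.
have k1 t : gbar e C t -> nc (k t) <= 1 by move=> /tmax H; exact: le_trans H M1.
have vt : v \notin tsv by rewrite mem_filter eqxx.
rewrite -kv expr2; apply: (kN v) => //; first exact: nc_ge0.
move=> y evy Gy; have nFy := F_nbr F1 (theta_F Xgraph Ccell Cv) evy.
have yt : y \notin tsv.
  by apply/negP => /mem_tsv[Ty _]; apply: nFy; exact: theta_F Ty.
rewrite -[leRHS]mulr1; apply: (kN y) => //.
by move=> t _; exact: k1.
Qed.

Lemma dval_fun (z : R[i]) : nc z < 1 ->
  rat_map (d_fun R e C v w) (Some z) = Some (dval z).
Proof.
move=> z1; apply: rat_mapZ.
have := @cell_regular R V e C (gfin Ccell) bnd z v w z1 (theta_gbar Cv) (theta_gbar Cw).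
by rewrite /rval /bnd; case: (rat_map _ _).
Qed.

Lemma f_regular (z : R[i]) : nc z < 1 -> rat_map f (Some z) <> None.
Proof.
by move=> z1; apply: cell_regular => //; [exact: gfin| |]; exact: theta_gbar.
Qed.

Lemma h_regular (z : R[i]) x y : nc z < 1 -> C x -> gbar e C y ->
  rat_map (h_fun R e C x y) (Some z) <> None.
Proof.
by move=> z1 Cx Gy; apply: cell_regular => //; [exact: gfin|left].
Qed.

(** Both sides solve the Green equation at [dval z]: the left one by [averaged_equation], since its
    defect at [psi t] is a delta. Their difference is bounded and harmonic, hence 0. *)
Lemma green_psi (z : R[i]) x y : nc z < 1 ->
  green e (psi x) (psi y) z = rval f (Some z) * green e x y (dval z).
Proof.
move=> z1.
have d1 : nc (dval z) < 1.
  apply: le_lt_trans (dval_le z1) _; rewrite expr2.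
  have := nc_ge0 z; nra.
pose g t := green e t (psi y) z.
pose k t : R[i] := g (psi t) - rval f (Some z) * green e t y (dval z).
have kE t : k t = dval z * srw_op e k t.
  have A : rval f (Some z) * (g (psi t) - z * srw_op e g (psi t)) =
      g (psi t) - dval z * srw_op e (g \o psi) t.
    apply: averaged_equation => // s nFs; rewrite {1}/g green_eq//.
    case: eqP => [sE|_]; last by rewrite add0r.
    by exfalso; apply: nFs; rewrite sE; exact: psi_F.
  have B : g (psi t) - z * srw_op e g (psi t) = (t == y)%:R.
    by rewrite {1}/g green_eq// addrK (inj_eq psi_inj).
  rewrite B in A; rewrite /k (green_eq Xgraph t y d1).
  have -> : srw_op e k t = srw_op e (g \o psi) t -
      rval f (Some z) * srw_op e (fun u => green e u y (dval z)) t.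
    by rewrite !srw_opE// sumrB mulrBr -mulr_sumr mulrCA.
  have -> : g (psi t) = rval f (Some z) * (t == y)%:R + dval z * srw_op e (g \o psi) t.
    by rewrite A subrK.
  move: (rval f _) (dval z) (srw_op _ _ _) (srw_op _ _ _) ((t == y)%:R).
  by move=> *; ring.
have kB t : nc (k t) <= (1 - nc z)^-1 + nc (rval f (Some z)) * (1 - nc (dval z))^-1.
  apply: le_trans (ncD _ _) _; rewrite ncN ncM; apply: lerD; first exact: green_le.
  by rewrite ler_wpM2l ?nc_ge0// green_le.
have := bounded_harmonic0 Xgraph d1 kB kE x.
by move=> /eqP; rewrite subr_eq0 => /eqP.
Qed.

(** The map vanishes at 0. If it also vanished at the positive number 1/2, the column of [w] would
    be 0 at [v]; its real part is nonnegative by the minimum principle, so the zero spreads through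
    the connected cell up to [w], where the value is 1. *)
Lemma d_nonconstant : nonconstant (d_fun R e C v w).
Proof.
have fC := gfin Ccell.
have Gv := theta_gbar Cv; have Gw := theta_gbar Cw.
pose z : R[i] := (2^-1 : R)%:C.
have zE : nc z = 2^-1 by rewrite nc_real ger0_norm.
have z1 : nc z < 1 by rewrite zE; lra.
have n0 : nc (0 : R[i]) < 1 by rewrite nc0.
exists (Some 0), (Some z); rewrite !dval_fun//.
have -> : dval 0 = 0.
  apply/eqP; rewrite -nc_eq0 eq_le nc_ge0 andbT.
  by have := dval_le n0; rewrite nc0 expr0n.
case=> d0.
pose k t := rval (Qstar R e C bnd t w) (Some z).
have kv0 : k v = 0.
  move: (d0) => /eqP; rewrite eq_sym /dval mulf_eq0 => /orP[|/eqP//].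
  rewrite subr_eq0 pnatr_eq1 => /eqP c1.
  by have := theta_card_ge2; rewrite c1.
pose r t : R := complex.Re (k t).
pose avg t : R := if t \in bnd then 0
  else (cell_deg e C t)%:R^-1 * \sum_(y <- cnb e C t) r y.
have ReZ (a : R) (b : R[i]) : complex.Re (a%:C * b) = a * complex.Re b.
  by case: b => b1 b2 /=; rewrite mul0r subr0.
have ReD (a b : R[i]) : complex.Re (a + b) = complex.Re a + complex.Re b.
  by case: a b => [? ?] [? ?].
have ReS (s : seq V) : complex.Re (\sum_(y <- s) k y) = \sum_(y <- s) r y.
  by apply: (big_morph (fun a : R[i] => complex.Re a)) => //; exact: ReD.
have natC n : (n%:R : R[i]) = (n%:R : R)%:C by rewrite rmorph_nat.
have rE t : gbar e C t -> r t = (t == w)%:R + 2^-1 * avg t.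
  move=> Gt; rewrite /r {1}/k (cell_fundamental fC bnd z1 Gw Gt) ReD ReZ natC /=.
  congr (_ + _ * _); rewrite /cell_op /avg; case: ifP => // _.
  by rewrite natC -fmorphV ReZ ReS.
have [t0 /(gbP fC) Gt0 tmin] : exists2 t0, t0 \in gb e C &
    forall t, t \in gb e C -> - r t <= - r t0.
  apply: seq_max; apply/eqP => E; have := introT (gbP fC v) Gv.
  by rewrite E.
have r0 t : gbar e C t -> 0 <= r t.
  move=> /(gbP fC)/tmin; rewrite lerN2; apply: le_trans.
  rewrite leNgt; apply/negP => neg.
  have A : r t0 <= avg t0.
    rewrite /avg; case: ifP => _; first exact: ltW.
    rewrite -size_cnb; case E : (cnb e C t0) => [|a s].
      by rewrite big_nil mulr0 ltW.
    rewrite -E ler_pdivlMl; last by rewrite ltr0n E.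
    rewrite mulrC mulr_natr -[leLHS]addr0 -iter_addr -count_predT -big_const_seq.
    rewrite big_seq [leRHS]big_seq; apply: ler_sum => y.
    by rewrite mem_cnb// => /andP[_ /tmin]; rewrite lerN2.
  have := rE t0 Gt0; have : 0 <= (t0 == w)%:R :> R by [].
  lra.
have prop t y : gbar e C t -> t \notin bnd -> r t = 0 -> e t y -> gbar e C y -> r y = 0.
  move=> Gt tB rt ety /(gbP fC) Gy.
  have yc : y \in cnb e C t by rewrite mem_cnb// ety.
  have d0' : 0 < (cell_deg e C t)%:R :> R.
    by rewrite ltr0n -size_cnb; case: (cnb e C t) yc.
  have S0 : 0 <= \sum_(y' <- cnb e C t) r y'.
    rewrite big_seq; apply: sumr_ge0 => y'; rewrite mem_cnb// => /andP[_ /(gbP fC)].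
    exact: r0.
  have : \sum_(y' <- cnb e C t) r y' <= 0.
    have := rE t Gt; rewrite rt /avg (negPf tB) => E.
    have : 0 <= (t == w)%:R :> R by [].
    have : 0 <= (cell_deg e C t)%:R^-1 * \sum_(y' <- cnb e C t) r y'.
      by rewrite mulr_ge0 ?invr_ge0// ltW.
    move=> H1 H2; have : (cell_deg e C t)%:R^-1 * \sum_(y' <- cnb e C t) r y' <= 0 by lra.
    by rewrite pmulr_rle0 ?invr_gt0.
  move=> Sle; apply/eqP; rewrite eq_le r0 ?andbT; last exact/(gbP fC).
  apply: le_trans Sle; rewrite (bigD1_seq y)//= ?uniq_cnb// lerDl.
  rewrite big_seq_cond; apply: sumr_ge0 => y' /andP[+ _].
  by rewrite mem_cnb// => /andP[_ /(gbP fC)]; exact: r0.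
have [_ [x1 Cx1 ex1]] := Cv; have [_ [x2 Cx2 ex2]] := Cw.
have rx1 : r x1 = 0.
  apply: (prop v) => //; first exact: v_notin_bnd.
  - by rewrite /r kv0.
  - by rewrite (adjC Xgraph).
  - by left.
have rx2 : r x2 = 0.
  move: (Cx2); rewrite (cell_eq Xgraph Ccell Cx1) => -[p [pe lp Hp]].
  elim: p (x1) Cx1 rx1 pe lp Hp {ex1} => [|a p IH] x Cx rx /=; first by move=> _ <-.
  move=> /andP[exa pe] lp Hp.
  have Ca : C a.
    by apply: (cell_nbr Xgraph Ccell Cx exa); apply: Hp; rewrite !inE eqxx orbT.
  apply: (IH a) => //; last by move=> u ua; apply: Hp; rewrite in_cons ua orbT.
  by apply: (prop x) => //; [left|exact: bnd_notin|left].
have : r w = 0 by apply: (prop x2) => //; [left|exact: bnd_notin].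
have wB : w \in bnd by rewrite inE; split=> //; exact/nesym.
by rewrite rE// eqxx /avg wB mulr0 addr0 => /eqP; rewrite oner_eq0.
Qed.

End FunctionalEquation.

(** * Continuation along the basin *)

Lemma ler_sum_sub (R : realType) (T : eqType) (g : T -> R) (s s' : seq T) :
  (forall t, 0 <= g t) -> uniq s -> {subset s <= s'} ->
  \sum_(t <- s) g t <= \sum_(t <- s') g t.
Proof.
move=> g0; elim: s s' => [|a s IH] s' /=.
  by move=> _ _; rewrite big_nil sumr_ge0.
move=> /andP[nas us] sub; have as' : a \in s' by apply: sub; exact: mem_head.
rewrite (perm_big _ (perm_to_rem as')) !big_cons lerD2l; apply: IH => // y ys.
apply: rem_mem; first by apply: contraNneq nas => <-.
by apply: sub; rewrite in_cons ys orbT.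
Qed.

Section Continuation.
Variables (R : realType) (V : choiceType) (e : rel V) (F : set V) (C : set V).
Variables (v w : V).
Hypotheses (Xgraph : graph_ax e) (Xsym : symmetrically_self_similar e F).
Hypotheses (Ccell : cells e F C) (Cv : theta e C v) (Cw : theta e C w).
Hypothesis neq_vw : v <> w.
Variable psi : V -> V.
Hypothesis psi_bij : set_bij setT F psi.
Hypothesis psi_adj : forall x y, e x y <-> reduced_adj e F (psi x) (psi y).
Variable iso_to : set V -> V -> V.
Hypothesis iso_toP : forall D, cells e F D -> cell_iso e C D (iso_to D).
Local Notation cs := (csphere R).
Local Notation chart := (@csphere_chart R).
Local Notation f := (f_fun R e C v).
Local Notation dmap := (rat_map (d_fun R e C v w)).
Local Notation dv := (@dval R V e C v w).

Let F1 : forall x y, F x -> F y -> ~~ e x y.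
Proof. by case: Xsym => -[]. Qed.

Let S1 : forall D, cells e F D -> finite_set D.
Proof. by case: Xsym => _ []. Qed.

Let gfin : forall D, cells e F D -> finite_set (gbar e D) := gbar_finite Xgraph S1.

Definition iso_inv (D : set V) (y : V) : V :=
  xget y [set x | gbar e C x /\ iso_to D x = y].
Definition psi_inv (u : V) : V := xget u [set x | psi x = u].

Lemma iso_invP D y : cells e F D -> gbar e D y ->
  gbar e C (iso_inv D y) /\ iso_to D (iso_inv D y) = y.
Proof.
move=> cD Dy; have [x Cx E] := iso_surj (iso_toP cD) Dy.
by apply: (xgetPex y (P := [set x | gbar e C x /\ iso_to D x = y])); exists x.
Qed.

Lemma iso_inv_cell D y : cells e F D -> D y -> C (iso_inv D y).
Proof.
move=> cD Dy; have [Cx E] := iso_invP cD (or_introl Dy).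
by apply/(iso_cell Xgraph Ccell cD (iso_toP cD) Cx); rewrite E.
Qed.

Lemma iso_invK D x : cells e F D -> gbar e C x -> iso_inv D (iso_to D x) = x.
Proof.
move=> cD Cx; have := iso_invP cD (iso_gbar (iso_toP cD) Cx).
by move=> [Cy]; exact: (iso_inj (iso_toP cD)).
Qed.

Lemma psi_invK u : F u -> psi (psi_inv u) = u.
Proof.
move=> Fu; have [x E] := psi_surj psi_bij Fu.
exact: (xgetPex u (P := [set x | psi x = u]) (ex_intro _ x E)).
Qed.

(** The vertices of [F] at which a walk started in [x] can first meet [F]. *)
Definition bd (x : V) : seq V :=
  if `[< F x >] then [:: x] else ts e (cell_of e F x).

(** Generating function of the first visit to [F] from [x] when it happens at [u], transported to
    the model cell [C]; it is meant for [u] in [bd x]. *)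
Definition harm (x u : V) (z : cs) : R[i] :=
  if `[< F x >] then 1
  else rval (h_fun R e C (iso_inv (cell_of e F x) x) (iso_inv (cell_of e F x) u)) z.

Definition local_green (x y : V) (z : cs) : R[i] :=
  if `[< F x >] then 0 else if `[< cell_of e F x y >] then
    rval (h_fun R e C (iso_inv (cell_of e F x) x) (iso_inv (cell_of e F x) y)) z
  else 0.

(* Formula for [K x y z] in terms of [K _ _ (d z)]: [local_green] counts the
   walks that stay in the cell of [x], the double sum those that visit [F];
   reversibility turns the last exit before [y] into a first exit from [y]. *)
Definition lift (K : V -> V -> cs -> R[i]) (x y : V) (z : cs) : R[i] :=
  local_green x y z +
  \sum_(u <- bd x) \sum_(t <- bd y)
    harm x u z * (rval f z * K (psi_inv u) (psi_inv t) (dmap z)) *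
    (harm y t z * ((gdeg e y)%:R / (gdeg e t)%:R)).

(** To be used where [iter n dmap z] lies in the unit disc; elsewhere the innermost Green series may
    diverge and the value is arbitrary. *)
Definition cont (n : nat) : V -> V -> cs -> R[i] := iter n lift (@green_sphere R V e).

Lemma bd_F x u : u \in bd x -> F u.
Proof.
rewrite /bd; case: asboolP => Fx; first by rewrite inE => /eqP->.
by move=> /(tsP Xgraph S1 _ (cell_of_cells e Fx)); exact: theta_F (cell_of_cells e Fx).
Qed.

(** The column of the Green function, pulled back to the model cell, solves the Dirichlet problem
    with its own boundary values and a source at [y] if [y] is in the same cell. *)
Lemma cell_decomp (z : R[i]) x y : nc z < 1 ->
  green e x y z = local_green x y (Some z) +
    \sum_(u <- bd x) harm x u (Some z) * green e u y z.
Proof.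
move=> z1; rewrite /local_green /bd /harm; case: asboolP => Fx.
  by rewrite big_seq1 add0r mul1r.
set D := cell_of e F x; have cD : cells e F D := cell_of_cells e Fx.
have Dx : D x := cell_of_refl e Fx.
have fC := gfin Ccell; have ia := iso_toP cD; set a := iso_to D in ia.
have [Cx ax] := iso_invP cD (or_introl Dx); set x' := iso_inv D x in Cx ax *.
pose k t := green e (a t) y z.
pose rhs t : R[i] := if t \in ts e C then k t else (a t == y)%:R.
have kE t : gbar e C t -> k t = rhs t + z * cell_op e C (theta e C) k t.
  move=> Gt; rewrite /rhs; case: (tsP Xgraph S1 t Ccell) => Tt.
    have tB : t \in theta e C by rewrite inE.
    by rewrite /cell_op tB mulr0 addr0.
  have Ct : C t by case: Gt.
  have tB : t \notin theta e C by apply/negP; rewrite inE.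
  rewrite /k green_eq//; congr (_ + _ * _).
  exact: (iso_srw Xgraph S1 Ccell cD ia (fun s => green e s y z) Ct tB).
transitivity (k x'); first by rewrite /k /a ax.
rewrite (cell_solve fC z1 kE Cx).
rewrite (bigID (fun s => s \in ts e C)) /= addrC; congr (_ + _).
  transitivity (\sum_(s <- gb e C | s \notin ts e C)
      rval (h_fun R e C x' s) (Some z) * (a s == y)%:R).
    by apply: eq_bigr => s sN; rewrite /rhs (negPf sN).
  case: asboolP => Dy.
    have [Cy ay] := iso_invP cD (or_introl Dy); set y' := iso_inv D y in Cy ay *.
    have C'y : C y' by exact: iso_inv_cell.
    rewrite -big_filter (bigD1_seq y') ?filter_uniq ?uniq_gb//=; last first.
      rewrite mem_filter (introT (gbP fC y') Cy) andbT.
      apply/negP => /(tsP Xgraph S1 y' Ccell) T.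
      exact: (cell_notF Ccell C'y (theta_F Xgraph Ccell T)).
    rewrite /a ay eqxx mulr1 big_seq_cond big1 ?addr0// => s /andP[].
    rewrite mem_filter => /andP[_ /(gbP fC) Gs] sy.
    case: eqP => [E|_]; last by rewrite mulr0.
    by move: sy; rewrite /y' -E iso_invK// eqxx.
  rewrite big_seq_cond big1// => s /andP[/(gbP fC) Gs sN].
  case: eqP => [E|_]; last by rewrite mulr0.
  exfalso; apply: Dy; rewrite -/D -E; apply/(iso_cell Xgraph Ccell cD ia Gs).
  by case: Gs => // T; move: sN; rewrite (introT (tsP Xgraph S1 s Ccell) T).
rewrite -(perm_big _ (iso_ts Xgraph S1 Ccell cD ia)) big_map.
transitivity (\sum_(s <- ts e C) rval (h_fun R e C x' s) (Some z) * k s).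
  rewrite -big_filter; transitivity (\sum_(s <- [seq s <- gb e C | s \in ts e C])
      rval (h_fun R e C x' s) (Some z) * k s).
    by apply: eq_big_seq => s; rewrite mem_filter /rhs => /andP[-> _].
  apply: perm_big; apply: uniq_perm; rewrite ?filter_uniq ?uniq_gb ?uniq_ts//.
  move=> s; rewrite mem_filter; case: (tsP Xgraph S1 s Ccell) => //= T.
  by apply/gbP => //; exact: theta_gbar.
apply: eq_big_seq => s /(tsP Xgraph S1 s Ccell) T; rewrite -/(iso_to D).
by rewrite iso_invK//; exact: theta_gbar.
Qed.

Lemma local_green_F x u z : F u -> local_green x u z = 0.
Proof.
move=> Fu; rewrite /local_green; case: asboolP => // Fx.
by case: asboolP => // /(cell_notF (cell_of_cells e Fx)).
Qed.

Lemma lift_ext K K' z : (forall x y, K x y (dmap z) = K' x y (dmap z)) ->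
  forall x y, lift K x y z = lift K' x y z.
Proof.
move=> E x y; congr (_ + _); apply: eq_bigr => u _; apply: eq_bigr => t _.
by rewrite E.
Qed.

Lemma dv_lt1 (z : R[i]) : nc z < 1 -> nc (dv z) < 1.
Proof.
move=> z1; have := dval_le Xgraph Xsym Ccell Cv Cw neq_vw z1.
by move=> /le_lt_trans; apply; rewrite expr2; have := nc_ge0 z; nra.
Qed.

Lemma dmap_disc (z : R[i]) : nc z < 1 -> dmap (Some z) = Some (dv z).
Proof. by move=> z1; exact: (dval_fun Xgraph Xsym Ccell Cv Cw z1). Qed.

(** [cell_decomp] in the first variable, then in the second through reversibility, leaves Green
    functions between vertices of [F], to which [green_psi] applies. *)
Lemma lift_green (z : R[i]) x y : nc z < 1 ->
  lift (@green_sphere R V e) x y (Some z) = green e x y z.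
Proof.
move=> z1; rewrite (cell_decomp x y z1); congr (_ + _).
apply: eq_big_seq => u /bd_F Fu.
have gu0 := gdegC_neq0 R Xgraph u.
have -> : green e u y z =
    \sum_(t <- bd y) harm y t (Some z) *
      ((gdeg e y)%:R / (gdeg e t)%:R) * green e u t z.
  apply: (mulfI gu0); rewrite green_rev//.
  rewrite (cell_decomp y u z1) local_green_F// add0r mulr_sumr mulr_sumr.
  apply: eq_bigr => t _; have gt0 := gdegC_neq0 R Xgraph t.
  have := green_rev Xgraph t u z1 => E.
  have -> : green e t u z = (gdeg e t)%:R^-1 * ((gdeg e u)%:R * green e u t z).
    by rewrite -E mulrA mulVf// mul1r.
  move: (harm _ _ _) (_%:R) (_%:R)^-1 (green _ _ _ _) => *; ring.
rewrite mulr_sumr; apply: eq_big_seq => t /bd_F Ft.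
have -> : green e u t z = rval f (Some z) * green e (psi_inv u) (psi_inv t) (dv z).
  rewrite -{1}(psi_invK Fu) -{1}(psi_invK Ft).
  exact: (green_psi Xgraph Xsym Ccell Cv Cw neq_vw psi_bij psi_adj _ _ z1).
rewrite dmap_disc//=.
by move: (harm _ _ _) (rval _ _) (green _ _ _ _) (harm _ _ _) (_ / _) => *; ring.
Qed.

Lemma cont_disc n x y (z : R[i]) : nc z < 1 -> cont n x y (Some z) = green e x y z.
Proof.
elim: n x y z => [//|n IH] x y z z1.
rewrite /cont iterS -(lift_green x y z1); apply: lift_ext => x' y'.
by rewrite dmap_disc// -/(cont n) IH// dv_lt1.
Qed.

Definition disc : set cs := [set z | exists2 c, z = Some c & nc c < 1].

(** Inside the disc [lift] reproduces the Green function, so an additional innermost application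
    changes nothing. *)
Lemma cont_stable n x y z : disc (iter n dmap z) -> cont n.+1 x y z = cont n x y z.
Proof.
elim: n x y z => [|n IH] x y z; first by move=> [c zE c1]; rewrite (zE : z = Some c) !cont_disc.
rewrite iterSr => H; rewrite {1}/cont iterS -/(cont n.+1).
by rewrite [RHS]/cont iterS -/(cont n); apply: lift_ext => x' y'; exact: IH.
Qed.

Lemma disc_iter n z : disc z -> disc (iter n dmap z).
Proof.
elim: n => [//|n IH] /IH [c E c1]; rewrite iterS E dmap_disc//.
by exists (dv c) => //; exact: dv_lt1.
Qed.

Lemma cont_stable_le n m x y z : (n <= m)%N -> disc (iter n dmap z) ->
  cont m x y z = cont n x y z.
Proof.
move=> /subnKC <- H; elim: (m - n)%N => [|k IH]; first by rewrite addn0.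
rewrite addnS cont_stable ?IH// addnC iterD; exact: disc_iter.
Qed.

Definition bad : set cs := poles f `|` @cell_poles R V e C.

Lemma good_h z x y : ~ bad z -> C x -> gbar e C y ->
  rat_map (h_fun R e C x y) z <> None.
Proof. by move=> nb Cx Gy H; apply: nb; right; exists x, y. Qed.

Lemma disc_good z : disc z -> ~ bad z.
Proof.
move=> [c -> c1] [H|[x [y [Cx Gy H]]]].
  exact: (f_regular Xgraph Xsym Ccell Cv c1 H).
exact: (h_regular Xgraph Xsym Ccell c1 Cx Gy H).
Qed.

Lemma analytic_harm x u z : ~ bad z -> u \in bd x -> analytic_at (harm x u) z.
Proof.
move=> nb ub; rewrite /harm; move: ub; rewrite /bd; case: asboolP => Fx ub.
  exact: ana0_cst.
have cD := cell_of_cells e Fx; apply: analytic_rval; apply: good_h => //.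
  by apply: iso_inv_cell => //; exact: cell_of_refl.
have Tu := elimT (tsP Xgraph S1 u cD) ub.
exact: (iso_invP cD (theta_gbar Tu)).1.
Qed.

Lemma analytic_local_green x y z : ~ bad z -> analytic_at (local_green x y) z.
Proof.
move=> nb; rewrite /local_green; case: asboolP => Fx; first exact: ana0_cst.
case: asboolP => Dy; last exact: ana0_cst.
have cD := cell_of_cells e Fx; apply: analytic_rval; apply: good_h => //.
  by apply: iso_inv_cell => //; exact: cell_of_refl.
by apply: (iso_invP cD _).1; left.
Qed.

Lemma analytic_lift K x y z : ~ bad z ->
  (forall x' y', analytic_at (fun z' => K x' y' (dmap z')) z) ->
  analytic_at (lift K x y) z.
Proof.
move=> nb AK.
have Af : analytic_at (rval f) z by apply: analytic_rval => fN; apply: nb; left.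
apply: (ana0D (analytic_local_green x y nb)).
apply: ana0_sum_seq => u ub; apply: ana0_sum_seq => t tb.
apply: (ana0M (ana0M (analytic_harm nb ub) (ana0M Af (AK _ _)))).
exact: (ana0M (analytic_harm nb tb) (ana0_cst _)).
Qed.

Lemma analytic_cont n x y z : disc (iter n dmap z) ->
  (forall k, (k < n)%N -> ~ bad (iter k dmap z)) -> analytic_at (cont n x y) z.
Proof.
elim: n x y z => [|n IH] x y z.
  by move=> [c zE c1] _; rewrite (zE : z = Some c); exact: analytic_green.
move=> H nb; apply: analytic_lift; first exact: (nb 0%N).
move=> x' y'; apply: analytic_rat_comp; apply: IH; first by rewrite -iterSr.
by move=> k kn; have := nb k.+1 kn; rewrite iterSr.
Qed.

(** * Row sums of the lifted kernel *)

Definition row_bound (K : V -> V -> cs -> R[i]) z (M : R) :=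
  forall x (s : seq V), uniq s -> \sum_(y <- s) nc (K x y z) <= M.

(** A crude bound for all cell coefficients at once; it depends on [z] alone, which makes the row
    estimates uniform in [x]. *)
Definition hsum (z : cs) : R :=
  \sum_(x <- gb e C) \sum_(y <- gb e C) nc (rval (h_fun R e C x y) z).

Lemma hsum_ge0 z : 0 <= hsum z.
Proof. by apply: sumr_ge0 => x _; apply: sumr_ge0 => y _; exact: nc_ge0. Qed.

Lemma hsum_row x z : gbar e C x ->
  \sum_(y <- gb e C) nc (rval (h_fun R e C x y) z) <= hsum z.
Proof.
move=> Gx; have fC := gfin Ccell; rewrite /hsum [leRHS](bigD1_seq x) ?uniq_gb//=; last exact/gbP.
rewrite lerDl; apply: sumr_ge0 => x' _; apply: sumr_ge0 => y _; exact: nc_ge0.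
Qed.

Lemma hsum_term x y z : gbar e C x -> gbar e C y ->
  nc (rval (h_fun R e C x y) z) <= hsum z.
Proof.
move=> Gx Gy; have fC := gfin Ccell; apply: le_trans (hsum_row z Gx).
rewrite [leRHS](bigD1_seq y) ?uniq_gb//=; last exact/gbP.
by rewrite lerDl; apply: sumr_ge0 => y' _; exact: nc_ge0.
Qed.

Lemma harm_le x u z : u \in bd x -> nc (harm x u z) <= 1 + hsum z.
Proof.
move=> ub; rewrite /harm; move: ub; rewrite /bd; case: asboolP => Fx ub.
  by rewrite nc1 lerDl hsum_ge0.
have cD := cell_of_cells e Fx.
have Tu := elimT (tsP Xgraph S1 u cD) ub.
have Dx : gbar e (cell_of e F x) x by left; exact: cell_of_refl.
apply: le_trans (hsum_term z (iso_invP cD Dx).1 (iso_invP cD (theta_gbar Tu)).1) _.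
by rewrite lerDr.
Qed.

Lemma local_green_row x z (s : seq V) : uniq s ->
  \sum_(y <- s) nc (local_green x y z) <= hsum z.
Proof.
move=> us; rewrite /local_green; case: asboolP => Fx.
  by rewrite big1 ?hsum_ge0// => y _; rewrite nc0.
set D := cell_of e F x; have cD : cells e F D := cell_of_cells e Fx.
have fC := gfin Ccell.
have Gx : gbar e D x by left; exact: cell_of_refl.
apply: le_trans (hsum_row z (iso_invP cD Gx).1).
rewrite (bigID (fun y => `[< D y >])) /= [X in _ + X]big1 ?addr0; last first.
  by move=> y /negPf->; rewrite nc0.
rewrite -big_filter.
rewrite (eq_big_seq (fun y => nc (rval (h_fun R e C (iso_inv D x) (iso_inv D y)) z))); last first.
  by move=> y; rewrite mem_filter => /andP[-> _].
rewrite -(big_map (iso_inv D) xpredT (fun y => nc (rval (h_fun R e C (iso_inv D x) y) z))).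
apply: ler_sum_sub => [t||y]; first exact: nc_ge0.
  rewrite map_inj_in_uniq ?filter_uniq// => y y'.
  rewrite !mem_filter => /andP[/asboolP Dy _] /andP[/asboolP Dy' _] E.
  by rewrite -(iso_invP cD (or_introl Dy)).2 E (iso_invP cD (or_introl Dy')).2.
move=> /mapP[y' + ->]; rewrite mem_filter => /andP[/asboolP Dy' _].
by apply/gbP => //; exact: (iso_invP cD (or_introl Dy')).1.
Qed.

Definition gsize : R := (size (gb e C))%:R.

Lemma gdeg_cell_le y : ~ F y -> (gdeg e y)%:R <= gsize.
Proof.
move=> Fy; have cD := cell_of_cells e Fy; have fC := gfin Ccell.
have Dy : cell_of e F y y := cell_of_refl e Fy.
have [Gy ay] := iso_invP cD (or_introl Dy).
rewrite -{1}ay (iso_cell_deg Xgraph S1 Ccell cD (iso_toP cD) (iso_inv_cell cD Dy)).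
rewrite ler_nat -size_cnb; apply: uniq_leq_size; first exact: uniq_cnb.
by move=> x; rewrite mem_cnb// => /andP[].
Qed.

(** Such a [y] is determined by a neighbour [y'] of [t] in the same cell and by a vertex of the
    model cell. *)
Lemma count_bd t (s : seq V) : uniq s ->
  (count (fun y => (t \in bd y) && ~~ `[< F y >]) s <= gdeg e t * size (gb e C))%N.
Proof.
move=> us; have fC := gfin Ccell.
rewrite -size_filter -size_nb.
rewrite -(size_allpairs (fun y' c => iso_to (cell_of e F y') c)).
apply: uniq_leq_size; first exact: filter_uniq.
move=> y; rewrite mem_filter => /andP[/andP[+ /asboolPn Fy] _].
have cD := cell_of_cells e Fy.
rewrite /bd; case: asboolP => // _ /(tsP Xgraph S1 t cD)[_ [y' Dy' ey't]].
have [Gy ay] := iso_invP cD (or_introl (cell_of_refl e Fy)).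
rewrite -ay (cell_eq Xgraph cD Dy'); apply/allpairsP.
exists (y', iso_inv (cell_of e F y) y); split=> //=.
- by rewrite mem_nb// (adjC Xgraph).
- by rewrite (cell_eq Xgraph cD Dy') in Gy *; apply/gbP.
- by rewrite (cell_eq Xgraph cD Dy').
Qed.

(** The factor [gdeg e t] of [count_bd] cancels against the weight, so the bound is the same for all
    [t]; the summand 1 is the case [y = t] in [F]. *)
Lemma bd_column t z (s : seq V) : uniq s ->
  \sum_(y <- s | t \in bd y) nc (harm y t z) * ((gdeg e y)%:R / (gdeg e t)%:R) <=
  1 + (1 + hsum z) * (gsize * gsize).
Proof.
move=> us; have mt0 := gdegR_gt0 R Xgraph t.
rewrite (bigID (fun y => `[< F y >])) /=; apply: lerD.
  apply: (@le_trans _ _ (\sum_(y <- s) (y == t)%:R * 1)); last first.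
    by rewrite sum_delta//; case: ifP.
  rewrite big_mkcond; apply: ler_sum => y _; rewrite mulr1.
  case: ifP => [/andP[+ Fy]|_ //].
  rewrite /bd /harm Fy inE => /eqP ty; rewrite -ty eqxx nc1 mul1r divff//.
  by rewrite gt_eqF.
apply: (@le_trans _ _ (\sum_(y <- s | (t \in bd y) && ~~ `[< F y >])
    (1 + hsum z) * (gsize / (gdeg e t)%:R))).
  apply: ler_sum => y /andP[ty /asboolPn Fy]; apply: ler_pM.
  - exact: nc_ge0.
  - by rewrite divr_ge0.
  - exact: harm_le.
  - by rewrite ler_wpM2r ?invr_ge0// gdeg_cell_le.
rewrite big_const_seq iter_addr addr0 -[leLHS]mulr_natr -mulrA.
rewrite ler_wpM2l ?addr_ge0 ?hsum_ge0// -mulrA ler_wpM2l ?ler0n//.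
rewrite mulrC ler_pdivrMr// mulrC -natrM ler_nat; exact: count_bd.
Qed.

Lemma size_bd x : (size (bd x) <= (theta_card e C).+1)%N.
Proof.
rewrite /bd; case: asboolP => // Fx; rewrite size_ts.
by rewrite (theta_card_cell Xgraph Xsym Ccell (cell_of_cells e Fx)).
Qed.

(** For fixed [u], exchanging the sums over [y] and [t] bounds the weights by [bd_column] and leaves
    a row of [K], since [psi_inv] is injective on [F]; at most [theta_card e C] + 1 choices of [u]
    remain. *)
Lemma row_bound_lift K z M : 0 <= M -> row_bound K (dmap z) M ->
  row_bound (lift K) z (hsum z + (theta_card e C).+1%:R *
    ((1 + hsum z) * nc (rval f z) * ((1 + (1 + hsum z) * (gsize * gsize)) * M))).
Proof.
move=> M0 HK x s us.
have H0 : 0 <= 1 + hsum z by rewrite addr_ge0 ?hsum_ge0.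
have g0 : 0 <= gsize * gsize by rewrite mulr_ge0.
pose om y t := nc (harm y t z) * ((gdeg e y)%:R / (gdeg e t)%:R).
have om0 y t : 0 <= om y t by rewrite mulr_ge0 ?nc_ge0// divr_ge0.
have column u : \sum_(y <- s) \sum_(t <- bd y)
    nc (K (psi_inv u) (psi_inv t) (dmap z)) * om y t <=
    (1 + (1 + hsum z) * (gsize * gsize)) * M.
  pose T := undup (flatten [seq bd y | y <- s]).
  have TF t : t \in T -> F t.
    by rewrite mem_undup => /flatten_mapP[y _]; exact: bd_F.
  have E y : y \in s -> \sum_(t <- bd y) nc (K (psi_inv u) (psi_inv t) (dmap z)) * om y t =
      \sum_(t <- T | t \in bd y) nc (K (psi_inv u) (psi_inv t) (dmap z)) * om y t.
    move=> ys; rewrite -[RHS]big_filter; apply: perm_big; apply: uniq_perm.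
    - by rewrite /bd; case: asboolP => // _; exact: uniq_ts.
    - by rewrite filter_uniq ?undup_uniq.
    move=> t; rewrite mem_filter; case tb : (t \in bd y) => //=.
    by rewrite mem_undup; apply/esym/flatten_mapP; exists y.
  rewrite (eq_big_seq _ E); under eq_bigr do rewrite big_mkcond.
  rewrite exchange_big /=.
  apply: (@le_trans _ _ (\sum_(t <- T) nc (K (psi_inv u) (psi_inv t) (dmap z)) *
      (1 + (1 + hsum z) * (gsize * gsize)))).
    apply: ler_sum => t _; rewrite -big_mkcond -mulr_sumr.
    by rewrite ler_wpM2l ?nc_ge0//; exact: bd_column.
  rewrite -mulr_suml mulrC ler_wpM2l ?addr_ge0 ?mulr_ge0//.
  rewrite -(big_map psi_inv xpredT (fun t => nc (K (psi_inv u) t (dmap z)))).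
  apply: HK; rewrite map_inj_in_uniq ?undup_uniq// => t t' /TF Ft /TF Ft' E'.
  by rewrite -(psi_invK Ft) E' psi_invK.
apply: (@le_trans _ _ (\sum_(y <- s) (nc (local_green x y z) +
    \sum_(u <- bd x) (1 + hsum z) * nc (rval f z) *
    \sum_(t <- bd y) nc (K (psi_inv u) (psi_inv t) (dmap z)) * om y t))).
  apply: ler_sum => y _; apply: le_trans (ncD _ _) _; rewrite lerD2l.
  apply: le_trans (nc_sum _ _ _) _; rewrite big_seq [leRHS]big_seq.
  apply: ler_sum => u ub; apply: le_trans (nc_sum _ _ _) _.
  rewrite mulr_sumr; apply: ler_sum => t _.
  rewrite !ncM ncV !nc_nat -/(om y t) -!mulrA ler_wpM2r ?harm_le//.
  by rewrite !mulr_ge0 ?nc_ge0// divr_ge0.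
rewrite big_split /=; apply: lerD; first exact: local_green_row.
rewrite exchange_big /=.
apply: (@le_trans _ _ (\sum_(u <- bd x) (1 + hsum z) * nc (rval f z) *
    ((1 + (1 + hsum z) * (gsize * gsize)) * M))).
  apply: ler_sum => u _; rewrite -mulr_sumr ler_wpM2l ?mulr_ge0 ?nc_ge0//.
rewrite big_const_seq iter_addr addr0 count_predT -[leLHS]mulr_natl.
rewrite ler_wpM2r ?ler_nat ?size_bd//.
apply: mulr_ge0; first exact: mulr_ge0 H0 (nc_ge0 _).
by apply: mulr_ge0 => //; rewrite addr_ge0// mulr_ge0.
Qed.

(** At most polynomial growth in [1 / |h|], a class closed under the sums and products occurring in
    [row_bound_lift]. *)
Definition grow (q : R[i] -> R) := exists A m d, [/\ 0 <= A, 0 < d &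
  forall h, h != 0 -> nc h < d -> q h <= A * (nc h)^-1 ^+ m].

Lemma inv_ge1 (h : R[i]) : h != 0 -> nc h < 1 -> 1 <= (nc h)^-1.
Proof. by move=> h0 h1; rewrite invf_ge1 ?nc_gt0// ltW. Qed.

Lemma grow_cst c : grow (fun=> c).
Proof.
exists `|c|, 0%N, 1; split=> // h _ _.
by rewrite expr0 mulr1 ler_norm.
Qed.

Lemma growD p q : grow p -> grow q -> grow (fun h => p h + q h).
Proof.
move=> [A [m [d [A0 d0 H]]]] [A' [m' [d' [A'0 d'0 H']]]].
exists (A + A'), (m + m')%N, (Num.min 1 (Num.min d d')); split.
- exact: addr_ge0.
- by rewrite !lt_min ltr01 d0.
move=> h h0; rewrite !lt_min => /and3P[h1 hd hd'].
have i1 := inv_ge1 h0 h1; rewrite mulrDl; apply: lerD.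
  apply: le_trans (H h h0 hd) _; rewrite ler_wpM2l// ler_weXn2l//; lia.
apply: le_trans (H' h h0 hd') _; rewrite ler_wpM2l// ler_weXn2l//; lia.
Qed.

Lemma growM p q : (forall h, 0 <= p h) -> (forall h, 0 <= q h) ->
  grow p -> grow q -> grow (fun h => p h * q h).
Proof.
move=> p0 q0 [A [m [d [A0 d0 H]]]] [A' [m' [d' [A'0 d'0 H']]]].
exists (A * A'), (m + m')%N, (Num.min d d'); split.
- exact: mulr_ge0.
- by rewrite lt_min d0.
move=> h h0; rewrite lt_min => /andP[hd hd'].
by rewrite exprD mulrACA ler_pM// ?H// H'.
Qed.

Lemma grow_sum (I : Type) (r : seq I) (p : I -> R[i] -> R) :
  (forall i, grow (p i)) -> grow (fun h => \sum_(i <- r) p i h).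
Proof.
move=> H; elim: r => [|i r IH].
  have -> : (fun h => \sum_(i <- [::]) p i h) = fun=> 0.
    by apply: funext => h; rewrite big_nil.
  exact: grow_cst.
have -> : (fun h => \sum_(j <- i :: r) p j h) = (fun h => p i h + \sum_(j <- r) p j h).
  by apply: funext => h; rewrite big_cons.
exact: growD.
Qed.

Lemma grow_rval r z : grow (fun h => nc (rval r (chart z h))).
Proof.
have [A [m [d [A0 d0 H]]]] := rval_growth r z.
by exists A, m, d; split=> // h h0 hd; have [] := H h h0 hd.
Qed.

Lemma row_bound_le K z M M' : M <= M' -> row_bound K z M -> row_bound K z M'.
Proof. by move=> MM H x s us; apply: le_trans (H x s us) MM. Qed.

Lemma row_bound_growth n z : disc (iter n dmap z) ->
  exists A m d, [/\ 0 <= A, 0 < d & forall h, h != 0 -> nc h < d ->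
    row_bound (cont n) (chart z h) (A * (nc h)^-1 ^+ m)].
Proof.
elim: n z => [|n IH] z.
  move=> /= [c -> c1]; exists (2 / (1 - nc c)), 0%N, ((1 - nc c) / 2).
  have c10 : 0 < 1 - nc c by rewrite subr_gt0.
  split; rewrite ?divr_ge0 ?divr_gt0 ?(ltW c10)// => h _ hd x s us.
  rewrite expr0 mulr1 /=.
  have ch : nc (c + h) <= 1 - (1 - nc c) / 2.
    by apply: le_trans (ncD _ _) _; lra.
  have ch1 : nc (c + h) < 1 by lra.
  apply: le_trans (green_row Xgraph x ch1 us) _.
  rewrite -[2 in leRHS]invrK -invfM lef_pV2 ?posrE ?subr_gt0// ?mulr_gt0 ?invr_gt0//.
  by lra.
rewrite iterSr => /IH[A [m [d [A0 d0 HA]]]].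
have [s [l [c [d1 [c0 d10 Hs]]]]] :=
  rat_map_growth z (d_nonconstant R Xgraph Xsym Ccell Cv Cw neq_vw) d0.
(* The bound at the image point, a power of [1 / |s h|], rewritten in terms of [h] through the lower
   bound [c * nc h ^+ l] of the displacement. *)
pose M h : R := A * (c^-1 * (nc h)^-1 ^+ l) ^+ m.
have M0 h : 0 <= M h.
  by rewrite mulr_ge0 ?exprn_ge0 ?mulr_ge0 ?exprn_ge0 ?invr_ge0 ?nc_ge0// ltW.
have gM : grow M.
  exists (A * c^-1 ^+ m), (l * m)%N, 1; split=> //.
    by rewrite mulr_ge0 ?exprn_ge0 ?invr_ge0// ltW.
  by move=> h _ _; rewrite /M exprMn exprM mulrA.
have gh : grow (fun h => hsum (chart z h)).
  by apply: grow_sum => x; apply: grow_sum => y; exact: grow_rval.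
have h1 h : 0 <= 1 + hsum (chart z h) by rewrite addr_ge0 ?hsum_ge0.
have gg : 0 <= gsize * gsize by rewrite mulr_ge0.
have gh1 : grow (fun h => 1 + hsum (chart z h)) by exact: growD (grow_cst 1) gh.
have gc : grow (fun h => 1 + (1 + hsum (chart z h)) * (gsize * gsize)).
  by apply: growD (grow_cst 1) _; apply: growM => //; exact: grow_cst.
have gc0 h : 0 <= 1 + (1 + hsum (chart z h)) * (gsize * gsize).
  by rewrite addr_ge0 ?mulr_ge0.
pose B h := hsum (chart z h) + (theta_card e C).+1%:R *
    ((1 + hsum (chart z h)) * nc (rval f (chart z h)) *
     ((1 + (1 + hsum (chart z h)) * (gsize * gsize)) * M h)).
have gB : grow B.
  apply: growD => //; apply: growM => //.
  - move=> h; apply: mulr_ge0; first exact: mulr_ge0 (h1 h) (nc_ge0 _).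
    exact: mulr_ge0 (gc0 h) (M0 h).
  - exact: grow_cst.
  apply: growM.
  - by move=> h; exact: mulr_ge0 (h1 h) (nc_ge0 _).
  - by move=> h; exact: mulr_ge0 (gc0 h) (M0 h).
  - apply: growM => //; [by move=> h; exact: nc_ge0|exact: grow_rval].
  - exact: growM.
have [A' [m' [d' [A'0 d'0 HB]]]] := gB.
exists A', m', (Num.min d1 d'); split=> //; first by rewrite lt_min d10.
move=> h h0; rewrite lt_min => /andP[hd1 hd'].
apply: row_bound_le (HB h h0 hd') _; rewrite /cont iterS -/(cont n).
apply: row_bound_lift => //.
have [E sn0 se sl] := Hs h h0 hd1; rewrite E.
apply: row_bound_le (HA _ sn0 se); rewrite /M ler_wpM2l//.
have p0 : 0 < c * nc h ^+ l by rewrite mulr_gt0// exprn_gt0// nc_gt0.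
rewrite lerXn2r ?nnegrE ?mulr_ge0 ?exprn_ge0 ?invr_ge0 ?nc_ge0 ?(ltW c0)//.
by rewrite exprVn -invfM lef_pV2 ?posrE ?nc_gt0.
Qed.

End Continuation.

(** * The immediate basin and the exceptional set *)

Section Basin.
Variables (R : realType) (V : choiceType) (e : rel V) (F : set V) (C : set V).
Variables (v w : V).
Hypotheses (Xgraph : graph_ax e) (Xsym : symmetrically_self_similar e F).
Hypotheses (Ccell : cells e F C) (Cv : theta e C v) (Cw : theta e C w).
Hypothesis neq_vw : v <> w.
Local Notation cs := (csphere R).
Local Notation chart := (@csphere_chart R).
Local Notation dmap := (rat_map (d_fun R e C v w)).
Local Notation dv := (@dval R V e C v w).
Local Notation disc := (@disc R).
Local Notation bad := (@bad R V e C v).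
Local Notation A0 := (immediate_basin0 dmap).
Local Notation D := (@exceptional_set R V e C v w).
Local Notation S := (@green_singularities R V e A0).

Let dnc : nonconstant (d_fun R e C v w).
Proof. exact: (d_nonconstant R Xgraph Xsym Ccell Cv Cw neq_vw). Qed.

Lemma unit_discE : @unit_disc R = disc.
Proof.
apply/seteqP; split=> z.
  by move=> [c /= c1 <-]; exists c => //; rewrite -ltcR -norm_nc.
by move=> [c -> c1]; exists c => //=; rewrite norm_nc -[1]/(1%:C) ltcR.
Qed.

Lemma disc0 : disc (Some 0). Proof. by exists 0; rewrite ?nc0. Qed.

Lemma nbhs_disc z : disc z -> nbhs z disc.
Proof.
move=> [c -> c1]; apply/nbhs_chart; exists (1 - nc c); first by rewrite subr_gt0.
by move=> h hd; exists (c + h) => //; apply: le_lt_trans (ncD _ _) _; lra.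
Qed.

Lemma iter_dmap_disc n (c : R[i]) : nc c < 1 ->
  exists2 c', iter n dmap (Some c) = Some c' & nc c' <= nc c ^+ n.+1.
Proof.
move=> c1; elim: n => [|n [c' E H]]; first by exists c; rewrite ?expr1.
have cc : nc c' <= nc c.
  apply: le_trans H _; rewrite exprS -[leRHS]mulr1 ler_wpM2l ?nc_ge0//.
  by rewrite exprn_ile1 ?nc_ge0// ltW.
have c'1 : nc c' < 1 by exact: le_lt_trans cc c1.
exists (dv c'); first by rewrite iterS E (dmap_disc Xgraph Xsym Ccell Cv Cw c'1).
apply: le_trans (dval_le Xgraph Xsym Ccell Cv Cw neq_vw c'1) _.
by rewrite expr2 exprS ler_pM ?nc_ge0.
Qed.

Lemma disc_basin z : disc z -> basin0 dmap z.
Proof.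
move=> [c -> c1] P /nbhs_chart[r r0 H].
have [N HN] := pow_small (nc_ge0 c) c1 r0.
exists N => // n /= Nn; have [c' E Hc] := iter_dmap_disc n c1.
rewrite E -[c']add0r; apply: (H c'); apply: le_lt_trans Hc _.
by apply: HN; exact: leqW.
Qed.

Lemma basin_iter z : basin0 dmap z -> exists n, disc (iter n dmap z).
Proof.
move=> H; have [N _ HN] := H _ (nbhs_disc disc0).
by exists N; apply: (HN N) => /=.
Qed.

Lemma iter_basin n z : disc (iter n dmap z) -> basin0 dmap z.
Proof.
move=> /disc_basin H P /H[N _ HN]; exists (N + n)%N => // k /= kN.
have -> : k = ((k - n) + n)%N by rewrite subnK// (leq_trans _ kN)// leq_addl.
by rewrite iterD; apply: HN => /=; lia.
Qed.

Lemma iter_nbhs n z (P : set cs) : nbhs (iter n dmap z) P ->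
  nbhs z (fun y => P (iter n dmap y)).
Proof.
elim: n P => [//|n IH] P; rewrite iterS => /rat_map_cont/IH.
by apply: filterS => y; rewrite iterS.
Qed.

Lemma iter_punct n z (P : set cs) : punct (iter n dmap z) P ->
  punct z (fun y => P (iter n dmap y)).
Proof.
elim: n P => [//|n IH] P; rewrite iterS => /(rat_map_punct dnc)/IH.
by apply: punctS => y; rewrite iterS.
Qed.

Lemma A0_sub_basin : A0 `<=` basin0 dmap.
Proof. exact: connected_component_sub. Qed.

Lemma A0_connected : connected A0.
Proof. exact: component_connected. Qed.

Lemma disc_sub_A0 : disc `<=` A0.
Proof.
have -> : disc = chart (Some 0) @` [set h | nc h < 1].
  apply/seteqP; split=> z.
    by move=> [c -> c1]; exists c => //=; rewrite add0r.
  by move=> [c /= c1 <-]; exists (0 + c) => //; rewrite add0r.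
apply: connected_component_max; last exact: disc_connected.
  by exists 0; [rewrite /mkset nc0|rewrite /= addr0].
by move=> z [c /= c1 <-]; apply: disc_basin; exists (0 + c); rewrite ?add0r.
Qed.

(** The basin is open, and a small disc around a point of the component can be adjoined without
    losing connectedness. *)
Lemma A0_open : open A0.
Proof.
rewrite openE => z Az; rewrite /interior.
have [n dn] := basin_iter (A0_sub_basin Az).
have : nbhs z (basin0 dmap).
  by apply: filterS (iter_nbhs (nbhs_disc dn)) => y; exact: iter_basin.
move=> /nbhs_chart[r r0 H]; apply/nbhs_chart; exists r => // h hr.
have : A0 `|` chart z @` [set h | nc h < r] `<=` A0.
  apply: connected_component_max.
  - by left; exact/disc_sub_A0/disc0.
  - by move=> y [/A0_sub_basin//|[h' hr' <-]]; exact: H.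
  - apply: connectedU; [|exact: A0_connected|exact: disc_connected].
    by exists z; split=> //; exists 0; [rewrite /mkset nc0|exact: chart0].
by apply; right; exists h.
Qed.

Lemma bad_punct z : punct z (fun y => ~ bad y).
Proof.
have fC : finite_set (gbar e C).
  by apply: (gbar_finite Xgraph _ Ccell); case: Xsym => _ [].
have H : punct z (fun y => forall x, x \in gb e C -> forall x', x' \in gb e C ->
    rat_map (h_fun R e C x x') y <> None).
  apply: punct_all => x _; apply: punct_all => x' _; exact: rat_pole_punct.
apply: punctS (punctI (rat_pole_punct (f_fun R e C v) z) H).
move=> y [Hf Hh] [//|[x [x' [Cx Gx' P]]]].
have Gx : gbar e C x by left.
exact: (Hh x (introT (gbP fC x) Gx) x' (introT (gbP fC x') Gx') P).
Qed.

Lemma disc_notD z : disc z -> ~ D z.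
Proof.
move=> dz [n]; apply: (disc_good Xgraph Xsym Ccell Cv).
exact: (disc_iter Xgraph Xsym Ccell Cv Cw neq_vw n dz).
Qed.

(** Near [z] the [n]-th iterate is already in the disc, which is stable and free of poles, so only
    the preimages under fewer than [n] steps matter; these are isolated because [d] is not
    constant. *)
Lemma D_punct z : A0 z -> punct z (fun y => ~ D y).
Proof.
move=> /A0_sub_basin/basin_iter[n dn].
have H : punct z (fun y => forall k, k \in iota 0 n -> ~ bad (iter k dmap y)).
  apply: punct_all => k _; apply: (@iter_punct k z (fun y => ~ bad y)).
  exact: bad_punct.
apply: punctS (punctI (nbhs_punct (iter_nbhs (nbhs_disc dn))) H) => y [dy Hy] [k Bk].
have [kn|nk] := ltnP k n; first by apply: (Hy k) => //; rewrite mem_iota.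
apply: (disc_good Xgraph Xsym Ccell Cv) Bk; rewrite -(subnK nk) iterD.
exact: (disc_iter Xgraph Xsym Ccell Cv Cw neq_vw _ dy).
Qed.

Variable psi : V -> V.
Hypothesis psi_bij : set_bij setT F psi.
Hypothesis psi_adj : forall x y, e x y <-> reduced_adj e F (psi x) (psi y).
Variable iso_to : set V -> V -> V.
Hypothesis iso_toP : forall D, cells e F D -> cell_iso e C D (iso_to D).
Local Notation cont := (@cont R V e F C v w psi iso_to).

(** Any stage reaching the disc would do, by [cont_stable_le]; it may thus vary with the point
    without harming analyticity. *)
Definition stage z : nat := xget 0%N [set n | disc (iter n dmap z)].
Definition g0 x y z : R[i] := cont (stage z) x y z.

Lemma g0E n x y z : disc (iter n dmap z) -> g0 x y z = cont n x y z.
Proof.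
move=> dn; have ds : disc (iter (stage z) dmap z).
  exact: (xgetPex 0%N (P := [set n | disc (iter n dmap z)]) (ex_intro _ n dn)).
have stab := cont_stable_le Xgraph Xsym Ccell Cv Cw neq_vw psi_bij psi_adj iso_toP.
by case/orP: (leq_total n (stage z)) => le; [exact: stab|exact/esym/stab].
Qed.

Lemma g0_disc x y (c : R[i]) : nc c < 1 -> g0 x y (Some c) = green e x y c.
Proof.
move=> c1; rewrite (@g0E 0)//; last by exists c.
Qed.

Lemma g0_analytic x y z : A0 z -> ~ D z -> analytic_at (g0 x y) z.
Proof.
move=> Az nDz; have [n dn] := basin_iter (A0_sub_basin Az).
have : analytic_at (cont n x y) z.
  apply: (analytic_cont Xgraph Xsym Ccell psi iso_toP) => // k _ Bk.
  by apply: nDz; exists k.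
apply: analytic_eq; apply: filterS (iter_nbhs (nbhs_disc dn)) => y' d'.
exact: g0E.
Qed.

Lemma AD_open : open (A0 `\` D).
Proof. exact: open_minus A0_open D_punct. Qed.

Lemma AD_connected : connected (A0 `\` D).
Proof. exact: connected_minus A0_open A0_connected D_punct. Qed.

Lemma g0_continuation x y : continuation (green e x y) (A0 `\` D) (g0 x y).
Proof.
split; first exact: AD_open.
- rewrite unit_discE => z dz; split; [exact: disc_sub_A0|exact: disc_notD].
- by move=> z [Az nDz]; exact: g0_analytic.
- by move=> c; rewrite norm_nc -[1]/(1%:C) ltcR => c1; exact: g0_disc.
Qed.

Lemma S_sub_D z : S z -> D z.
Proof.
move=> [Az [x [y H]]]; apply: contrapT => nDz; apply: H.
exists (A0 `\` D), (g0 x y); split=> //; first exact: AD_connected.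
exact: g0_continuation.
Qed.

Lemma S_punct z : A0 z -> punct z (fun y => ~ S y).
Proof. by move=> /D_punct; apply: punctS => y nD /S_sub_D. Qed.

Lemma AS_open : open (A0 `\` S).
Proof. exact: open_minus A0_open S_punct. Qed.

Lemma AS_connected : connected (A0 `\` S).
Proof. exact: connected_minus A0_open A0_connected S_punct. Qed.

Lemma AS_disc : disc `<=` A0 `\` S.
Proof.
by move=> z dz; split; [exact: disc_sub_A0|move=> /S_sub_D; exact: disc_notD].
Qed.

Lemma nbhs0_disc (P : set cs) : (forall c, nc c < 1 -> P (Some c)) ->
  nbhs (Some 0 : cs) P.
Proof. by move=> H; apply: filterS (nbhs_disc disc0) => z [c -> /H]. Qed.

(** Removing [D] keeps [U] connected, so the identity principle applies from the disc outwards. This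
    excludes different branches inside [A0]. *)
Lemma local_continuation x y U g : connected U -> U `<=` A0 ->
  continuation (green e x y) U g -> forall z, U z -> ~ D z -> g z = g0 x y z.
Proof.
move=> cU UA [oU dU aU gU] z Uz nDz.
have pU t : U t -> punct t (fun y => ~ D y) by move=> /UA/D_punct.
have cUD := connected_minus oU cU pU.
apply: (identity_principle cUD _ _ (z0 := Some 0)) => //.
- by move=> t [Ut _]; exact: aU.
- by move=> t [/UA At nDt]; exact: g0_analytic.
- split; last exact/disc_notD/disc0.
  by apply: dU; rewrite unit_discE; exact: disc0.
- apply: nbhs0_disc => c c1; rewrite g0_disc//; apply: gU.
  by rewrite norm_nc -[1]/(1%:C) ltcR.
Qed.

Lemma global_continuation x y : exists g, continuation (green e x y) (A0 `\` S) g /\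
  forall z, A0 z -> ~ D z -> g z = g0 x y z.
Proof.
have /choice[gam Hgam] : forall z, exists g : cs -> R[i], (A0 `\` S) z ->
    exists U, [/\ connected U, U `<=` A0, U z & continuation (green e x y) U g].
  move=> z; have [[Az nSz]|n] := pselect ((A0 `\` S) z); last by exists (fun=> 0).
  apply: contrapT => H; apply: nSz; split=> //; exists x, y => -[U [g HU]].
  by apply: H; exists g => _; exists U.
(* Each point uses its own local continuation; all of them agree with [g0] off [D], which is
   discrete in [A0], so [g] is near [z] the function [gam z]. *)
pose g z := gam z z.
have gE z : A0 z -> ~ D z -> g z = g0 x y z.
  move=> Az nDz; have ASz : (A0 `\` S) z by split=> // /S_sub_D.
  by have [U [cU UA Uz cont]] := Hgam z ASz; exact: (local_continuation cU UA cont).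
exists g; split=> //; split; first exact: AS_open.
- by rewrite unit_discE; exact: AS_disc.
- move=> z ASz; have [U [cU UA Uz cont]] := Hgam z ASz.
  have [oU dU aU gU] := cont.
  have : analytic_at (gam z) z by exact: aU.
  apply: analytic_eq; apply: punct_nbhs => //.
  have HU : nbhs z U by apply: open_nbhs_nbhs.
  apply: punctS (punctI (nbhs_punct HU) (D_punct (UA z Uz))) => t [Ut nDt].
  by rewrite gE ?(local_continuation cU UA cont)//; exact: UA.
- move=> c; rewrite norm_nc -[1]/(1%:C) ltcR => c1.
  have dc : disc (Some c) by exists c.
  by rewrite gE ?g0_disc//; [exact: disc_sub_A0|exact: disc_notD].
Qed.

Lemma continuation_unique x y g g' : continuation (green e x y) (A0 `\` S) g ->
  continuation (green e x y) (A0 `\` S) g' -> forall z, (A0 `\` S) z -> g' z = g z.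
Proof.
move=> [_ _ ag gg] [_ _ ag' gg'] z ASz.
apply: (identity_principle AS_connected ag' ag (z0 := Some 0)) => //.
  exact/AS_disc/disc0.
apply: nbhs0_disc => c c1.
have c1' : `|c| < 1 by rewrite norm_nc -[1]/(1%:C) ltcR.
by rewrite gg// gg'.
Qed.

End Basin.

(** * The spectrum *)

Section MaxModulus.
Variable R : realType.
Local Notation C := R[i].

Lemma nc_sqr (x : C) : nc x ^+ 2 = complex.Re x ^+ 2 + complex.Im x ^+ 2.
Proof.
by case: x => a b; rewrite /nc sqr_sqrtr// addr_ge0// sqr_ge0.
Qed.

(** The cross terms cancel because the points sum to 0: averaging the squared modulus over the
    circle gains exactly [r ^+ 2]. *)
Lemma average_sqr q (t : nat -> C) (h : C) r : (forall j, nc (t j) = r) ->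
  \sum_(j < q) t j = 0 ->
  \sum_(j < q) nc (h + t j) ^+ 2 = q%:R * (nc h ^+ 2 + r ^+ 2).
Proof.
move=> tr t0.
have RS : \sum_(j < q) complex.Re (t j) = 0.
  rewrite -[RHS]/(complex.Re (0 : C)) -t0.
  by apply/esym; apply: (big_morph (fun z : C => complex.Re z)) => //; case=> ? ? [].
have IS : \sum_(j < q) complex.Im (t j) = 0.
  rewrite -[RHS]/(complex.Im (0 : C)) -t0.
  by apply/esym; apply: (big_morph (fun z : C => complex.Im z)) => //; case=> ? ? [].
transitivity (\sum_(j < q) ((nc h ^+ 2 + r ^+ 2) +
    (2 * complex.Re h * complex.Re (t j) + 2 * complex.Im h * complex.Im (t j)))).
  apply: eq_bigr => j _; rewrite -(tr j) !nc_sqr.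
  by case: h (t j) => [a b] [c d] /=; ring.
rewrite big_split /= sumr_const card_ord [X in _ + X](_ : _ = 0).
  by rewrite addr0 mulr_natl.
by rewrite big_split /= -!mulr_sumr RS IS !mulr0 addr0.
Qed.

(* An interior maximum of [|k h| + eps |h|^2] would contradict the mean value
   inequality of [circle_average]. *)
Lemma max_modulus (k : C -> C) r B : 0 < r ->
  (forall h0, nc h0 <= r -> ana0 (fun h => k (h0 + h))) ->
  (forall h, nc h = r -> nc (k h) <= B) -> nc (k 0) <= B.
Proof.
move=> r0 ak kB.
suff H (eps : R) : 0 < eps -> nc (k 0) <= B + eps * r ^+ 2.
  apply/ler_addgt0Pr => eps e0.
  have r2 : 0 < r ^+ 2 by rewrite exprn_gt0.
  by have := H _ (divr_gt0 e0 r2); rewrite divfK// gt_eqF.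
move=> e0; pose phi (h : C^o) : R := nc (k h) + eps * nc h ^+ 2.
pose A : set C^o := [set h : C^o | nc h <= r].
have A0 : A 0 by rewrite /A /mkset nc0 ltW.
have cphi : {within A, continuous phi}.
  apply: continuous_in_subspaceT => h0; rewrite inE => Ah0.
  apply/(@cvgrPdist_lt _ R^o _ (nbhs (h0 : C^o))) => eta eta0.
  have eta2 : 0 < eta / 2 by rewrite divr_gt0.
  have [d d0 Hd] := ana0_cont (ak h0 Ah0) eta2.
  have a2 : ana0 (fun h : C => (h0 + h) * (h0 + h)).
    by apply: ana0M; apply: ana0D (ana0_cst _) (@ana0_id R).
  have [d' d'0 Hd'] := ana0_cont a2 (divr_gt0 eta2 e0).
  apply/nbhs_complexP; exists (Num.min d d'); first by rewrite lt_min d0.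
  move=> h; rewrite lt_min => /andP[h1 h2].
  have nd (x y : C) : `|nc x - nc y| <= nc (y - x).
    rewrite ler_distl; apply/andP; split.
      have := ncD (y - x) x; rewrite subrK; lra.
    have := ncD x (y - x); rewrite subrKC; have := ncD y (x - y); rewrite subrKC (ncBC x); lra.
  have -> : phi h0 - phi (h0 + h) = (nc (k h0) - nc (k (h0 + h))) +
     eps * (nc (h0 * h0) - nc ((h0 + h) * (h0 + h))).
    by rewrite /phi !ncM !expr2; ring.
  apply: le_lt_trans (ler_normD _ _) _; rewrite [eta]splitr; apply: ltrD.
    by apply: le_lt_trans (nd _ _) _; have := Hd h h1; rewrite addr0.
  rewrite normrM (gtr0_norm e0) mulrC -ltr_pdivlMr//.
  by apply: le_lt_trans (nd _ _) _; have := Hd' h h2; rewrite addr0.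
have [hm Ahm hmax] := compact_EVT_max (ex_intro _ _ A0) (@compact_disc R r) cphi.
have {}hmax t : nc t <= r -> phi t <= phi hm by move=> tr; apply: hmax; rewrite inE.
have {}Ahm : nc hm <= r by move: Ahm; rewrite inE.
have p0 : nc (k 0) <= phi hm.
  apply: le_trans (hmax 0 _); last by rewrite nc0 ltW.
  by rewrite /phi nc0 expr0n /= mulr0 addr0.
apply: le_trans p0 _; move: Ahm; rewrite le_eqVlt => /orP[/eqP hr|hr].
  by rewrite /phi hr lerD2r; exact: kB.
exfalso.
have /ana0P[rho [N [rho0 W]]] := ak hm (ltW hr).
pose s := Num.min rho (r - nc hm).
have s0 : 0 < s by rewrite lt_min rho0 subr_gt0.
have srho : s <= rho by rewrite ge_min lexx.
have sr : nc hm + s <= r by rewrite -lerBrDl ge_min lexx orbT.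
(* The averaging error is set to half of the gain [eps * s ^+ 2], so that a strict contradiction
   survives. *)
have e' : 0 < eps * s ^+ 2 / 2 by rewrite divr_gt0 ?mulr_gt0 ?exprn_gt0.
have [q [t [q0 tr t0 avg]]] := circle_average s0 srho W e'.
rewrite addr0 in avg.
have qR : 0 < q%:R :> R by rewrite ltr0n.
have S1 : \sum_(j < q) phi (hm + t j) <= q%:R * phi hm.
  rewrite mulr_natl -[q in leRHS]card_ord -sumr_const; apply: ler_sum => j _.
  by apply: hmax; apply: le_trans (ncD _ _) _; rewrite tr.
have S2 : \sum_(j < q) phi (hm + t j) =
    \sum_(j < q) nc (k (hm + t j)) + eps * (q%:R * (nc hm ^+ 2 + s ^+ 2)).
  by rewrite big_split /= -mulr_sumr (average_sqr _ tr t0).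
have S3 : q%:R * nc (k hm) <= \sum_(j < q) nc (k (hm + t j)) + q%:R * (eps * s ^+ 2 / 2).
  rewrite -(ler_pM2l qR) mulrDr mulrA divff ?gt_eqF// mul1r in avg.
  exact: avg.
have : 0 < q%:R * (eps * s ^+ 2 / 2) by rewrite mulr_gt0.
move: S1; rewrite S2 /phi; move: S3.
set a := \sum_(j < q) _; set b := nc (k hm); move=> S3 S1 S4.
nra.
Qed.

End MaxModulus.

(** * Resolvents from reversible kernels with bounded row sums *)

Section Resolvent.
Variables (R : realType) (V : choiceType) (e : rel V).
Hypothesis Xgraph : graph_ax e.
Local Notation C := R[i].

Fixpoint gball (x : V) n : set V :=
  if n is n'.+1 then gball x n' `|` \bigcup_(y in gball x n') gnbr e y else [set x].

Lemma gball_finite x n : finite_set (gball x n).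
Proof.
have [_ _ _ fin _] := Xgraph; elim: n => [|n IH] /=; first exact: finite_set1.
by rewrite finite_setU; split=> //; apply: bigcup_finite => // y _; exact: fin.
Qed.

Lemma gball_last x p n y : gball x n y -> path e y p ->
  gball x (n + size p) (last y p).
Proof.
elim: p n y => [|a p IH] n y /=; first by rewrite addn0.
move=> By /andP[eya pe]; rewrite addnS -addSn; apply: IH => //=.
by right; exists y.
Qed.

(** A connected graph is the union of the balls around one vertex, which are finite by local
    finiteness. *)
Lemma vertices_countable : exists idx : V -> nat, injective idx.
Proof.
have [_ _ conn _ inf] := Xgraph.
have [x _] : [set: V] !=set0.
  by apply/set0P/eqP => E; apply: inf; rewrite E; exact: finite_set0.
have : countable [set: V].
  have -> : [set: V] = \bigcup_n gball x n.
    apply/seteqP; split=> // y _; have [p [pe lp _]] := conn x y.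
    exists (0 + size p)%N => //; rewrite -lp.
    exact: (@gball_last x p 0 x erefl pe).
  apply: bigcup_countable => // n _; apply: finite_set_countable.
  exact: gball_finite.
by move=> /countable_injP[f fi]; exists f => a b E; apply: fi; rewrite ?inE.
Qed.

Variable idx : V -> nat.
Hypothesis idx_inj : injective idx.

Definition en n : option V :=
  match pselect (exists x, idx x = n) with
  | left H => Some (projT1 (cid H))
  | right _ => None
  end.

Lemma enP n x : en n = Some x -> idx x = n.
Proof.
rewrite /en; case: pselect => // H [<-]; exact: (projT2 (cid H)).
Qed.

Lemma enK x : en (idx x) = Some x.
Proof.
rewrite /en; case: pselect => [H|H]; last by exfalso; apply: H; exists x.
by congr Some; apply: idx_inj; exact: (projT2 (cid H)).
Qed.

Definition vseq (phi : V -> C) n : C := if en n is Some x then phi x else 0.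
Definition vsum (phi : V -> C) : C := csum (vseq phi).
(** Bounding all finite sets of vertices makes absolute summability independent of the enumeration
    [idx]. *)
Definition vsm (phi : V -> C) (M : R) :=
  forall s, uniq s -> \sum_(y <- s) nc (phi y) <= M.

Definition trunc n : seq V := pmap en (iota 0 n).

Lemma uniq_trunc n : uniq (trunc n).
Proof.
apply: (pmap_uniq (g := idx)); last exact: iota_uniq.
by move=> k; case E : (en k) => [x|] //=; exact: enP.
Qed.

Lemma sum_vseq (T : nmodType) (G : C -> T) (phi : V -> C) n : G 0 = 0 ->
  \sum_(k < n) G (vseq phi k) = \sum_(y <- trunc n) G (phi y).
Proof.
move=> G0; rewrite -(big_mkord xpredT (fun k => G (vseq phi k))) /index_iota subn0.
rewrite /trunc; elim: (iota 0 n) => [|k r IH]; first by rewrite !big_nil.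
rewrite big_cons IH /= /vseq; case: (en k) => [x|] /=; first by rewrite big_cons.
by rewrite G0 add0r.
Qed.

Lemma vsm_summ phi M : vsm phi M -> summ (vseq phi) M.
Proof. by move=> H n; rewrite (sum_vseq _ _ (nc0 R)); apply: H; exact: uniq_trunc. Qed.

Lemma vsum_delta y (c : C) : vsum (fun t => (t == y)%:R * c) = c.
Proof.
rewrite /vsum (@csum_fin _ _ (idx y).+1).
  rewrite big_ord_recr /= big1 ?add0r; first by rewrite /vseq enK eqxx mul1r.
  move=> i _; rewrite /vseq; case E : (en i) => [x|//].
  case: eqP => [xy|_]; last by rewrite mul0r.
  by have := ltn_ord i; rewrite -(enP E) xy ltnn.
move=> k ky; rewrite /vseq; case E : (en k) => [x|//].
case: eqP => [xy|_]; last by rewrite mul0r.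
by move: ky; rewrite -(enP E) xy ltnn.
Qed.

Lemma vsm_delta y (c : C) : vsm (fun t => (t == y)%:R * c) (nc c).
Proof.
move=> s us; under eq_bigr do rewrite ncM nc_nat.
by rewrite sum_delta//; case: ifP => // _; exact: nc_ge0.
Qed.

Lemma vsum_fin (phi : V -> C) s : uniq s -> (forall y, y \notin s -> phi y = 0) ->
  vsum phi = \sum_(y <- s) phi y.
Proof.
move=> us H.
have E n : vseq phi n = \sum_(y <- s) vseq (fun t => (t == y)%:R * phi y) n.
  rewrite /vseq; case: (en n) => [x|]; last by rewrite big1.
  transitivity (\sum_(y <- s) (y == x)%:R * phi y); last first.
    by apply: eq_bigr => y _; rewrite eq_sym.
  by rewrite sum_delta//; case: ifP => // /negbT/H.
have -> : vsum phi = csum (fun n => \sum_(y <- s | y \in s)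
    vseq (fun t => (t == y)%:R * phi y) n).
  by congr csum; apply: funext => n; rewrite E big_seq.
rewrite (@csum_sum _ _ _ _ _ (\sum_(y <- s) nc (phi y))).
  by rewrite -big_seq; apply: eq_bigr => y _; exact: vsum_delta.
move=> y ys; apply: vsm_summ => r ur; apply: le_trans (vsm_delta y (phi y) ur) _.
by rewrite (bigD1_seq y)//= lerDl; apply: sumr_ge0 => t _; exact: nc_ge0.
Qed.

Lemma vsmM (k phi : V -> C) M B : vsm k M -> (forall y, nc (phi y) <= B) ->
  vsm (fun y => k y * phi y) (M * B).
Proof.
move=> Hk HB s us; have [->|] := eqVneq s [::].
  rewrite big_nil mulr_ge0//; first by have := Hk [::] isT; rewrite big_nil.
  have [_ _ _ _ inf] := Xgraph.
  have [x _] : [set: V] !=set0.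
    by apply/set0P/eqP => E; apply: inf; rewrite E; exact: finite_set0.
  exact: le_trans (nc_ge0 (phi x)) (HB x).
case: s us => // y0 s us _; have B0 := le_trans (nc_ge0 _) (HB y0).
apply: (@le_trans _ _ ((\sum_(y <- y0 :: s) nc (k y)) * B)).
  rewrite mulr_suml; apply: ler_sum => y _.
  by rewrite ncM ler_wpM2l ?nc_ge0.
by rewrite ler_wpM2r// Hk.
Qed.

Lemma vsumD phi chi M N : vsm phi M -> vsm chi N ->
  vsum (fun y => phi y + chi y) = vsum phi + vsum chi.
Proof.
move=> /vsm_summ Hp /vsm_summ Hc; rewrite /vsum -(csumD Hp Hc).
by congr csum; apply: funext => n; rewrite /vseq; case: (en n); rewrite ?addr0.
Qed.

Lemma vsumZ c phi M : vsm phi M -> vsum (fun y => c * phi y) = c * vsum phi.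
Proof.
move=> /vsm_summ Hp; rewrite /vsum -(csumZ _ Hp).
by congr csum; apply: funext => n; rewrite /vseq; case: (en n); rewrite ?mulr0.
Qed.

Lemma vsum_sum (I : Type) (r : seq I) (f : I -> V -> C) M :
  (forall i, vsm (f i) M) ->
  vsum (fun y => \sum_(i <- r) f i y) = \sum_(i <- r) vsum (f i).
Proof.
move=> H; rewrite /vsum -(@csum_sum _ _ _ _ _ M); last by move=> i _; exact: vsm_summ.
by congr csum; apply: funext => n; rewrite /vseq; case: (en n) => // ; rewrite big1.
Qed.

Lemma vsum_fubini (a : V -> V -> C) (k : V -> C) M B : 0 <= B ->
  (forall y, vsm (a y) (nc (k y) * B)) -> vsm k M ->
  vsum (fun u => vsum (a^~ u)) = vsum (fun y => vsum (a y)).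
Proof.
move=> B0 Ha Hk.
pose A n : nat -> C := if en n is Some y then vseq (a y) else fun=> 0.
have c0 : csum (fun=> 0 : C) = 0 by rewrite (@csum_fin _ _ 0%N) ?big_ord0.
transitivity (csum (fun j => csum (A^~ j))).
  congr csum; apply: funext => j; rewrite /A {1}/vseq /vsum.
  case Ej : (en j) => [u|].
    by congr csum; apply: funext => n; rewrite {1}/vseq; case: (en n) => // y; rewrite /vseq Ej.
  rewrite -[LHS]c0; congr csum; apply: funext => n.
  by case: (en n) => // y; rewrite /vseq Ej.
transitivity (csum (fun n => csum (A n))).
  apply: (@csum_fubini _ A (fun n => nc (vseq k n) * B) (M * B)) => n.
    move=> m; rewrite /A /vseq; case: (en n) => [y|].
      exact: (vsm_summ (Ha y)).
    by rewrite nc0 mul0r big1// => i _; rewrite nc0.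
  by rewrite -mulr_suml ler_wpM2r//; exact: (vsm_summ Hk).
congr csum; apply: funext => n; rewrite /A {2}/vseq /vsum.
by case: (en n).
Qed.

Local Notation m x := ((gdeg e x)%:R).

(** The norm bound without extended reals, tested on finite sets of vertices. *)
Definition l2sq (phi : V -> C) (L : R) :=
  forall s, uniq s -> \sum_(x <- s) m x * nc (phi x) ^+ 2 <= L.

Lemma l2sqP phi L : (l2norm2 e phi <= L%:E)%E <-> l2sq phi L.
Proof.
split=> H.
  move=> s us; rewrite -lee_fin; apply: le_trans H.
  rewrite /l2norm2; apply: esum_ge; exists [set` s].
    by split=> //; exact: finite_seq.
  by rewrite -fsbig_seq// sumEFin.
rewrite /l2norm2; apply: ub_ereal_sup => _ [X [fX _] <-].
rewrite fsbig_finite//= sumEFin lee_fin; apply: H; exact: fset_uniq.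
Qed.

Lemma l2sq_bounded phi L : l2sq phi L -> forall y, nc (phi y) <= 1 + L.
Proof.
move=> H y; have := H [:: y] isT; rewrite big_seq1.
have : 1 <= m y :> R by rewrite ler1n gdeg_gt0.
have := nc_ge0 (phi y); set t := nc _; set c : R := m y => t0 c1 H'.
have : t ^+ 2 <= c * t ^+ 2 by rewrite ler_peMl// sqr_ge0.
nra.
Qed.

Lemma l2_finite (phi : V -> C) : l2 e phi -> exists L, l2norm2 e phi = L%:E.
Proof.
move=> H; exists (fine (l2norm2 e phi)); rewrite fineK//.
rewrite ge0_fin_numE//; apply: esum_ge0 => x _; rewrite lee_fin.
by rewrite mulr_ge0 ?exprn_ge0 ?nc_ge0.
Qed.

Lemma weighted_cauchy_schwarz (I : Type) (s : seq I) (a b : I -> R) M : 0 < M ->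
  (forall i, 0 <= a i) -> \sum_(i <- s) a i <= M ->
  (\sum_(i <- s) a i * b i) ^+ 2 <= M * \sum_(i <- s) a i * b i ^+ 2.
Proof.
move=> M0 a0 aM; set T := \sum_(i <- s) a i * b i.
(* Expanding the nonnegative sum of [a i * (b i - t) ^+ 2]; dividing by [M] rather than by the total
   weight avoids a vanishing denominator. *)
pose t := T / M; have tM : T = t * M by rewrite /t divfK// gt_eqF.
have : 0 <= \sum_(i <- s) a i * (b i - t) ^+ 2.
  by apply: sumr_ge0 => i _; rewrite mulr_ge0// sqr_ge0.
have -> : \sum_(i <- s) a i * (b i - t) ^+ 2 =
  \sum_(i <- s) a i * b i ^+ 2 - 2 * t * T + t ^+ 2 * \sum_(i <- s) a i.
  rewrite /T !mulr_sumr -sumrB -big_split /=; apply: eq_bigr => i _; ring.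
move: aM; move: (\sum_(i <- s) a i) (\sum_(i <- s) a i * b i ^+ 2) => A Q AM.
rewrite tM => H.
have H2 : t ^+ 2 * A <= t ^+ 2 * M by rewrite ler_wpM2l// sqr_ge0.
have -> : (t * M) ^+ 2 = M * (t ^+ 2 * M) by ring.
rewrite ler_pM2l//; lra.
Qed.

Variables (z0 : C) (K : V -> V -> C) (M : R).
Hypotheses (z00 : z0 != 0) (M0 : 0 < M).
Hypothesis Krow : forall x, vsm (K x) M.
Hypothesis Krev : forall x y, m x * K x y = m y * K y x.
Hypothesis Keq : forall x y,
  K x y = (x == y)%:R + z0 * srw_op e (fun u => K u y) x.

Definition Kop (phi : V -> C) x : C := vsum (fun y => K x y * phi y).

Lemma nc_tends (u : nat -> C) l : tends u l ->
  ((fun n => nc (u n)) : nat -> R^o) @ \oo --> (nc l : R^o).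
Proof.
move=> H; apply/cvgrPdist_lt => eps e0; have [N HN] := H _ e0.
exists N => // n /= /HN; apply: le_lt_trans; rewrite ler_distl; apply/andP; split.
  have := ncD (u n - l) l; rewrite subrK; lra.
have := ncD (l - u n) (u n); rewrite subrK (ncBC l); lra.
Qed.

(* Schur's test on finite sections, followed by a passage to the limit. *)
Lemma Kop_l2sq phi L : l2sq phi L -> l2sq (Kop phi) (M ^+ 2 * L).
Proof.
move=> H s us.
have fin n : \sum_(x <- s) m x * nc (\sum_(y <- trunc n) K x y * phi y) ^+ 2 <=
    M ^+ 2 * L.
  apply: (@le_trans _ _ (\sum_(x <- s) \sum_(y <- trunc n)
      M * (nc (phi y) ^+ 2 * (m y * nc (K y x))))).
    apply: ler_sum => x _.
    apply: (@le_trans _ _ (m x * (M * \sum_(y <- trunc n) nc (K x y) * nc (phi y) ^+ 2))).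
      rewrite ler_wpM2l//; apply: (@le_trans _ _ ((\sum_(y <- trunc n) nc (K x y) * nc (phi y)) ^+ 2)).
        rewrite ler_pXn2r ?nnegrE ?nc_ge0//.
          by apply: le_trans (nc_sum _ _ _) _; apply: ler_sum => y _; rewrite ncM.
        by apply: sumr_ge0 => y _; rewrite mulr_ge0 ?nc_ge0.
      apply: weighted_cauchy_schwarz => //; first by move=> y; exact: nc_ge0.
      by apply: Krow; exact: uniq_trunc.
    rewrite !mulr_sumr; apply: ler_sum => y _.
    have /(congr1 (@nc R)) := Krev x y; rewrite !ncM !nc_nat => E.
    rewrite -E; move: (nc (K x y)) (nc (phi y)) (m x : R) => a b c.
    by have -> : c * (M * (a * b ^+ 2)) = M * (b ^+ 2 * (c * a)) by ring.
  rewrite exchange_big /=.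
  apply: (@le_trans _ _ (\sum_(y <- trunc n) M ^+ 2 * (m y * nc (phi y) ^+ 2))).
    apply: ler_sum => y _; rewrite -mulr_sumr [M ^+ 2]expr2 -mulrA ler_pM2l//.
    rewrite -mulr_sumr mulrC.
    have KM : \sum_(x <- s) nc (K y x) <= M by exact: Krow.
    rewrite -[X in X * _ <= _]mulr_sumr -[leLHS]mulrA [leRHS]mulrCA ler_wpM2l//.
    by rewrite ler_wpM2r ?exprn_ge0 ?nc_ge0.
  rewrite -mulr_sumr ler_wpM2l ?exprn_ge0 ?(ltW M0)//.
  by apply: H; exact: uniq_trunc.
have cv : (fun n => \sum_(x <- s) m x *
    nc (\sum_(y <- trunc n) K x y * phi y) ^+ 2 : R^o) @ \oo -->
    (\sum_(x <- s) m x * nc (Kop phi x) ^+ 2 : R^o).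
  elim: (s) => [|x s' IH].
    by under eq_fun do rewrite big_nil; rewrite big_nil; exact: cvg_cst.
  under eq_fun do rewrite big_cons; rewrite big_cons; apply: cvgD IH.
  have T : tends (fun n => \sum_(y <- trunc n) K x y * phi y) (Kop phi x).
    have := csumP (vsm_summ (vsmM (Krow x) (l2sq_bounded H))).
    move=> T eps e0; have [N HN] := T _ e0; exists N => n /HN.
    by rewrite (@sum_vseq _ id).
  apply: cvgM; first exact: cvg_cst.
  by rewrite expr2; under eq_fun do rewrite expr2; apply: cvgM; exact: nc_tends.
apply: (ler_cvg_to cv (cvg_cst (M ^+ 2 * L : R^o))).
by apply: nearW.
Qed.

(** [Keq] is summed against [phi] over the second variable; only the finite sum over neighbours is
    exchanged with the series. *)
Lemma Kop_right phi B : (forall y, nc (phi y) <= B) -> forall x,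
  Kop phi x - z0 * srw_op e (Kop phi) x = phi x.
Proof.
move=> HB x; have Hu u : vsm (fun y => K u y * phi y) (M * B) by exact: vsmM.
suff -> : Kop phi x = phi x + z0 * srw_op e (Kop phi) x by rewrite addrK.
rewrite (srw_opE Xgraph) -(vsum_sum (nb e x) Hu).
have Hs : vsm (fun y => \sum_(u <- nb e x) K u y * phi y) (\sum_(u <- nb e x) M * B).
  move=> s us; apply: le_trans (_ : \sum_(u <- nb e x) \sum_(y <- s) nc (K u y * phi y) <= _).
    by rewrite exchange_big /=; apply: ler_sum => y _; exact: nc_sum.
  by apply: ler_sum => u _; exact: Hu.
rewrite mulrA -(vsumZ _ Hs) -[phi x](vsum_delta x).
have Hs' : vsm (fun y => z0 * (m x)^-1 * \sum_(u <- nb e x) K u y * phi y)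
    (nc (z0 * (m x)^-1) * \sum_(u <- nb e x) M * B).
  move=> s us; under eq_bigr do rewrite ncM.
  by rewrite -[leLHS]mulr_sumr ler_wpM2l ?nc_ge0// Hs.
rewrite -(vsumD (vsm_delta x (phi x)) Hs'); congr vsum; apply: funext => y.
rewrite {1}Keq (srw_opE Xgraph) mulrDl -mulr_suml eq_sym -!mulrA; congr (_ + _).
by case: eqVneq => [->//|_]; rewrite !mul0r.
Qed.

(** Here the transition operator acts on the summed variable: Fubini moves it onto the kernel, and
    reversibility turns [Keq] into the transposed equation. *)
Lemma Kop_left phi B : (forall y, nc (phi y) <= B) -> forall x,
  Kop phi x - z0 * Kop (srw_op e phi) x = phi x.
Proof.
move=> HB x; have [sym _ _ _ _] := Xgraph.
have B0 : 0 <= B by apply: le_trans (HB x); exact: nc_ge0.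
pose a y u := K x y * ((m y)^-1 * ((e y u)%:R * phi u)).
have nbE (f : V -> C) y : vsum (fun u => (e y u)%:R * f u) = \sum_(u <- nb e y) f u.
  rewrite (@vsum_fin _ (nb e y)) ?uniq_nb//.
    by rewrite big_seq [RHS]big_seq; apply: eq_bigr => u; rewrite (mem_nb Xgraph) => ->; rewrite mul1r.
  by move=> u; rewrite (mem_nb Xgraph) => /negPf->; rewrite mul0r.
have vnb y : vsm (fun u => (e y u)%:R * phi u) (m y * B).
  move=> s us; apply: (@le_trans _ _ (\sum_(u <- s) (u \in nb e y)%:R * B)).
    apply: ler_sum => u _; rewrite ncM nc_nat (mem_nb Xgraph).
    by rewrite ler_wpM2l.
  rewrite -mulr_suml ler_wpM2r// -natr_sum ler_nat -size_nb.
  have -> : (\sum_(u <- s) (u \in nb e y))%N = size [seq u <- s | u \in nb e y].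
    rewrite size_filter -sum1_count [RHS]big_mkcond /=.
    by apply: eq_bigr => u _; case: (u \in _).
  apply: uniq_leq_size; first exact: filter_uniq.
  by move=> u; rewrite mem_filter => /andP[].
have E1 : Kop (srw_op e phi) x = vsum (fun y => vsum (a y)).
  congr vsum; apply: funext => y; rewrite (srw_opE Xgraph) -nbE.
  have vnb' : vsm (fun u => (m y)^-1 * ((e y u)%:R * phi u)) B.
    move=> s us; under eq_bigr do rewrite ncM ncV nc_nat.
    by rewrite -mulr_sumr mulrC ler_pdivrMr ?(gdegR_gt0 R Xgraph)// mulrC vnb.
  by rewrite /a (vsumZ _ vnb') (vsumZ _ (vnb y)).
have Ha y : vsm (a y) (nc (K x y) * B).
  move=> s us; under eq_bigr do rewrite ncM ncM ncV nc_nat.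
  rewrite -mulr_sumr ler_wpM2l ?nc_ge0// -mulr_sumr mulrC.
  by rewrite ler_pdivrMr ?(gdegR_gt0 R Xgraph)// mulrC vnb.
have Kphi : vsm (fun u => K x u * phi u) (M * B) by exact: vsmM.
rewrite E1 -(vsum_fubini B0 Ha (Krow x)).
(* The transposed equation: [Keq] for the column of [x] at [u], with [Krev] exchanging the two
   variables. *)
have E2 u : z0 * vsum (a^~ u) = K x u * phi u - (u == x)%:R * phi x.
  have -> : vsum (a^~ u) = (\sum_(y <- nb e u) K x y * (m y)^-1) * phi u.
    rewrite mulr_suml -nbE; congr vsum; apply: funext => y.
    by rewrite /a sym; ring.
  have -> : \sum_(y <- nb e u) K x y * (m y)^-1 =
      m u / m x * srw_op e (fun y => K y x) u.
    rewrite (srw_opE Xgraph) mulrA [m u / m x * _]mulrAC divff ?(gdegC_neq0 R Xgraph)//.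
    rewrite mul1r mulr_sumr; apply: eq_bigr => y _; apply: (mulfI (gdegC_neq0 R Xgraph x)).
    rewrite mulrA Krev mulrAC divff ?(gdegC_neq0 R Xgraph)// mul1r mulrA.
    by rewrite divff ?(gdegC_neq0 R Xgraph)// mul1r.
  have := Keq u x; set P := srw_op _ _ _ => E.
  have {}E : z0 * P = K u x - (u == x)%:R by rewrite E; ring.
  have -> : z0 * (m u / m x * P * phi u) = m u / m x * (z0 * P) * phi u.
    by move: (m u / m x : C) => q; ring.
  rewrite E mulrBr mulrBl [m u / m x * K u x]mulrAC -Krev.
  rewrite [m x * _ / _]mulrAC divff ?(gdegC_neq0 R Xgraph)// mul1r; congr (_ - _).
  case: eqVneq => [->|_]; last by rewrite mulr0 !mul0r.
  by rewrite divff ?(gdegC_neq0 R Xgraph)// !mul1r.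
have V1 : vsm (fun u => - ((u == x)%:R * phi x)) (nc (phi x)).
  by move=> s us; under eq_bigr do rewrite ncN; exact: vsm_delta.
rewrite -[RHS](vsum_delta x) -(@vsumZ _ _ (nc z0^-1 * (M * B + nc (phi x)))).
  under eq_fun do rewrite E2.
  rewrite (vsumD Kphi V1).
  have -> : vsum (fun u => - ((u == x)%:R * phi x)) = - phi x.
    by under eq_fun do rewrite -mulrN; rewrite vsum_delta.
  by rewrite opprD opprK addNKr vsum_delta.
move=> s us; have E3 u : vsum (a^~ u) = z0^-1 * (K x u * phi u - (u == x)%:R * phi x).
  by rewrite -E2 mulKf.
under eq_bigr do rewrite E3 ncM; rewrite -[leLHS]mulr_sumr ler_wpM2l ?nc_ge0//.
apply: le_trans (lerD (Kphi s us) (V1 s us)); rewrite -big_split /=.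
by apply: ler_sum => u _; exact: ncD.
Qed.

(** [Keq] says that [K] inverts [1 - z0 P], so [z0 * K] inverts [z0^-1 - P]; square summable
    functions are bounded, which legitimates the sums. *)
Lemma resolvent_of_kernel : ~ specP e (z0^-1).
Proof.
apply; pose T phi x := z0 * Kop phi x.
have bd (phi : V -> C) : l2 e phi -> exists B, forall y, nc (phi y) <= B.
  move=> /l2_finite[L E]; exists (1 + L); apply: l2sq_bounded; apply/l2sqP.
  by rewrite E.
have Tn (phi : V -> C) : l2 e phi ->
    (l2norm2 e (T phi) <= (nc z0 ^+ 2 * M ^+ 2)%:E * l2norm2 e phi)%E.
  move=> /l2_finite[L E]; rewrite E -EFinM; apply/l2sqP => s us.
  have /Kop_l2sq/(_ s us) H : l2sq phi L by apply/l2sqP; rewrite E.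
  rewrite /T; under eq_bigr do rewrite ncM exprMn mulrCA.
  by rewrite -[leLHS]mulr_sumr -[leRHS]mulrA ler_wpM2l ?exprn_ge0 ?nc_ge0.
exists T; split; first split.
- move=> phi lp; rewrite /l2 /=; apply: le_lt_trans (Tn _ lp) _.
  by have [L ->] := l2_finite lp; rewrite -EFinM ltry.
- move=> a phi chi /bd[B1 H1] /bd[B2 H2]; apply: funext => x.
  have V1 := vsmM (Krow x) H1; have V2 := vsmM (Krow x) H2.
  have V3 : vsm (fun y => a * (K x y * phi y)) (nc a * (M * B1)).
    move=> s us; under eq_bigr do rewrite ncM.
    by rewrite -[leLHS]mulr_sumr ler_wpM2l ?nc_ge0// V1.
  rewrite /T /Kop mulrCA -mulrDr -(vsumZ _ V1) -(vsumD V3 V2); congr (_ * vsum _).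
  by apply: funext => y; rewrite mulrDr mulrCA.
- by exists (nc z0 ^+ 2 * M ^+ 2).
- move=> phi /bd[B HB]; apply: funext => x; rewrite /T.
  have HP y : nc (srw_op e phi y) <= B by apply: srw_op_le.
  have V1 := vsmM (Krow x) HB; have V2 := vsmM (Krow x) HP.
  rewrite -[RHS](Kop_left HB) /Kop.
  have V3 : vsm (fun y => - z0 * (K x y * srw_op e phi y)) (nc (- z0) * (M * B)).
    move=> s us; under eq_bigr do rewrite ncM.
    by rewrite -[leLHS]mulr_sumr ler_wpM2l ?nc_ge0// V2.
  have V4 : vsm (fun y => K x y * (z0^-1 * phi y - srw_op e phi y)) (M * (nc z0^-1 * B + B)).
    apply: vsmM => // y; apply: le_trans (ncD _ _) _.
    by rewrite ncN ncM lerD ?ler_wpM2l ?nc_ge0.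
  rewrite -mulNr -(vsumZ _ V2) -(vsumD V1 V3) -(vsumZ _ V4); congr vsum.
  apply: funext => y; rewrite mulrBr mulrBr mulNr; congr (_ - _).
  by rewrite mulrCA mulVKf.
- move=> phi /bd[B HB]; apply: funext => x; rewrite /T mulKf//.
  rewrite -[RHS](Kop_right HB); congr (_ - _).
  by rewrite !(srw_opE Xgraph) -mulr_sumr mulrCA.
Qed.

End Resolvent.

(** * The continued Green kernel outside the singular set *)

Section Spectrum.
Variables (R : realType) (V : choiceType) (e : rel V) (F : set V) (C : set V).
Variables (v w : V).
Hypotheses (Xgraph : graph_ax e) (Xsym : symmetrically_self_similar e F).
Hypotheses (Ccell : cells e F C) (Cv : theta e C v) (Cw : theta e C w).
Hypothesis neq_vw : v <> w.
Variable psi : V -> V.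
Hypothesis psi_bij : set_bij setT F psi.
Hypothesis psi_adj : forall x y, e x y <-> reduced_adj e F (psi x) (psi y).
Variable iso_to : set V -> V -> V.
Hypothesis iso_toP : forall D, cells e F D -> cell_iso e C D (iso_to D).
Local Notation cs := (csphere R).
Local Notation dmap := (rat_map (d_fun R e C v w)).
Local Notation A0 := (immediate_basin0 dmap).
Local Notation D := (@exceptional_set R V e C v w).
Local Notation S := (@green_singularities R V e A0).
Local Notation g0 := (@g0 R V e F C v w psi iso_to).

Variable G : V -> V -> cs -> R[i].
Hypothesis Gcont : forall x y, continuation (green e x y) (A0 `\` S) (G x y).
Hypothesis Gg0 : forall x y z, A0 z -> ~ D z -> G x y z = g0 x y z.

Let AS_disc : @disc R `<=` A0 `\` S.
Proof. exact: (AS_disc Xgraph Xsym Ccell Cv Cw neq_vw psi_bij psi_adj iso_toP). Qed.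

Let AS_connected : connected (A0 `\` S).
Proof. exact: (AS_connected Xgraph Xsym Ccell Cv Cw neq_vw psi_bij psi_adj iso_toP). Qed.

Lemma continued_analytic x y z : (A0 `\` S) z -> analytic_at (G x y) z.
Proof. by have [_ _ H _] := Gcont x y; exact: H. Qed.

Lemma continued_disc x y (c : R[i]) : nc c < 1 -> G x y (Some c) = green e x y c.
Proof.
by move=> c1; have [_ _ _ ->//] := Gcont x y; rewrite norm_nc -[1]/(1%:C) ltcR.
Qed.

Lemma continued_rev x y z : (A0 `\` S) z ->
  (gdeg e x)%:R * G x y z = (gdeg e y)%:R * G y x z.
Proof.
move=> ASz.
have a x' y' t : (A0 `\` S) t -> analytic_at (fun z => (gdeg e x')%:R * G x' y' z) t.
  by move=> ASt; apply: ana0M (ana0_cst _) _; exact: continued_analytic.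
apply: (identity_principle AS_connected (a x y) (a y x) (z0 := Some 0)) => //.
  exact/AS_disc/disc0.
by apply: nbhs0_disc => c c1; rewrite !continued_disc//; exact: green_rev.
Qed.

Lemma continued_eq x y (z0 : R[i]) : (A0 `\` S) (Some z0) ->
  G x y (Some z0) = (x == y)%:R + z0 * srw_op e (fun u => G u y (Some z0)) x.
Proof.
move=> ASz; pose cval (z : cs) : R[i] := if z is Some c then c else 0.
pose g z := (x == y)%:R + cval z * srw_op e (fun u => G u y z) x.
(* The identity contains the coordinate [z] itself, which has a pole at infinity; that point is
   removed before the identity principle is applied. *)
have cU : connected ((A0 `\` S) `\ None).
  apply: connected_minus => //; first by have [oU _ _ _] := Gcont x y.
  by move=> z _; exact: punct_neq.
rewrite -[RHS]/(g (Some z0)).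
apply: (identity_principle cU _ _ (z0 := Some 0)) => //.
- by move=> z [ASz' _]; exact: continued_analytic.
- move=> [c|] [ASc nN]; last by case: nN.
  have : ana0 (fun h : R[i] => (x == y)%:R + (c + h) * ((gdeg e x)%:R^-1 *
      \sum_(u <- nb e x) G u y (csphere_chart (Some c) h))).
    apply: ana0D (ana0_cst _) (ana0M _ (ana0M (ana0_cst _) _)).
      exact: ana0D (ana0_cst _) (@ana0_id R).
    by apply: ana0_sum => u _; exact: continued_analytic.
  by apply: ana0_eq (ltr01) _ => h _; rewrite /g (srw_opE Xgraph).
- by split=> //; exact/AS_disc/disc0.
- apply: nbhs0_disc => c c1; rewrite /g /= continued_disc// (green_eq Xgraph x y c1).
  by congr (_ + _ * srw_op _ _ _); apply: funext => u; rewrite continued_disc.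
Qed.

(** The point may lie in [D], where the recursion gives no bound; the bound comes from a circle
    around it that avoids [D]. *)
Lemma continued_row (z0 : R[i]) : (A0 `\` S) (Some z0) ->
  exists2 M, 0 < M & forall x (s : seq V), uniq s ->
    \sum_(y <- s) nc (G x y (Some z0)) <= M.
Proof.
move=> ASz; have [Az _] := ASz.
have [n dn] := basin_iter (A0_sub_basin Az).
have [A [m [d [A0' d0 HG]]]] := row_bound_growth Xgraph Xsym Ccell Cv Cw neq_vw
  psi_bij iso_toP dn.
have [r1 r10 H1] : punct (Some z0 : cs) (fun t => disc (iter n dmap t) /\ ~ D t).
  apply: punctI; last exact: (D_punct Xgraph Xsym Ccell Cv Cw neq_vw).
  exact/nbhs_punct/iter_nbhs/nbhs_disc.
have [r2 r20 H2] : exists2 r : R, 0 < r &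
    forall h, nc h < r -> (A0 `\` S) (csphere_chart (Some z0) h).
  apply/nbhs_chart; apply: open_nbhs_nbhs; split=> //.
  by have [oU _ _ _] := Gcont v v.
(* Half of the minimum keeps the closed disc inside the regions where the growth bound, the absence
   of [D] off the centre and analyticity hold. *)
pose r := Num.min d (Num.min r1 r2) / 2.
have m0 : 0 < Num.min d (Num.min r1 r2) by rewrite !lt_min d0 r10.
have r0 : 0 < r by rewrite divr_gt0.
have : r < Num.min d (Num.min r1 r2) by rewrite ltr_pdivrMr// ltr_pMr// ltr1n.
rewrite !lt_min => /and3P[rd rr1 rr2].
have B0 : 0 <= A * r^-1 ^+ m by rewrite mulr_ge0// exprn_ge0// invr_ge0 ltW.
exists (A * r^-1 ^+ m + 1); first by rewrite ltr_wpDl.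
move=> x s us; apply: (@le_trans _ _ (A * r^-1 ^+ m)); last by rewrite lerDl.
have /choice[u Hu] : forall y, exists u : R[i], nc u <= 1 /\
    u * G x y (Some z0) = (nc (G x y (Some z0)))%:C.
  by move=> y; have [u ? ?] := phase (G x y (Some z0)); exists u.
(* The phases are chosen at [z0] and then kept fixed, so [k] is analytic, equals the sum of moduli
   at the centre and is dominated by the row sum on the circle. *)
pose k (h : R[i]) := \sum_(y <- s) u y * G x y (Some (z0 + h)).
have -> : \sum_(y <- s) nc (G x y (Some z0)) = nc (k 0).
  rewrite /k addr0; under [in RHS]eq_bigr do rewrite (Hu _).2.
  by rewrite -rmorph_sum nc_real ger0_norm//; apply: sumr_ge0 => y _; exact: nc_ge0.
apply: (max_modulus r0) => [h0 hr|h hr].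
  have : ana0 (fun h => \sum_(y <- s) u y * G x y (csphere_chart (Some (z0 + h0)) h)).
    apply: ana0_sum => y _; apply: ana0M (ana0_cst _) _.
    by apply: continued_analytic; apply: (H2 h0); exact: le_lt_trans hr rr2.
  by apply: ana0_eq (ltr01) _ => h _; rewrite /k /= addrA.
have h0 : h != 0 by rewrite -nc_gt0 hr.
rewrite -hr in rd rr1 rr2 *.
have [dh nDh] := H1 h h0 rr1; have [Ah _] := H2 h rr2.
apply: le_trans (HG h h0 rd x s us); apply: le_trans (nc_sum _ _ _) _.
apply: ler_sum => y _; rewrite ncM -[leRHS]mul1r.
rewrite Gg0// (g0E Xgraph Xsym Ccell Cv Cw neq_vw psi_bij psi_adj iso_toP x y dh).
by rewrite ler_wpM2r ?nc_ge0 ?(Hu y).1.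
Qed.

Lemma continued_not_spec (z0 : R[i]) : (A0 `\` S) (Some z0) -> z0 != 0 ->
  ~ specP e z0^-1.
Proof.
move=> ASz z00; have [M M0 Krow] := continued_row ASz.
have [idx idx_inj] := vertices_countable Xgraph.
apply: (@resolvent_of_kernel R V e Xgraph idx idx_inj z0
  (fun x y => G x y (Some z0)) M z00 M0) => // x y.
- exact: continued_rev.
- exact: continued_eq.
Qed.

End Spectrum.

(* Assembly of the continuation and spectral statements *)
Local Close Scope ring_scope.

Theorem theorem7p2 (R : realType) (V : choiceType) (e : rel V) (F : set V)
    (C : set V) (v w : V)
    (Xgraph : graph_ax e) (Xsym : symmetrically_self_similar e F)
    (Ccell : cells e F C) (Cv : theta e C v) (Cw : theta e C w)
    (neq_vw : v <> w) :
  let A0 := immediate_basin0 (rat_map (d_fun R e C v w)) in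
  let D : set (csphere R) := exceptional_set e C v w in
  let S := green_singularities e A0 in
  [/\ forall x y : V, unique_continuation (green e x y) (A0 `\` S),
      A0 `\` D `<=` A0 `\` S,
      spec_invP e `\ None `<=` ~` (A0 `\` S) &
      ~` (A0 `\` S) `<=` ~` (A0 `\` closure D)].
Proof.
move=> A0 D S.
have [[_ _ [psi [psi_bij psi_adj]]] [_ isos] _] := Xsym.
have /choice[iso_to iso_toP] : forall E, exists alpha, cells e F E -> cell_iso e C E alpha.
  move=> E; have [cE|nE] := pselect (cells e F E); last by exists id.
  by have [alpha ?] := isos C E Ccell cE; exists alpha.
have SD := S_sub_D Xgraph Xsym Ccell Cv Cw neq_vw psi_bij psi_adj iso_toP.
have GC := global_continuation R Xgraph Xsym Ccell Cv Cw neq_vw psi_bij psi_adj iso_toP.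
have ADS : A0 `\` D `<=` A0 `\` S by move=> z [Az nDz]; split=> // /SD.
split=> //.
- move=> x y; have [g [gc _]] := GC x y; exists g => // g' gc' z ASz.
  exact: (continuation_unique Xgraph Xsym Ccell Cv Cw neq_vw psi_bij psi_adj iso_toP gc gc').
- have /choice[G HG] : forall p : V * V, exists g : csphere R -> R[i],
      continuation (green e p.1 p.2) (A0 `\` S) g /\
      forall z, A0 z -> ~ D z -> g z = @g0 R V e F C v w psi iso_to p.1 p.2 z.
    by move=> p; exact: GC.
  move=> z [[lambda spec <-]]; rewrite /csphere_inv.
  (* The eigenvalue parameter 0 corresponds to [None], which has been removed from the left-hand
     side. *)
  case: eqVneq => [_|l0 _ ASz]; first by case.
  have := @continued_not_spec R V e F C v w Xgraph Xsym Ccell Cv Cw neq_vw psi psi_bij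
    psi_adj iso_to iso_toP (fun x y => G (x, y)) (fun x y => (HG (x, y)).1)
    (fun x y => (HG (x, y)).2) _ ASz.
  by rewrite invr_eq0 invrK; apply.
- move=> z nAS [Az nDz]; apply: nAS; apply: ADS; split=> // Dz.
  by apply: nDz; exact: subset_closure.
Qed.
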